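(* Let $n\ge2$. There are constants $\epsilon=\epsilon_n>0$ and $K=K(n)$ such that for every sequence of positive integers $d_0<d_1<d_2<\cdots$ with $d_{k+1}>Kd_k$ for all $k$, there are clopen partitions $\mathcal{R}^m_k$ ($1\le k\le m$) of $F(2^{\mathbb{Z}^n})$ satisfying the orthogonality properties with constant $\epsilon$ for the distances $d_k$, such that, with $\mathcal{R}_m=\mathcal{R}^m_1$, for every $m\ge 1$ each region $R$ of the partition $\mathcal{R}_m$ is connected and its boundary $\partial R$ is connected; in fact each region $R$ of $\mathcal{R}_m$ is homeomorphic to the closed unit ball in $\mathbb{R}^n$.
   Context: $\mathbb{Z}^n$ acts on $2^{\mathbb{Z}^n}$ by $(g\cdot x)(h)=x(g+h)$, and $F(2^{\mathbb{Z}^n})=\{x:\forall g\in\mathbb{Z}^n\setminus\{0\},\ g\cdot x\ne x\}$. $\rho$ denotes the distance on orbits induced from $\mathbb{Z}^n$ ($\infty$ between different orbits); distances between sets are infima. A clopen partition $\mathcal{R}$ of $F(2^{\mathbb{Z}^n})$ here is a partition into finite subsets of orbits (called regions) such that for each $g\in\mathbb{Z}^n$ the set of $x$ for which $x$ and $g\cdot x$ lie in the same region is relatively clopen in $F(2^{\mathbb{Z}^n})$. A rectangle is a set of the form $A\cdot y$ with $A=\mathbb{Z}^n\cap\prod_i[a_i,b_i]$. Regions (finite unions of rectangles in an orbit $[y]$) are regarded as subsets of $\mathbb{R}^n$ in the obvious way: identify $[y]$ with $\mathbb{Z}^n$ via $g\cdot y\leftrightarrow g$ and replace a region by the union of the closed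 unit cubes $g+[0,1]^n$; connectedness, boundary and homeomorphism type are understood for these subsets of $\mathbb{R}^n$. A face of a region is a maximal connected flat piece of its boundary perpendicular to one of the coordinate directions $e_1,\dots,e_n$; two faces are parallel if they are perpendicular to the same $e_i$. Orthogonality properties of the family $\mathcal{R}^m_k$ ($1\le k\le m$), with constant $\epsilon$: (1) (bounded geometry) $\mathcal{R}^m_k$ is a clopen partition, and each region in $\mathcal{R}^m_k$ is a finite disjoint union of rectangles with side lengths between $\frac12d_k$ and $d_k$; (2) (orthogonality to previous regions) any face $F$ of a region in $\mathcal{R}^m_k$ is at distance at least $\epsilon d_k$ from any parallel face $F'$ of a region in $\mathcal{R}^j_k$, for any $k\le j<m$; (3) (orthogonality to same regions) any face $F$ of a region in $\mathcal{R}^m_k$ is at distance at least $\epsilon d_k$ from any parallel face $F'$ of a region in $\mathcal{R}^m_k$ unless $\rho(F,F')\le1$. *)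

(* Defs.v *)
From mathcomp Require Import all_boot all_order all_algebra.
From mathcomp Require Import all_classical all_reals all_analysis.

Set Implicit Arguments.
Unset Strict Implicit.
Unset Printing Implicit Defensive.

Import Order.TTheory GRing.Theory Num.Theory.
Import numFieldNormedType.Exports.

Local Open Scope classical_set_scope.
Local Open Scope ring_scope.

(* The space 2^(Z^n): the product topology over discrete bool. *)
Definition config (n : nat) := {ptws 'rV[int]_n -> bool}.

Definition act (n : nat) (g : 'rV[int]_n) (x : config n) : config n :=
  fun h => x (g + h).

Definition free_part (n : nat) : set (config n) :=
  [set x | forall g : 'rV[int]_n, g != 0 -> act g x <> x].

Definition Zn_orbit (n : nat) (y : config n) : set (config n) :=
  [set act g y | g in [set: 'rV[int]_n]].

(* [subspace A] carries the relative topology on A and makes the points outside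
   A isolated, so for subsets of A [clopen] means relatively clopen in A. *)
Definition clopen_partition (n : nat) (P : set (set (config n))) : Prop :=
  [/\ partition P id (@free_part n),
      forall Q, P Q -> finite_set Q /\ exists y, Q `<=` Zn_orbit y
    & forall g : 'rV[int]_n,
        clopen ([set x | exists2 Q, P Q & Q x /\ Q (act g x)]
                : set (subspace (@free_part n)))].

(* The side lengths of the box prod_i [a_i, b_i] are the numbers b_i - a_i. *)
Definition rectangle_between (n d : nat) (Q : set (config n)) : Prop :=
  exists (y : config n) (a b : 'rV[int]_n),
    Q = [set act g y | g in
          [set g : 'rV[int]_n | forall i, a 0 i <= g 0 i <= b 0 i]] /\
    forall i, d%:Z <= 2 * (b 0 i - a 0 i) /\ b 0 i - a 0 i <= d%:Z.

Definition disjoint_union_of_rectangles (n d : nat) (Q : set (config n)) : Prop :=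
  exists (N : nat) (B : 'I_N -> set (config n)),
    [/\ forall k, rectangle_between d (B k),
        trivIset setT B
      & Q = \bigcup_k B k].

Section Geometry.
Variables (R : realType) (n : nat).
Implicit Types (A B P X : set 'rV[R]_n) (Q : set (config n)) (y : config n).

Definition unit_cube (g : 'rV[int]_n) : set 'rV[R]_n :=
  [set p | forall i, (g 0 i)%:~R <= p 0 i <= (g 0 i)%:~R + 1].

(* The subset of R^n attached to Q when the orbit of y is identified with Z^n
   by g . y <-> g.  Changing y within its orbit translates it by an integer
   vector. *)
Definition realization y Q : set 'rV[R]_n :=
  \bigcup_(g in [set g | Q (act g y)]) unit_cube g.

Definition boundary X : set 'rV[R]_n := closure X `\` interior X.

Definition hyperplane (i : 'I_n) (c : R) : set 'rV[R]_n := [set p | p 0 i = c].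

(* P lies in a hyperplane perpendicular to e_i and is genuinely
   (n-1)-dimensional there: it is contained in the closure of its interior
   relative to the hyperplane.  Without this condition, the section of X's
   boundary by a hyperplane crossing X would also count as flat. *)
Definition flat_piece (i : 'I_n) X P : Prop :=
  exists c : R,
    P `<=` boundary X `&` hyperplane i c /\
    P `<=` closure [set p | P p /\ within (hyperplane i c) (nbhs p) P].

Definition face (i : 'I_n) X P : Prop :=
  [/\ P !=set0, flat_piece i X P, connected P
    & forall P', flat_piece i X P' -> connected P' -> P `<=` P' -> P' = P].

(* The norm on 'rV[R]_n is the sup norm. *)
Definition set_dist A B : \bar R :=
  ereal_inf [set (`|p - q|)%:E | p in A & q in B].

Definition closed_unit_ball : set 'rV[R]_n :=
  [set p | \sum_(i < n) p 0 i ^+ 2 <= 1].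

End Geometry.

Arguments realization R {n} y Q.
Arguments closed_unit_ball R n : clear implicits.

Definition homeomorphic (T U : topologicalType) (A : set T) (B : set U) : Prop :=
  exists (f : T -> U) (g : U -> T),
    [/\ {within A, continuous f}, {within B, continuous g},
        forall x, A x -> B (f x) /\ g (f x) = x
      & forall y, B y -> A (g y) /\ f (g y) = y].

Section Orthogonality.
Variables (R : realType) (n : nat).
Variables (eps : R) (d : nat -> nat) (P : nat -> nat -> set (set (config n))).

(* The superscript comes first: P m k is R^m_k. *)

Definition bounded_geometry (m k : nat) : Prop :=
  clopen_partition (P m k) /\
  forall Q, P m k Q -> disjoint_union_of_rectangles (d k) Q.

(* The distance between subsets of different orbits is infinite, so only
   regions in a common orbit are constrained; both are then realized in
   R^n with the same base point. *)

Definition orthogonal_to_previous (m k : nat) : Prop :=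
  forall j : nat, (k <= j < m)%N ->
  forall (y : config n) (Q Q' : set (config n)),
    P m k Q -> P j k Q' -> Q `<=` Zn_orbit y -> Q' `<=` Zn_orbit y ->
  forall (i : 'I_n) (F F' : set 'rV[R]_n),
    face i (realization R y Q) F -> face i (realization R y Q') F' ->
    ((eps * (d k)%:R)%:E <= set_dist F F')%E.

Definition orthogonal_to_same (m k : nat) : Prop :=
  forall (y : config n) (Q Q' : set (config n)),
    P m k Q -> P m k Q' -> Q `<=` Zn_orbit y -> Q' `<=` Zn_orbit y ->
  forall (i : 'I_n) (F F' : set 'rV[R]_n),
    face i (realization R y Q) F -> face i (realization R y Q') F' ->
    ~ (set_dist F F' <= 1%:E)%E ->
    ((eps * (d k)%:R)%:E <= set_dist F F')%E.

Definition orthogonality_properties : Prop :=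
  forall m k : nat, (1 <= k <= m)%N ->
    [/\ bounded_geometry m k,
        orthogonal_to_previous m k
      & orthogonal_to_same m k].

End Orthogonality.

(* Main.v *)
(** A locally constant map lam from the free part to Z^n partitions every orbit
    into the fibres of the colouring g |-> g + lam (g . x); the faces of the
    regions are walls, i.e. places where the colouring changes between
    neighbouring lattice points.  For each scale there are clopen sets of
    markers, separated and syndetic, and any quantity that must avoid
    boundedly many bounded intervals, also near the values chosen at
    neighbouring markers, can be chosen greedily in a locally constant way.

    For fixed d consider scales B_0 << B_1 << ... and build partitions F m j of
    label m at level j <= m.  F m m consists of boxes cut out by cubes around
    the markers of scale B_m.  F m j is obtained from F m (j+1) by moving its
    walls away from those of F i j, j <= i < m.  Near a given point only one
    hyperplane x_t = c contains the old t-walls; over the base of the cube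
    around each marker z it is raised to c + beta z, so that the region below
    is extruded through the region above.  The new walls are either the tops
    x_t = c + beta z or the sides of the cubes, and beta and the sizes of the
    cubes are chosen to avoid all other walls.  After one such step for each
    direction t no old wall is left in place.  An extrusion is induced by a
    homeomorphism of R^n, provided that no other wall meets the top or the
    sides of the block; hence all regions remain balls.  Then R^m_k consists of
    the regions of F (m-k) 0, so distinct k do not interact and it
    is enough that d_k >= 2. *)

(* The obstacle is the number of earlier partitions. Label [m] has to keep away from all labels
   [i < m], whereas a greedy choice copes only with a number of forbidden intervals that is fixed
   before the scale is. This is what the levels are for. For [j < i], every wall of [F i j] is
   within 8 B_j of a wall of [F i (j+1)], and at level [j+1] parallel walls of different labels are
   more than 50 B_j apart. So near a given point each direction of walls at level [j+1] brings in at
   most one label. Together with label [j], whose boxes are new at level [j], at most [n + 1] labels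
   matter there, and the number of forbidden values depends on [n] only.

   Three lengths occur at each level: [s], the separation to be achieved, [bb], which bounds the
   heights of the blocks, and [B], the mesh of the cubes. They are fixed in this order, each from a
   count times the one before.

   Freeness enters through [priority], which gives points of an orbit at bounded distance different
   natural numbers in a locally constant way. Greedy choices are recursions along it.

   Balls are followed as images of a fixed ball under homeomorphisms of the whole space: these
   compose with extrusions and carry the sphere to the boundary. *)
Require Import Defs.
From mathcomp Require Import all_boot all_order all_algebra.
From mathcomp Require Import all_classical all_reals all_analysis.
From mathcomp Require Import zify ring lra.

Import Order.TTheory GRing.Theory Num.Theory.
Import numFieldNormedType.Exports.

Set Implicit Arguments.
Unset Strict Implicit.
Unset Printing Implicit Defensive.

Local Open Scope classical_set_scope.
Local Open Scope ring_scope.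

(** * Integer lattice *)

Section Lattice.
Variable n : nat.
Notation Z := 'rV[int]_n.
Implicit Types (g h u v z : Z) (l t : 'I_n) (r : int).

Definition nearby r g := forall l, - r <= g 0 l <= r.

Definition upd g t (c : int) : Z := \row_l (if l == t then c else g 0 l).

Definition dn l g : Z := upd g l (g 0 l - 1).

Lemma updE g t c l : upd g t c 0 l = if l == t then c else g 0 l.
Proof. by rewrite mxE. Qed.

Lemma dnE l g k : dn l g 0 k = if k == l then g 0 l - 1 else g 0 k.
Proof. by rewrite updE. Qed.

Lemma addE g h l : (g + h) 0 l = g 0 l + h 0 l.
Proof. by rewrite mxE. Qed.

Lemma subE g h l : (g - h) 0 l = g 0 l - h 0 l.
Proof. by rewrite !mxE. Qed.

Lemma oppE g l : (- g) 0 l = - g 0 l.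
Proof. by rewrite mxE. Qed.

Definition latE := (addE, subE, oppE, dnE, updE).

Lemma latP g h : (forall l, g 0 l = h 0 l) -> g = h.
Proof. by move=> e; apply/rowP. Qed.

Lemma dnD l g h : dn l (g + h) = dn l g + h.
Proof. by apply: latP => k; rewrite !latE; case: eqP => // ->; lia. Qed.

Lemma updD g h t c : upd (g + h) t (c + h 0 t) = upd g t c + h.
Proof. by apply: latP => k; rewrite !latE; case: eqP => // ->. Qed.

Lemma nearby_le r r' g : r <= r' -> nearby r g -> nearby r' g.
Proof. by move=> le H l; have := H l; lia. Qed.

Lemma nearby_opp r g : nearby r g -> nearby r (- g).
Proof. by move=> H l; have := H l; rewrite oppE; lia. Qed.

Lemma nearby_sym r g h : nearby r (g - h) -> nearby r (h - g).
Proof. by move=> /nearby_opp; rewrite opprB. Qed.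

Lemma nearby_add r r' g h : nearby r g -> nearby r' h -> nearby (r + r') (g + h).
Proof. by move=> H H' l; have := H l; have := H' l; rewrite addE; lia. Qed.

Lemma nearby0 r : 0 <= r -> nearby r 0.
Proof. by move=> r0 l; rewrite mxE; lia. Qed.

Definition win (r : nat) : seq Z :=
  [seq \row_l ((f l : nat)%:Z - r%:Z) | f : {ffun 'I_n -> 'I_(2 * r).+1}].

Lemma mem_win (r : nat) g : g \in win r <-> nearby r%:Z g.
Proof.
split.
  move=> /mapP [f _ ->] l; rewrite mxE; move: (nat_of_ord _) (ltn_ord (f l)) => k. lia.
move=> H; apply/mapP.
exists [ffun l : 'I_n => inord (absz (g 0 l + r%:Z))]; first by rewrite mem_enum.
apply: latP => l; rewrite mxE ffunE inordK; have := H l; lia.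
Qed.

(** A window is finite, so sizes that suffice at its single points have a common upper bound. This
    turns pointwise statements, such as freeness or continuity, into one size for a whole window. *)
Lemma win_bound (r : int) (P : Z -> nat -> Prop) :
  (forall g k k', (k <= k')%N -> P g k -> P g k') ->
  (forall g, nearby r g -> exists k, P g k) ->
  exists k, forall g, nearby r g -> P g k.
Proof.
move=> mono ex.
have [k Hk] : exists k, forall g, g \in win (absz r) -> nearby r g -> P g k.
  elim: (win _) => [|g s [k IH]]; first by exists 0%N.
  have [nr|nr] := pselect (nearby r g); last first.
    exists k => h; rewrite inE => /orP [/eqP -> //|]; exact: IH.
  have [k' Hk'] := ex g nr.
  exists (maxn k k') => h; rewrite inE => /orP [/eqP -> _|hs nh].
    by apply: mono Hk'; rewrite leq_maxr.
  by apply: mono (IH h hs nh); rewrite leq_maxl.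
by exists k => g nr; apply: Hk => //; apply/mem_win => l; have := nr l; lia.
Qed.

End Lattice.

(** The value is determined by the predicate alone. Choices made with [least] therefore inherit
    locality and equivariance from the data that define the predicate. *)
Definition least (P : nat -> Prop) : nat :=
  if pselect (exists k, `[< P k >]) is left e then ex_minn e else 0%N.

Lemma leastP (P : nat -> Prop) :
  (exists k, P k) -> P (least P) /\ forall k, (k < least P)%N -> ~ P k.
Proof.
move=> [k Pk]; rewrite /least; case: pselect => [e|]; last first.
  by case; exists k; apply/asboolP.
case: ex_minnP => m /asboolP Pm min; split=> // j jm /asboolP /min; lia.
Qed.

(* [size L] forbidden intervals of radius b cannot meet all of the size L + 1
   slots, whose centres are 2b + 1 apart. *)
Lemma avoid (L : seq int) (lo b : int) : 0 <= b ->
  exists k : nat, (k%:Z <= (size L)%:Z * (2 * b + 1)) /\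
    forall c, c \in L -> b < `|lo + k%:Z - c|.
Proof.
move=> b0; pose B := absz (2 * b + 1); have BE : B%:Z = 2 * b + 1 by rewrite /B; lia.
apply: contrapT => no.
have ex (i : 'I_(size L).+1) : exists c, c \in L /\ `|lo + (i * B)%N%:Z - c| <= b.
  apply: contrapT => nc; apply: no; exists (i * B)%N; split.
    rewrite PoszM BE; have : (i <= size L)%N by rewrite -ltnS.
    move=> le; apply: ler_wpM2r; lia.
  move=> c cL; rewrite ltNge; apply/negP => le; apply: nc; by exists c.
pose f i := projT1 (cid (ex i)).
have fP i : f i \in L /\ `|lo + (i * B)%N%:Z - f i| <= b by exact: projT2 (cid (ex i)).
have finj : injective f.
  move=> i j e; apply: ord_inj; have [_ H1] := fP i; have [_ H2] := fP j.
  rewrite e in H1.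
  have H : `|(i * B)%N%:Z - (j * B)%N%:Z| <= 2 * b by lia.
  move: H; rewrite !PoszM -mulrBl normrM; move: BE => BE.
  case: (eqVneq (i : nat) j) => // ne H.
  have d1 : 1 <= `|(i : nat)%:Z - (j : nat)%:Z| by move/eqP: ne; lia.
  have : 1 * (2 * b + 1) <= `|(i:nat)%:Z - (j:nat)%:Z| * `|B%:Z|.
    apply: ler_pM => //; lia.
  lia.
have := @uniq_leq_size _ (codom f) L.
rewrite size_codom card_ord => /(_ _ _) H.
have : ((size L).+1 <= size L)%N.
  apply: H; first by rewrite map_inj_uniq ?enum_uniq.
  by move=> c /codomP [i ->]; have [] := fP i.
by rewrite ltnn.
Qed.

Section Packing.
Variable n : nat.
Notation Z := 'rV[int]_n.

(* Points further than B apart in some coordinate lie in different cells of a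
   grid of mesh B. *)
Lemma packing (B : int) (k : nat) (mk : Z -> Prop) (x : Z) : 0 < B ->
  (forall g h, mk g -> mk h -> g <> h -> ~ nearby B (g - h)) ->
  exists L : seq Z, (size L <= (2 * k).+1 ^ n)%N /\
    forall g, mk g -> nearby (k%:Z * B) (g - x) -> g \in L.
Proof.
move=> B0 sep.
pose cell (g : Z) : {ffun 'I_n -> 'I_(2 * k).+1} :=
  [ffun l : 'I_n => inord (absz (divz (g 0 l - x 0 l + k%:Z * B) B))].
pose good (g : Z) := mk g /\ nearby (k%:Z * B) (g - x).
pose rep c : Z := xget 0 [set g | good g /\ cell g = c].
exists [seq rep c | c : {ffun 'I_n -> 'I_(2 * k).+1}]; split.
  by rewrite size_map -cardT card_ffun !card_ord.
move=> g mg ng; apply/mapP; exists (cell g); first by rewrite mem_enum.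
have [[mr nr] cr] : [set h | good h /\ cell h = cell g] (rep (cell g)).
  by apply: xgetPex; exists g.
apply: contrapT => ne; apply: (sep g (rep (cell g))) => // l.
move/ffunP/(_ l): cr; rewrite !ffunE => /(congr1 (@nat_of_ord _)).
have bound (h : Z) : nearby (k%:Z * B) (h - x) ->
    (0 <= divz (h 0 l - x 0 l + k%:Z * B) B :> int) /\
    divz (h 0 l - x 0 l + k%:Z * B) B < (2 * k).+1%:Z.
  move=> /(_ l); rewrite subE => nh; rewrite divz_ge0 // ltz_divLR //.
  have -> : (2 * k).+1%:Z * B = k%:Z * B + k%:Z * B + B.
    by rewrite -addn1 PoszD PoszM; ring.
  by move: (k%:Z * B : int) nh => kB nh; split; lia.
have := bound _ nr; have := bound _ ng.
have fin (a b : int) : divz a B = divz b B -> - B <= a - b <= B.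
  move=> e; have := divz_eq a B; have := divz_eq b B; rewrite e.
  have := ltz_pmod a B0; have := ltz_pmod b B0.
  have := modz_ge0 a (lt0r_neq0 B0); have := modz_ge0 b (lt0r_neq0 B0).
  move: (modz a B : int) (modz b B : int) (divz b B * B : int) => p q w; lia.
have := fin (g 0 l - x 0 l + k%:Z * B) ((rep (cell g)) 0 l - x 0 l + k%:Z * B).
rewrite subE.
move: (divz _ B : int) (divz (_ + _) B : int) => a b.
move=> fn [a0 a1] [b0 b1]; rewrite !inordK; [|lia|lia]; move=> e.
have := fn ltac:(lia); move: (k%:Z * B : int) => kB; lia.
Qed.

End Packing.

(** * Cubes, boxes and displaced walls *)

Section Walls.
Variable n : nat.
Notation Z := 'rV[int]_n.
Implicit Types (g h u z : Z) (l t : 'I_n).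

(** Stands for the facet common to the unit cubes at [u] and [dn l u]. It lies in the hyperplane x_l
    = [u 0 l], so [u 0 l] serves as the position of the wall. *)
Definition wall T (C : Z -> T) l u := C u <> C (dn l u).

(** Walk from [g] to [h] by unit steps inside their coordinate hull, by induction on the
    l1-distance. The strict inequality at coordinate [l] keeps both cubes of each crossed facet in
    the hull. *)
Lemma no_wall_const T (C : Z -> T) g h :
  (forall l u, (forall k, Num.min (g 0 k) (h 0 k) <= u 0 k <= Num.max (g 0 k) (h 0 k)) ->
     Num.min (g 0 l) (h 0 l) < u 0 l -> ~ wall C l u) ->
  C g = C h.
Proof.
have [m] := ubnP (\sum_k absz (g 0%R k - h 0%R k))%N; elim: m g h => // m IH g h.
move=> le H; have [->//|ne] := pselect (g = h).
have [l nel] : exists l, g 0 l <> h 0 l.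
  by apply: contrapT => no; apply: ne; apply: latP => l; apply: contrapT => nl; apply: no; exists l.
have hull g' h' : (forall k, Num.min (g 0 k) (h 0 k) <= Num.min (g' 0 k) (h' 0 k)
    /\ Num.max (g' 0 k) (h' 0 k) <= Num.max (g 0 k) (h 0 k)) ->
    (absz (g' 0 l - h' 0 l)%R < absz (g 0 l - h 0 l)%R)%N ->
    (forall k, k != l -> g' 0 k = g 0 k /\ h' 0 k = h 0 k) -> C g' = C h'.
  move=> sub lt eq; apply: IH.
    rewrite ltnS in le; apply: leq_trans le.
    rewrite (bigD1 l) //= [X in (_ < X)%N](bigD1 l) //= -addSn leq_add //.
    by rewrite leq_eqVlt; apply/orP; left; apply/eqP; apply: eq_bigr => k /eq [-> ->].
  move=> k u uk ul; apply: H.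
    by move=> k'; have := sub k'; have := uk k'; lia.
  by have := sub k; lia.
have [lt|gt] : g 0 l < h 0 l \/ h 0 l < g 0 l by lia.
  have -> : C h = C (dn l h).
    apply: contrapT; apply: H; last by lia.
    by move=> k; lia.
  apply: hull => [k||k /negbTE kl]; rewrite dnE; last by rewrite kl.
    by case: eqP => [->|_]; lia.
  by rewrite eqxx; lia.
have -> : C g = C (dn l g).
  apply: contrapT; apply: H; last by lia.
  by move=> k; lia.
apply: hull => [k||k /negbTE kl]; rewrite dnE; last by rewrite kl.
  by case: eqP => [->|_]; lia.
by rewrite eqxx; lia.
Qed.

(** * Boxes cut out by cubes around markers and by a given family of walls *)

Section Cubes.
Variables (B b : int) (mk : Z -> Prop) (a : Z -> int) (id : Z -> nat).
Variable wR : 'I_n -> Z -> Prop.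
Definition sideplane z l (v : int) := v = z 0 l - a z \/ v = z 0 l + a z.

Hypothesis B0 : 0 < B.
Hypothesis b0 : 0 <= b < B.
Hypothesis mk_cov : forall g, exists2 z, mk z & nearby B (z - g).
Hypothesis a_rng : forall z, mk z -> B < a z <= 2 * B.
Hypothesis face_sep : forall z z' l v v', mk z -> mk z' -> z <> z' ->
  nearby (20 * B) (z - z') -> sideplane z l v -> sideplane z' l v' -> b < `|v - v'|.
Hypothesis id_inj : forall z z', mk z -> mk z' -> z <> z' ->
  nearby (20 * B) (z - z') -> id z <> id z'.
Hypothesis R_uniq : forall l u v, wR l u -> wR l v -> nearby (40 * B) (u - v) ->
  u 0 l = v 0 l.
Hypothesis R_avoid : forall l z u v, mk z -> sideplane z l v -> wR l u ->
  nearby (15 * B) (u - z) -> b < `|v - u 0 l|.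

Definition inQ z g := forall l, z 0 l - a z <= g 0 l < z 0 l + a z.

Definition own g z := [/\ mk z, inQ z g &
  forall z', mk z' -> inQ z' g -> (id z <= id z')%N].

(** Hyperplanes that cut the cell of points owned by [z]: the sides of all cubes near enough to meet
    the cube of [z], and the nearby walls in [wR]. Each hyperplane cuts the whole cell, which makes
    all pieces boxes. The family [wR] is empty for the starting boxes; it consists of the walls of a
    finished partition when the regions are cut into rectangles. *)
Definition plane z l (v : int) :=
  (exists z', [/\ mk z', nearby (5 * B) (z' - z) & sideplane z' l v]) \/
  exists u, [/\ wR l u, nearby (4 * B) (u - z) & u 0 l = v].

Definition pl g l v := exists2 z, own g z & plane z l v.

Definition lo g l : int := g 0 l - (least (fun k => pl g l (g 0 l - k%:Z)))%:Z.

Definition hi g l : int := g 0 l + 1 + (least (fun k => pl g l (g 0 l + 1 + k%:Z)))%:Z.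

Definition corner g : Z := \row_l lo g l.

Definition box g h := forall l, lo g l <= h 0 l < hi g l.

Lemma inQ_nearby z g : mk z -> inQ z g -> nearby (2 * B) (g - z).
Proof. by move=> mz q l; have := q l; have := a_rng mz; rewrite subE; lia. Qed.

Lemma inQ_nearby2 z z' g : mk z -> mk z' -> inQ z g -> inQ z' g -> nearby (4 * B) (z - z').
Proof.
move=> mz mz' /(inQ_nearby mz) H /(inQ_nearby mz') H' l.
by have := H l; have := H' l; rewrite !subE; lia.
Qed.

Lemma own_uniq g z z' : own g z -> own g z' -> z = z'.
Proof.
move=> [mz qz minz] [mz' qz' minz']; apply: contrapT => ne.
apply: (id_inj mz mz' ne); last by have := minz _ mz' qz'; have := minz' _ mz qz; lia.
by apply: nearby_le (inQ_nearby2 mz mz' qz qz'); lia.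
Qed.

Lemma cov_inQ g : exists2 z, mk z & inQ z g.
Proof.
have [z mz nz] := mk_cov g; exists z => // l.
by have := nz l; have := a_rng mz; rewrite subE; lia.
Qed.

Lemma own_ex g : exists z, own g z.
Proof.
have [z0 mz0 qz0] := cov_inQ g.
pose P k := exists z, [/\ mk z, inQ z g & id z = k].
have [[z [mz qz e]] min] := leastP (ex_intro P (id z0) (ex_intro _ z0 (And3 mz0 qz0 erefl))).
exists z; split=> // z' mz' qz'; rewrite leqNgt; apply/negP; rewrite e => /min; apply.
by exists z'.
Qed.

Lemma lo_spec g l : [/\ pl g l (lo g l), lo g l <= g 0 l &
  forall v, pl g l v -> v <= g 0 l -> v <= lo g l].
Proof.
have [z oz] := own_ex g; have [mz qz _] := oz.
have ex : exists k : nat, pl g l (g 0 l - k%:Z).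
  exists (absz (g 0 l - (z 0 l - a z))%R); exists z => //; left; exists z; split=> //.
    by rewrite subrr; apply: nearby0; lia.
  by left; have := qz l; lia.
have [H min] := leastP ex; rewrite /lo; move: (least _) H min => m H min; split=> //; first lia.
move=> v pv vg; rewrite leNgt; apply/negP => lt.
apply: (min (absz (g 0 l - v)%R)); first lia.
by have -> : g 0 l - (absz (g 0 l - v)%R)%:Z = v by lia.
Qed.

Lemma hi_spec g l : [/\ pl g l (hi g l), g 0 l < hi g l &
  forall v, pl g l v -> g 0 l < v -> hi g l <= v].
Proof.
have [z oz] := own_ex g; have [mz qz _] := oz.
have ex : exists k : nat, pl g l (g 0 l + 1 + k%:Z).
  exists (absz (z 0 l + a z - g 0 l - 1)%R); exists z => //; left; exists z; split=> //.
    by rewrite subrr; apply: nearby0; lia.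
  by right; have := qz l; lia.
have [H min] := leastP ex; rewrite /hi; move: (least _) H min => m H min; split=> //; first lia.
move=> v pv vg; rewrite leNgt; apply/negP => lt.
apply: (min (absz (v - g 0 l - 1)%R)); first lia.
by have -> : g 0 l + 1 + (absz (v - g 0 l - 1)%R)%:Z = v by lia.
Qed.

Lemma box_refl g : box g g.
Proof. by move=> l; have [_ H _] := lo_spec g l; have [_ H' _] := hi_spec g l; lia. Qed.

Lemma pl_own g z l v : own g z -> pl g l v -> plane z l v.
Proof. by move=> oz [z' oz' p]; rewrite (own_uniq oz oz'). Qed.

Lemma box_inQ g h z : own g z -> box g h -> inQ z h.
Proof.
move=> oz bh l; have [mz qz _] := oz.
have [_ _ H] := lo_spec g l; have [_ _ H'] := hi_spec g l.
have f v : sideplane z l v -> pl g l v.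
  by move=> fv; exists z => //; left; exists z; split=> //; rewrite subrr; apply: nearby0; lia.
have := H _ (f _ (or_introl erefl)); have := H' _ (f _ (or_intror erefl)).
by have := qz l; have := bh l; lia.
Qed.

(** Another cube containing a point of the box has its marker within [4 * B] of [z], so its sides
    are among the cutting hyperplanes. The box then lies inside that cube altogether, and the marker
    with the least [id] is the same at [g] and [h]. *)
Lemma box_own g h z : own g z -> box g h -> own h z.
Proof.
move=> oz bh; have qh := box_inQ oz bh; have [mz qz min] := oz; split=> // z' mz' qz'.
apply: min => // l.
have nz : nearby (5 * B) (z' - z) by apply: nearby_le (inQ_nearby2 mz' mz qz' qh); lia.
have [_ _ H] := lo_spec g l; have [_ _ H'] := hi_spec g l.
have f v : sideplane z' l v -> pl g l v by move=> fv; exists z => //; left; exists z'.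
have := H _ (f _ (or_introl erefl)); have := H' _ (f _ (or_intror erefl)).
have := H _ (f _ (or_intror erefl)); have := H' _ (f _ (or_introl erefl)).
by have := qz' l; have := bh l; lia.
Qed.

Lemma box_pl g h l v : box g h -> pl g l v <-> pl h l v.
Proof.
move=> bh; have [z oz] := own_ex g; have oh := box_own oz bh.
by split=> [/(pl_own oz)|/(pl_own oh)] p; exists z.
Qed.

Lemma box_lohi g h l : box g h -> lo h l = lo g l /\ hi h l = hi g l.
Proof.
move=> bh; have bl := bh l.
have [p1 q1 r1] := lo_spec g l; have [p2 q2 r2] := lo_spec h l.
have [p3 q3 r3] := hi_spec g l; have [p4 q4 r4] := hi_spec h l.
have e := box_pl l _ bh.
have := r2 _ (iffLR (e _) p1); have := r4 _ (iffLR (e _) p3).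
have p2' := iffRL (e _) p2; have p4' := iffRL (e _) p4.
have := r1 _ p2'; have := r3 _ p2'; have := r1 _ p4'; have := r3 _ p4'.
by lia.
Qed.

Lemma box_trans g h k : box g h -> box h k -> box g k.
Proof. by move=> bh bk l; have := bk l; have [-> ->] := box_lohi l bh. Qed.

Lemma box_sym g h : box g h -> box h g.
Proof. by move=> bh l; have [-> ->] := box_lohi l bh; apply: box_refl. Qed.

Lemma corner_box g : box g (corner g).
Proof.
move=> l; rewrite mxE; have [_ H _] := lo_spec g l; have [_ H' _] := hi_spec g l; lia.
Qed.

Lemma corner_eq g h : corner g = corner h <-> box g h.
Proof.
split=> [e|bh]; last by apply: latP => l; rewrite !mxE; have [-> _] := box_lohi l bh.
by apply: box_trans (corner_box g) _; rewrite e; apply: box_sym; exact: corner_box.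
Qed.

Lemma plane_sep z l v v' : plane z l v -> plane z l v' -> v <> v' -> b < `|v - v'|.
Proof.
move=> [[z1 [m1 n1 f1]]|[u1 [w1 n1 e1]]] [[z2 [m2 n2 f2]]|[u2 [w2 n2 e2]]] ne.
- have [e|ne'] := pselect (z1 = z2).
    by move: f1 f2 ne (a_rng m2); rewrite e => -[->|->] [->|->]; lia.
  apply: face_sep f1 f2 => // k.
  by have := n1 k; have := n2 k; rewrite !subE; lia.
- rewrite -e2; apply: (R_avoid m1 f1 w2) => k.
  by have := n1 k; have := n2 k; rewrite !subE; lia.
- rewrite distrC -e1; apply: (R_avoid m2 f2 w1) => k.
  by have := n1 k; have := n2 k; rewrite !subE; lia.
case: ne; rewrite -e1 -e2; apply: R_uniq => // k.
by have := n1 k; have := n2 k; rewrite !subE; lia.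
Qed.

Lemma box_side g l : b < hi g l - lo g l.
Proof.
have [z oz] := own_ex g.
have [/(pl_own oz) p q _] := lo_spec g l; have [/(pl_own oz) p' q' _] := hi_spec g l.
by have := plane_sep p' p; lia.
Qed.

Lemma box_nearby g h : box g h -> nearby (4 * B) (h - g).
Proof.
move=> bh; have [z oz] := own_ex g; have [mz _ _] := oz.
have H := inQ_nearby mz (box_inQ oz (box_refl g)); have H' := inQ_nearby mz (box_inQ oz bh).
by move=> l; have := H l; have := H' l; rewrite !subE; lia.
Qed.

Lemma corner_wall l u : wall corner l u ->
  exists z, [/\ mk z, nearby (2 * B) (z - u) & plane z l (u 0 l)].
Proof.
move=> w; have [z oz] := own_ex u; have [mz qz _] := oz; exists z; split=> //.
  by apply: nearby_sym; exact: inQ_nearby.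
suff <- : lo u l = u 0 l by have [/(pl_own oz)] := lo_spec u l.
apply: contrapT => ne; apply: w; apply/corner_eq => k; rewrite dnE.
have [_ H _] := lo_spec u k; have [_ H' _] := hi_spec u k.
by case: eqP => [e|_]; [move: ne H H'; rewrite e; lia|lia].
Qed.

(** A wall of [C] between two points of a box would belong to [wR], and its hyperplane would have
    cut the box. *)
Lemma corner_refines T (C : Z -> T) g h :
  (forall l u, wall C l u -> wR l u) -> box g h -> C g = C h.
Proof.
move=> CR bh; apply: no_wall_const => l u uk ul w.
have bu : box g u.
  by move=> k; have := bh k; have := box_refl g k; have := uk k; lia.
have [z oz] := own_ex g; have [mz _ _] := oz.
have pu : pl g l (u 0 l).
  exists z => //; right; exists u; split=> //; first exact: CR.
  by apply: nearby_le (inQ_nearby mz (box_inQ oz bu)); lia.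
have [_ _ H] := lo_spec g l; have [_ _ H'] := hi_spec g l.
have := H _ pu; have := H' _ pu; have := bh l; have := uk l; have := box_refl g l.
lia.
Qed.

End Cubes.

(** * Displacement of walls in one direction *)

Section Displace.
Variables (B bb : int) (mk : Z -> Prop) (a beta : Z -> int) (t : 'I_n).
Variable wR : 'I_n -> Z -> Prop.

Hypothesis B0 : 0 < B.
Hypothesis bbB : bb < B.
Hypothesis mk_cov : forall g, exists2 z, mk z & nearby B (z - g).
Hypothesis a_rng : forall z, mk z -> B < a z <= 2 * B.
Hypothesis beta_rng : forall z, mk z -> 0 < beta z < bb.
Hypothesis R_uniq : forall l u v, wR l u -> wR l v -> nearby (40 * B) (u - v) ->
  u 0 l = v 0 l.

Definition sliced z (c : int) := exists v, [/\ wR t v, nearby (3 * B) (v - z) & v 0 t = c].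

Definition inblock z (c : int) g := [/\ mk z, sliced z c,
  forall l, l != t -> z 0 l - a z <= g 0 l < z 0 l + a z & c <= g 0 t < c + beta z].

(** The displaced colouring is [C \o src S]: a point of a block reads the colour of the layer
    [c - 1] just below the hyperplane x_t = [c]. The set [S] of active markers is a parameter so
    that blocks can be added one at a time when homeomorphism types are followed. *)
Definition src (S : Z -> Prop) g : Z :=
  if pselect (exists c, exists2 z, S z & inblock z c g) is left e
  then upd g t (projT1 (cid e) - 1) else g.

Lemma inblock_nearby z c g : inblock z c g -> nearby (4 * B) (z - g).
Proof.
move=> [mz [v [_ nv <-]] base ht] l; rewrite subE.
have [->|ne] := eqVneq l t; last by have := base _ ne; have := a_rng mz; lia.
by have := nv t; have := beta_rng mz; rewrite subE; lia.
Qed.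

Lemma sliced_uniq z z' c c' : sliced z c -> sliced z' c' -> nearby (30 * B) (z - z') -> c = c'.
Proof.
move=> [v [wv nv <-]] [v' [wv' nv' <-]] nz; apply: R_uniq => // l.
by have := nv l; have := nv' l; have := nz l; rewrite !subE; lia.
Qed.

(** Blocks that meet have nearby markers, and nearby [t]-walls in [wR] lie in one hyperplane. Hence
    overlapping blocks rest on the same [c], and [src] does not depend on the block that is
    picked. *)
Lemma inblock_uniq z z' c c' g : inblock z c g -> inblock z' c' g -> c = c'.
Proof.
move=> e e'; have [_ p _ _] := e; have [_ p' _ _] := e'; apply: sliced_uniq p p' _ => l.
by have := inblock_nearby e l; have := inblock_nearby e' l; rewrite !subE; lia.
Qed.

Lemma src_in (S : Z -> Prop) z c g : S z -> inblock z c g -> src S g = upd g t (c - 1).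
Proof.
move=> Sz e; rewrite /src; case: pselect => [e'|]; last by case; exists c; exists z.
by case: cid => c' /= [z' _ e2]; rewrite (inblock_uniq e2 e).
Qed.

Lemma src_out (S : Z -> Prop) g : (forall z c, S z -> ~ inblock z c g) -> src S g = g.
Proof.
by move=> no; rewrite /src; case: pselect => // -[c [z Sz ez]]; case: (no z c Sz).
Qed.

Lemma srcP (S : Z -> Prop) g :
  (exists z c, [/\ S z, inblock z c g & src S g = upd g t (c - 1)]) \/
  (forall z c, S z -> ~ inblock z c g) /\ src S g = g.
Proof.
have [[c [z Sz e]]|no] := pselect (exists c, exists2 z, S z & inblock z c g).
  by left; exists z, c; split=> //; exact: src_in Sz e.
have no' z c : S z -> ~ inblock z c g by move=> Sz e; apply: no; exists c; exists z.
by right; split=> //; exact: src_out.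
Qed.

Lemma src_nearby (S : Z -> Prop) g : nearby bb (src S g - g).
Proof.
have [[z [c [_ [mz _ _ h] ->]]]|[_ ->]] := srcP S g; move=> l; last first.
  by rewrite subE; have [z mz _] := mk_cov g; have := beta_rng mz; lia.
by rewrite subE updE; have := beta_rng mz; case: eqP => [->|_]; lia.
Qed.

(** Four cases, according to which of [u] and [dn l u] lie in blocks. If both do or neither does,
    the wall is read off from [C], at most shifted along e_t. If exactly one does, the facet is a
    top or a side of a block. The bottom of a block gives no wall, since both of its sides read the
    layer [c - 1]. *)
Lemma displaced_wall T (C : Z -> T) (S : Z -> Prop) l u : wall (C \o src S) l u ->
  [\/ exists u', [/\ wall C l u', u' 0 l = u 0 l, nearby bb (u' - u) & l = t -> u' = u],
      exists z c, [/\ S z, mk z, sliced z c, nearby (4 * B) (z - u) & l = t /\ u 0 t = c + beta z]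
    | exists z c, [/\ S z, mk z, sliced z c, nearby (4 * B) (z - u) & l != t /\ sideplane a z l (u 0 l)]].
Proof.
rewrite /wall /=.
have same u' : wall C l u' -> u' 0 l = u 0 l -> nearby bb (u' - u) -> (l = t -> u' = u) ->
   [\/ exists u', [/\ wall C l u', u' 0 l = u 0 l, nearby bb (u' - u) & l = t -> u' = u],
      exists z c, [/\ S z, mk z, sliced z c, nearby (4 * B) (z - u) & l = t /\ u 0 t = c + beta z]
    | exists z c, [/\ S z, mk z, sliced z c, nearby (4 * B) (z - u) & l != t /\ sideplane a z l (u 0 l)]].
  by move=> w e nu lt; constructor 1; exists u'.
have dec : l = t \/ l != t by case: (eqVneq l t) => [->|_]; [left|right].
have bb0 : 0 <= bb by have [z mz _] := mk_cov 0; have := beta_rng mz; lia.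
case: (srcP S u) => [[z [c [Sz ez ->]]]|[no ->]];
  case: (srcP S (dn l u)) => [[z' [c' [Sz' ez' ->]]]|[no' ->]] w.
- have [ltE|ne] := dec.
    case: w; congr C.
    have [mz p _ _] := ez; have [mz' p' _ _] := ez'.
    have ec : c = c'.
      apply: sliced_uniq p p' _ => k; have := inblock_nearby ez k; have := inblock_nearby ez' k.
      by rewrite !subE dnE; case: eqP => [->|_]; lia.
    by apply: latP => k; rewrite ec ltE !latE; case: eqP.
  have ec : c = c'.
    have [mz p _ _] := ez; have [mz' p' _ _] := ez'.
    apply: sliced_uniq p p' _ => k; have := inblock_nearby ez k; have := inblock_nearby ez' k.
    by rewrite !subE dnE; case: eqP => [->|_]; lia.
  have eq : upd (dn l u) t (c' - 1) = dn l (upd u t (c - 1)).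
    apply: latP => k; rewrite !latE ec; case: eqP => [->|_].
      by rewrite eq_sym (negbTE ne).
    by case: eqP => // _; rewrite (negbTE ne).
  rewrite eq in w; apply: (same (upd u t (c - 1))) => //; first by rewrite updE (negbTE ne).
    move=> k; rewrite subE updE; case: eqP => [->|_]; last lia.
    by have [mz _ _ h] := ez; have := beta_rng mz; lia.
  by move=> e; rewrite e eqxx in ne.
- have [mz p base h] := ez; have [ltE|ne] := dec.
    rewrite ltE in no' w *; have [hc|hc] : u 0 t = c \/ c < u 0 t by lia.
      by case: w; congr C; apply: latP => k; rewrite !latE hc.
    case: (no' z c Sz); split=> // [k kt|]; rewrite dnE ?eqxx ?(negbTE kt) //; last lia.
    exact: base.
  constructor 3; exists z, c; split=> //; first exact: inblock_nearby ez.
  split=> //; apply: contrapT => nf; apply: (no' z c Sz); split=> //.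
    move=> k kt; rewrite dnE; have := base k kt; case: eqP => [->|_ //].
    by move=> h1; have : u 0 l <> z 0 l - a z by [move=> e; apply: nf; left]; lia.
  by rewrite dnE eq_sym (negbTE ne).
- have [mz p base h] := ez'; have [ltE|ne] := dec.
    rewrite ltE dnE eqxx in h; constructor 2; exists z', c'; split=> //.
      move=> k; have := inblock_nearby ez' k; rewrite !subE dnE; case: eqP => [->|_ //].
      rewrite ltE; have [v [_ nv ev]] := p; have := nv t; have := beta_rng mz.
      by rewrite subE ev; lia.
    split=> //; apply: contrapT => nb; apply: (no z' c' Sz'); split=> //; last lia.
    by move=> k kt; have := base k kt; rewrite dnE ltE (negbTE kt).
  constructor 3; exists z', c'; split=> //.
    move=> k; have := inblock_nearby ez' k; rewrite !subE dnE; case: eqP => [->|_ //].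
    by have := base l ne; rewrite dnE eqxx; have := a_rng mz; lia.
  split=> //; apply: contrapT => nf; apply: (no z' c' Sz'); split=> //.
    move=> k kt; have := base k kt; rewrite dnE; case: eqP => [->|_ //].
    by move=> h1; have : u 0 l <> z' 0 l + a z' by [move=> e; apply: nf; right]; lia.
  by move: h; rewrite dnE eq_sym (negbTE ne).
by apply: (same u) => //; rewrite subrr; apply: nearby0.
Qed.

(** The cubes cover everything, so a point [u] at the height of an old wall lies in the lowest layer
    of some block and reads the colour of [dn t u]. The latter is below every nearby block and keeps
    its own colour, so no wall is left between them. *)
Lemma displaced_old T (C : Z -> T) u v :
  wall (C \o src (fun _ => True)) t u -> wR t v -> nearby (2 * B) (v - u) -> v 0 t <> u 0 t.
Proof.
move=> w wv nv e; apply: w => /=.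
have [z mz nz] := mk_cov u.
have p : sliced z (u 0 t).
  exists v; split=> // l; have := nv l; have := nz l; rewrite !subE; lia.
have ez : inblock z (u 0 t) u.
  split=> // [l _|]; last by have := beta_rng mz; lia.
  by have := nz l; have := a_rng mz; rewrite subE; lia.
rewrite (src_in _ ez) // src_out; first by congr C.
move=> z' c _ ez'; have [_ p' _] := ez'; rewrite dnE eqxx.
suff -> : c = u 0 t by lia.
apply: sliced_uniq p' p _ => l; have := inblock_nearby ez' l; have := nz l.
by rewrite !subE dnE; case: eqP => [->|_]; lia.
Qed.

End Displace.
End Walls.

(** * Locally constant functions and greedy choices *)

Section LocallyConstant.
Variable n : nat.
Notation Z := 'rV[int]_n.
Implicit Types (x y : config n) (g h : Z) (r : int).

Definition agree (k : nat) x x' := forall h, nearby k%:Z h -> x h = x' h.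

(** Continuity on the free part for the discrete topology on the target. The window may depend on
    [x], as no uniform one can be expected from choices based on freeness. *)
Definition lc T (f : config n -> T) := forall x, free_part x ->
  exists k, forall x', free_part x' -> agree k x x' -> f x' = f x.

Lemma actE g x h : act g x h = x (g + h).
Proof. by []. Qed.

Lemma actD g h x : act g (act h x) = act (g + h) x.
Proof.
by apply/funext => u; change (x (h + (g + u)) = x (g + h + u)); congr (x _); rewrite addrCA addrA.
Qed.

Lemma act0 x : act 0 x = x.
Proof. by apply/funext => u; change (x (0 + u) = x u); congr (x _); rewrite add0r. Qed.

Lemma act_inj g h x : free_part x -> act g x = act h x -> g = h.
Proof.
move=> fx e; apply/eqP; rewrite -subr_eq0; apply/negPn/negP => /(fx (g - h)); apply.
by rewrite addrC -actD e actD addNr act0.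
Qed.

Lemma free_act g x : free_part x -> free_part (act g x).
Proof.
move=> fx h /(fx h) ne e; apply: ne.
have := congr1 (act (- g)) e; rewrite !actD.
by rewrite addrAC addNr add0r act0.
Qed.
Arguments free_act g [x] _.

Lemma agree_le k k' x x' : (k <= k')%N -> agree k' x x' -> agree k x x'.
Proof. by move=> le H h nh; apply: H; apply: nearby_le nh; lia. Qed.

Lemma agree_act (r : int) k g x x' : nearby r g ->
  agree (absz r + k) x x' -> agree k (act g x) (act g x').
Proof.
move=> ng H h nh; rewrite !actE; apply: H => l.
by have := ng l; have := nh l; rewrite addE; lia.
Qed.

Lemma lc_local T U (v : config n -> U) (f : config n -> T) (r : int) :
  lc v ->
  (forall x x', free_part x -> free_part x' ->
     (forall g, nearby r g -> v (act g x) = v (act g x')) -> f x = f x') ->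
  lc f.
Proof.
move=> lv loc x fx.
have [k Hk] : exists k, forall g, nearby r g -> forall x', free_part x' ->
    agree (absz r + k) x x' -> v (act g x') = v (act g x).
  apply: win_bound => [g k k' le H x' fx' ag|g ng].
    by apply: H => //; apply: agree_le ag; lia.
  have [k Hk] := lv _ (free_act g fx); exists k => x' fx' ag.
  by apply: Hk; [exact: free_act|exact: agree_act ag].
exists (absz r + k)%N => x' fx' ag; apply: loc => // g ng; exact: Hk.
Qed.

Lemma lc_comp T U (v : config n -> U) (f : U -> T) : lc v -> lc (f \o v).
Proof.
by move=> lv x fx; have [k Hk] := lv x fx; exists k => x' fx' /Hk /= ->.
Qed.

Lemma lc_cst T (a : T) : lc (fun _ => a).
Proof. by move=> x _; exists 0%N. Qed.

Lemma lc_pair T U (f : config n -> T) (f' : config n -> U) :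
  lc f -> lc f' -> lc (fun x => (f x, f' x)).
Proof.
move=> lf lf' x fx; have [k Hk] := lf x fx; have [k' Hk'] := lf' x fx.
exists (maxn k k') => x' fx' ag.
by rewrite Hk ?Hk' //; apply: agree_le ag; lia.
Qed.

(** * Priorities and recursion along them *)

Section Proper.
Variable r : int.
Hypothesis r0 : 0 <= r.

Let distinguished x (k : nat) := forall g, nearby r g -> g <> 0 ->
  exists2 h, nearby k%:Z h & act g x h <> x h.

Let distinguished_ex x : free_part x -> exists k, distinguished x k.
Proof.
move=> fx; rewrite /distinguished.
apply: (@win_bound _ r (fun g k => g <> 0 -> exists2 h, nearby k%:Z h & act g x h <> x h)).
  by move=> g k k' le H g0; have [h nh ne] := H g0; exists h => //; apply: nearby_le nh; lia.
move=> g ng; have [->|g0] := eqVneq g 0; first by exists 0%N.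
have [h hP] : exists h, act g x h <> x h.
  apply: contrapT => no; apply: (fx g g0); apply/funext => h.
  by apply: contrapT => ne; apply: no; exists h.
have [k Hk] : exists k : nat, nearby k%:Z h.
  exists (\max_(l < n) absz (h 0%R l)) => l.
  have := @leq_bigmax _ (fun l : 'I_n => absz (h 0 l)) l; move: (\max_(l < n) _)%N; lia.
by exists k => _; exists h.
Qed.

Let scale x := least (distinguished x).

(** A proper colouring of the graph joining points of an orbit at distance at most [r]. The window
    of size [scale x] shows that every nonzero shift by at most [r] changes [x]; a shift with the
    same code would have the same scale and the same pattern on this window, a contradiction. *)
Definition priority x : nat :=
  pickle (scale x, [seq x h | h <- win n (scale x)]).

Let scale_agree x x' : free_part x -> free_part x' ->
  agree (absz r + scale x) x x' -> scale x' = scale x.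
Proof.
move=> fx fx' ag.
have eqd k : (k <= scale x)%N -> distinguished x k <-> distinguished x' k.
  move=> le; split=> H g ng g0; have [h nh ne] := H g ng g0; exists h => //.
    have e1 : agree k (act g x) (act g x') by apply: agree_act ng _; apply: agree_le ag; lia.
    by rewrite -e1 // -ag //; apply: nearby_le nh; lia.
  have e1 : agree k (act g x) (act g x') by apply: agree_act ng _; apply: agree_le ag; lia.
  by rewrite e1 // ag //; apply: nearby_le nh; lia.
have [d1 m1] := leastP (distinguished_ex fx); have [d2 m2] := leastP (distinguished_ex fx').
rewrite -/(scale _) in d1 m1 d2 m2.
case: (ltngtP (scale x') (scale x)) => // lt.
  by case: (m1 _ lt); apply/eqd => //; exact: ltnW.
by case: (m2 _ lt); apply/eqd.
Qed.

Lemma lc_priority : lc priority.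
Proof.
move=> x fx; exists (absz r + scale x)%N => x' fx' ag.
rewrite /priority (scale_agree fx fx' ag); congr (pickle (_, _)).
apply/eq_in_map => h /mem_win nh; rewrite ag //; apply: nearby_le nh; lia.
Qed.

Lemma priority_neq x g : free_part x -> nearby r g -> g <> 0 -> priority (act g x) <> priority x.
Proof.
move=> fx ng g0 /(pcan_inj pickleK) [es].
rewrite es => /eq_in_map e.
have [d _] := leastP (distinguished_ex fx).
have [h nh ne] := d g ng g0; apply: ne; apply: e.
by apply/mem_win.
Qed.

Section Recursion.
Variables (T : Type) (Phi : config n -> (Z -> option T) -> T).

Let restrict x (f : config n -> T) (g : Z) : option T :=
  if `[< nearby r g >] && (priority (act g x) < priority x)%N then Some (f (act g x)) else None.

(** Every recursive call lowers the priority, so [priority x] is enough fuel. With fuel 0 at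
    priority 0 no neighbour has a smaller priority, and [None] everywhere is the correct input. *)
Let fuel := fix fuel k x := if k is k'.+1 then Phi x (restrict x (fuel k')) else Phi x (fun _ => None).

Let fuelE k k' x : (priority x <= k)%N -> (priority x <= k')%N -> fuel k x = fuel k' x.
Proof.
elim: k k' x => [|k IH] [|k'] x /= lek lek' //.
- congr Phi; apply/funext => g; rewrite /restrict; case: ifP => // /andP [_]; lia.
- congr Phi; apply/funext => g; rewrite /restrict; case: ifP => // /andP [_]; lia.
congr Phi; apply/funext => g; rewrite /restrict; case: ifP => // /andP [_ lt].
by congr Some; apply: IH; lia.
Qed.

(** For a fixed amount of fuel the result is locally constant by induction, and the amount needed,
    [priority x], is locally constant too. *)
Lemma priority_rec U (w : config n -> U) (r' : int) : lc w ->
  (forall x x' F, (forall g, nearby r' g -> w (act g x) = w (act g x')) -> Phi x F = Phi x' F) ->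
  exists2 f, lc f & forall x, f x = Phi x (fun g =>
    if `[< nearby r g >] && (priority (act g x) < priority x)%N then Some (f (act g x)) else None).
Proof.
move=> lw loc; exists (fun x => fuel (priority x) x); last first.
  move=> x /=; rewrite (fuelE (leqnn _) (leqnSn _)) /=; congr Phi.
  apply/funext => g; rewrite /restrict; case: ifP => // /andP [_ lt].
  by congr Some; apply: fuelE; lia.
have lfuel k : lc (fuel k).
  elim: k => [|k IH].
    by apply: (lc_local (r := r') lw) => x x' _ _ e /=; apply: loc.
  apply: (lc_local (r := `|r| + `|r'|) (lc_pair lw (lc_pair lc_priority IH))) => x x' _ _ e /=.
  have e1 g : nearby r' g -> w (act g x) = w (act g x').
    by move=> ng; have /e [] : nearby (`|r| + `|r'|) g by apply: nearby_le ng; lia.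
  have e2 g : nearby r g -> priority (act g x) = priority (act g x') /\
      fuel k (act g x) = fuel k (act g x').
    by move=> ng; have /e [] : nearby (`|r| + `|r'|) g by apply: nearby_le ng; lia.
  rewrite (loc _ _ _ e1); congr Phi; apply/funext => g; rewrite /restrict.
  have [ng|] := asboolP (nearby r g) => //=; have [-> ->] := e2 g ng.
  by have [] := e2 0 (nearby0 r0); rewrite !act0 => ->.
move=> x fx; have [k Hk] := lc_priority fx; have [k' Hk'] := lfuel (priority x) x fx.
exists (maxn k k') => x' fx' ag.
by rewrite Hk ?Hk' //; apply: agree_le ag; lia.
Qed.

End Recursion.

(** The predicate [Bad] may refer to the values already chosen at neighbours of smaller priority,
    through its argument [F]. By [avoid], an admissible value occurs before [N] forbidden intervals
    of radius [b] are exhausted, and the least one is taken. *)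
Lemma greedy U (w : config n -> U) (r' lo b : int) (N : nat)
    (Bad : config n -> (Z -> option int) -> int -> Prop) :
  lc w -> 0 <= b ->
  (forall x x' F v, (forall g, nearby r' g -> w (act g x) = w (act g x')) ->
    Bad x F v -> Bad x' F v) ->
  (forall x F, free_part x -> exists L : seq int, (size L <= N)%N /\
    forall v, Bad x F v -> exists2 c, c \in L & `|v - c| <= b) ->
  exists2 f : config n -> int, lc f & forall x, free_part x ->
    lo <= f x <= lo + N%:Z * (2 * b + 1) /\
    ~ Bad x (fun g => if `[< nearby r g >] && (priority (act g x) < priority x)%N
                      then Some (f (act g x)) else None) (f x).
Proof.
move=> lw b0 loc few.
pose Phi x F : int := lo + (least (fun k => ~ Bad x F (lo + k%:Z)))%:Z.
have [|f lf fE] := @priority_rec _ Phi _ w r' lw.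
  move=> x x' F e; rewrite /Phi.
  suff -> : (fun k : nat => ~ Bad x F (lo + k%:Z)) = (fun k => ~ Bad x' F (lo + k%:Z)) by [].
  by apply/funext => k; apply/propext; split=> nb B; apply: nb; apply: loc B => // g ng; rewrite e.
exists f => // x fx; set F := (X in ~ Bad x X _); rewrite (fE x) -/F /Phi.
have [L [sL HL]] := few x F fx.
have [k [kb kL]] := avoid L lo b0.
have kgood : ~ Bad x F (lo + k%:Z).
  by move=> /HL [c /kL]; lia.
have [lg lmin] := leastP (ex_intro (fun k : nat => ~ Bad x F (lo + k%:Z)) k kgood).
move: (least _) lg lmin => m lg lmin; split=> //.
have lek : (m <= k)%N by rewrite leqNgt; apply/negP => /lmin; apply.
have le2 : (size L)%:Z * (2 * b + 1) <= N%:Z * (2 * b + 1).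
  by apply: ler_wpM2r; lia.
move: le2 kb; move: (_ * _ : int) (_ * _ : int) => p q; lia.
Qed.

End Proper.
End LocallyConstant.

(** * Homeomorphisms of the ambient space *)

Section Continuity.
Variables (T : topologicalType) (R : realType).
Implicit Types f g : T -> R.

Lemma cts_add f g : continuous f -> continuous g -> continuous (fun x => f x + g x).
Proof. by move=> cf cg x; apply: cvgD; [exact: cf|exact: cg]. Qed.

Lemma cts_opp f : continuous f -> continuous (fun x => - f x).
Proof. by move=> cf x; apply: cvgN; exact: cf. Qed.

Lemma cts_mul f g : continuous f -> continuous g -> continuous (fun x => f x * g x).
Proof. by move=> cf cg x; apply: cvgM; [exact: cf|exact: cg]. Qed.

Lemma cts_inv f : (forall x, f x != 0) -> continuous f -> continuous (fun x => (f x)^-1).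
Proof. by move=> f0 cf x; apply: cvgV => //; exact: cf. Qed.

Lemma cts_cst (c : R) : continuous (fun _ : T => c).
Proof. by move=> x; exact: cvg_cst. Qed.

Lemma cts_max f g : continuous f -> continuous g -> continuous (fun x => Num.max (f x) (g x)).
Proof.
move=> cf cg; have -> : (fun x => Num.max (f x) (g x)) =
    (fun x => (f x + g x + `|f x - g x|) * 2^-1).
  by apply/funext => x; rewrite maxr_absE.
apply: cts_mul; last exact: cts_cst.
apply: cts_add; first exact: cts_add.
by move=> x; apply: cvg_norm; apply: cvgB; [exact: cf|exact: cg].
Qed.

Lemma cts_min f g : continuous f -> continuous g -> continuous (fun x => Num.min (f x) (g x)).
Proof.
move=> cf cg; have -> : (fun x => Num.min (f x) (g x)) =
    (fun x => - Num.max (- f x) (- g x)).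
  by apply/funext => x; rewrite oppr_max !opprK.
by apply: cts_opp; apply: cts_max; exact: cts_opp.
Qed.

Lemma cts_addv (V : normedModType R) (f g : T -> V) :
  continuous f -> continuous g -> continuous (fun x => f x + g x).
Proof. by move=> cf cg x; apply: cvgD; [exact: cf|exact: cg]. Qed.

Lemma cts_scale (V : normedModType R) (f : T -> R) (g : T -> V) :
  continuous f -> continuous g -> continuous (fun x => f x *: g x).
Proof. by move=> cf cg x; apply: cvgZ; [exact: cf|exact: cg]. Qed.

Lemma cts_row n (f : T -> 'rV[R]_n) :
  (forall l, continuous (fun x => f x 0 l)) -> continuous f.
Proof.
move=> cf; have -> : f = (fun x => \sum_l f x 0 l *: delta_mx 0 l).
  by apply/funext => x; exact: row_sum_delta.
elim: (index_enum _) => [|l s IH].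
  by under eq_fun do rewrite big_nil; move=> x; exact: cvg_cst.
under eq_fun do rewrite big_cons.
apply: cts_addv => //; apply: cts_scale => //.
by move=> x; exact: cvg_cst.
Qed.
End Continuity.

Section SupNorm.
Variables (R : realType) (n : nat).
Notation V := 'rV[R]_n.
Implicit Types p q : V.

Lemma norm_coord p l : `|p 0 l| <= `|p|.
Proof.
rewrite [leRHS]mx_normrE; apply: (le_trans _ (le_bigmax _ _ (0, l))) => //=.
Qed.

Lemma norm_le p (c : R) : 0 <= c -> (forall l, `|p 0 l| <= c) -> `|p| <= c.
Proof.
move=> c0 H; rewrite [leLHS]mx_normrE; apply/bigmax_leP; split => // -[i l] _ /=.
by rewrite ord1.
Qed.

Lemma norm_attained p (c : R) : 0 < c -> c <= `|p| -> exists l, c <= `|p 0 l|.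
Proof.
move=> c0 le; have /mx_norm_neq0 [[i l] /= e] : mx_norm p != 0.
  by apply: lt0r_neq0; apply: lt_le_trans le.
by exists l; move: le; rewrite [leRHS]e ord1.
Qed.

Lemma coordD p q l : (p + q) 0 l = p 0 l + q 0 l.
Proof. by rewrite mxE. Qed.

Lemma coordN p l : (- p) 0 l = - p 0 l.
Proof. by rewrite mxE. Qed.

Lemma coordZ (c : R) p l : (c *: p) 0 l = c * p 0 l.
Proof. by rewrite mxE. Qed.

Lemma cts_coord (T : topologicalType) (f : T -> V) l :
  continuous f -> continuous (fun x => f x 0 l).
Proof.
move=> cf x; apply: (@continuous_comp _ _ _ f (fun p : V => p 0 l)); first exact: cf.
exact: coord_continuous.
Qed.

Lemma cts_normv (T : topologicalType) (f : T -> V) :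
  continuous f -> continuous (fun x => `|f x|).
Proof. by move=> cf x; apply: cvg_norm; exact: cf. Qed.

Lemma closed_approx (S : set V) p : closed S ->
  (forall e : R, 0 < e -> exists2 q, S q & `|p - q| < e) -> S p.
Proof.
move=> cS H; apply: cS => U /nbhs_ballP [e /= e0 Ue].
have [q Sq lt] := H e e0; exists q; split=> //; apply: Ue.
by rewrite -ball_normE.
Qed.

End SupNorm.

Ltac mlra := repeat match goal with
  | |- context [Order.max ?x ?y] => case: (lerP x y)
  | |- context [Order.min ?x ?y] => case: (lerP x y) end; intros; lra.

(* The homeomorphism behind an extrusion: over the box |x_l - z_l| <= a (l <> t)
   the hyperplane x_t = c is raised to x_t = c + h.  [lift] raises it vertically,
   with a ramp near the rim of the box; [spread] then pushes the ramp outwards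
   until it is a vertical wall over the rim. *)
Section Profiles.
Variable R : realType.
Implicit Types w s y m h : R.

(** Soft thresholding: the signed excess of [x] over the interval [-A, A]. *)
Definition soft (A x : R) : R := Num.max 0 (x - A) - Num.max 0 (- A - x).

Definition ramp w : R := Num.max 0 (Num.min 1 (2 * (1 - w))).

(* Piecewise linear, identity outside [0, h + 2], mapping 1 to 1 + m. *)
Definition pushup h m y : R :=
  Num.max y (Num.min (y * (1 + m)) (h + 2 - (h + 2 - y) * ((h + 1 - m) / (h + 1)))).

Definition pulldown h m y : R :=
  Num.min y (Num.max (y / (1 + m)) (h + 2 - (h + 2 - y) * ((h + 1) / (h + 1 - m)))).

(** The factor for which [stretch s w * w] is piecewise affine in [w], sending 0, 1 - s, 2 to 0, 1,
    2, and the identity from 2 on. The maximum with 1/2 only guards the division, because 1 - s is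
    at least 1/2. *)
Definition stretch s w : R :=
  Num.max 1 (Num.min ((1 - s)^-1) ((1 + 2 * s / Num.max w 2^-1) / (1 + s))).

Definition shrink s w : R :=
  Num.min 1 (Num.max (1 - s) (1 + s - 2 * s / Num.max w 2^-1)).

(** At relative height [y] the ramp left by [lift] sits at w = 1 - (y - 1) / (2 h). So this is the
    value of [s] with which [stretch] moves the ramp to w = 1. Above the raised hyperplane, at y = h
    + 1, the value returns to 0 by y = h + 2, where the motion ends. *)
Definition slope h y : R := Num.max 0 (Num.min 2^-1 (Num.min ((y - 1) / (2 * h)) (h + 2 - y))).

Lemma soft_lt A m x : 0 <= A -> 0 < m -> `|soft A x| < m -> - (A + m) < x < A + m.
Proof. by rewrite ltr_norml /soft; mlra. Qed.

Lemma soft_le A m x : 0 <= A -> 0 <= m -> - (A + m) <= x <= A + m -> `|soft A x| <= m.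
Proof. by rewrite ler_norml /soft; mlra. Qed.

Lemma clamp_low u v : u <= 0 \/ v <= 0 -> Num.max 0 (Num.min 2^-1 (Num.min u v)) = 0 :> R.
Proof. by case; mlra. Qed.

Lemma clamp_mid u v : 0 <= v <= 2^-1 -> v <= u -> Num.max 0 (Num.min 2^-1 (Num.min v u)) = v :> R.
Proof. by mlra. Qed.

Lemma ramp_le u w : u < 1 -> ramp w <= u -> 1 - u / 2 <= w.
Proof. by rewrite /ramp; mlra. Qed.

Lemma ramp_ge u w : 0 < u -> u <= ramp w -> w <= 1 - u / 2.
Proof. by rewrite /ramp; mlra. Qed.

Lemma ramp0 w : 1 <= w -> ramp w = 0.
Proof. by rewrite /ramp; mlra. Qed.

Lemma ramp_rng w : 0 <= ramp w <= 1.
Proof. rewrite /ramp; mlra. Qed.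

Lemma slope_rng h y : 0 <= slope h y <= 2^-1.
Proof. rewrite /slope; move: (_ / _) => u; mlra. Qed.

(** Points of [-A, A] stay in place and the excess is multiplied by [k]. Because of this [spread]
    acts on [core] as a scaling, and it is inverted by inverting [stretch]. *)
Lemma soft_scale A k x : 0 <= A -> 0 <= k -> soft A (x + (k - 1) * soft A x) = k * soft A x.
Proof.
move=> A0 k0; rewrite /soft; have [lt|ge] := ltrP x (- A).
  have -> : Num.max 0 (x - A) = 0 by mlra.
  have -> : Num.max 0 (- A - x) = - A - x by mlra.
  have H : 0 <= k * (- A - x) by apply: mulr_ge0 => //; mlra.
  have -> : k * (0 - (- A - x)) = - (k * (- A - x)) by ring.
  have -> : x + (k - 1) * (0 - (- A - x)) = - A - k * (- A - x) by ring.
  by move: (k * (- A - x)) H => e H; mlra.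
have [gt|le] := ltrP A x.
  have -> : Num.max 0 (x - A) = x - A by mlra.
  have -> : Num.max 0 (- A - x) = 0 by mlra.
  have H : 0 <= k * (x - A) by apply: mulr_ge0 => //; mlra.
  have -> : k * (x - A - 0) = k * (x - A) by ring.
  have -> : x + (k - 1) * (x - A - 0) = A + k * (x - A) by ring.
  by move: (k * (x - A)) H => e H; mlra.
have -> : Num.max 0 (x - A) = 0 by mlra.
have -> : Num.max 0 (- A - x) = 0 by mlra.
by rewrite subrr !mulr0 addr0; mlra.
Qed.

Lemma pushupE1 h m y : 0 < h -> 0 <= m <= h -> 0 <= y <= 1 -> pushup h m y = y * (1 + m).
Proof.
move=> h0 mh y1; rewrite /pushup.
have e : h + 2 - (h + 2 - y) * ((h + 1 - m) / (h + 1)) - y * (1 + m) =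
    (1 - y) * (m * (h + 2) / (h + 1)) by field; mlra.
have : 0 <= (1 - y) * (m * (h + 2) / (h + 1)).
  apply: mulr_ge0; first mlra; apply: divr_ge0; [apply: mulr_ge0; mlra|mlra].
have : 0 <= y * m by apply: mulr_ge0; mlra.
have : y * (1 + m) = y + y * m by ring.
move: e; move: (h + 2 - (h + 2 - y) * _) (y * (1 + m)) (y * m) ((1 - y) * _) => u v w x.
mlra.
Qed.

Lemma pushupE2 h m y : 0 < h -> 0 <= m <= h -> 1 <= y <= h + 2 ->
  pushup h m y = h + 2 - (h + 2 - y) * ((h + 1 - m) / (h + 1)).
Proof.
move=> h0 mh y1; rewrite /pushup.
have e : h + 2 - (h + 2 - y) * ((h + 1 - m) / (h + 1)) - y * (1 + m) =
    (1 - y) * (m * (h + 2) / (h + 1)) by field; mlra.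
have : 0 <= (y - 1) * (m * (h + 2) / (h + 1)).
  apply: mulr_ge0; first mlra; apply: divr_ge0; [apply: mulr_ge0; mlra|mlra].
have : 0 <= (h + 2 - y) * (m / (h + 1)).
  apply: mulr_ge0; first mlra; apply: divr_ge0; mlra.
have : h + 2 - (h + 2 - y) * ((h + 1 - m) / (h + 1)) = y + (h + 2 - y) * (m / (h + 1)).
  by field; mlra.
have -> : (y - 1) * (m * (h + 2) / (h + 1)) = - ((1 - y) * (m * (h + 2) / (h + 1))) by ring.
move: e; move: (h + 2 - (h + 2 - y) * ((h + 1 - m) / (h + 1))) (y * (1 + m)).
move: ((h + 2 - y) * (m / (h + 1))) ((1 - y) * _) => u v w x; mlra.
Qed.

Lemma pushupE0 h m y : 0 < h -> 0 <= m <= h -> (y <= 0) || (h + 2 <= y) -> pushup h m y = y.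
Proof.
move=> h0 mh /orP [y0|y2]; rewrite /pushup.
  have : 0 <= - y * m by apply: mulr_ge0; mlra.
  have : y * (1 + m) = y - (- y * m) by ring.
  by move: (y * (1 + m)) (- y * m) (h + 2 - _) => u v w; mlra.
have e : h + 2 - (h + 2 - y) * ((h + 1 - m) / (h + 1)) = y - (y - h - 2) * (m / (h + 1)).
  by field; mlra.
have : 0 <= (y - h - 2) * (m / (h + 1)) by apply: mulr_ge0; [mlra|apply: divr_ge0; mlra].
by rewrite e; move: (_ * (m / _)) (y * _) => u v; mlra.
Qed.

Lemma pulldownE1 h m y : 0 < h -> 0 <= m <= h -> 0 <= y <= 1 + m -> pulldown h m y = y / (1 + m).
Proof.
move=> h0 mh y1; rewrite /pulldown.
have e : y / (1 + m) - (h + 2 - (h + 2 - y) * ((h + 1) / (h + 1 - m))) =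
    (1 + m - y) * (m * (h + 2) / ((h + 1 - m) * (1 + m))) by field; apply/andP; split; mlra.
have : 0 <= (1 + m - y) * (m * (h + 2) / ((h + 1 - m) * (1 + m))).
  by apply: mulr_ge0; first mlra; apply: divr_ge0; apply: mulr_ge0; mlra.
have : 0 <= y * (m / (1 + m)) by apply: mulr_ge0; [mlra|apply: divr_ge0; mlra].
have : y / (1 + m) = y - y * (m / (1 + m)) by field; mlra.
move: e; move: (y * (m / (1 + m))) ((1 + m - y) * (m * (h + 2) / ((h + 1 - m) * (1 + m)))) => w x.
move: (y / (1 + m)) (h + 2 - (h + 2 - y) * ((h + 1) / (h + 1 - m))) => u v; mlra.
Qed.

Lemma pulldownE2 h m y : 0 < h -> 0 <= m <= h -> 1 + m <= y <= h + 2 ->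
  pulldown h m y = h + 2 - (h + 2 - y) * ((h + 1) / (h + 1 - m)).
Proof.
move=> h0 mh y1; rewrite /pulldown.
have e : h + 2 - (h + 2 - y) * ((h + 1) / (h + 1 - m)) - y / (1 + m) =
    (y - 1 - m) * (m * (h + 2) / ((h + 1 - m) * (1 + m))) by field; apply/andP; split; mlra.
have : 0 <= (y - 1 - m) * (m * (h + 2) / ((h + 1 - m) * (1 + m))).
  by apply: mulr_ge0; first mlra; apply: divr_ge0; apply: mulr_ge0; mlra.
have : 0 <= (h + 2 - y) * (m / (h + 1 - m)) by apply: mulr_ge0; [mlra|apply: divr_ge0; mlra].
have : h + 2 - (h + 2 - y) * ((h + 1) / (h + 1 - m)) = y - (h + 2 - y) * (m / (h + 1 - m)).
  by field; mlra.
move: e; move: ((h + 2 - y) * (m / (h + 1 - m))) ((y - 1 - m) * (m * (h + 2) / ((h + 1 - m) * (1 + m)))) => w x.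
move: (y / (1 + m)) (h + 2 - (h + 2 - y) * ((h + 1) / (h + 1 - m))) => u v; mlra.
Qed.

Lemma pulldownE0 h m y : 0 < h -> 0 <= m <= h -> (y <= 0) || (h + 2 <= y) -> pulldown h m y = y.
Proof.
move=> h0 mh /orP [y0|y2]; rewrite /pulldown.
  have : 0 <= - y * (m / (1 + m)) by apply: mulr_ge0; [mlra|apply: divr_ge0; mlra].
  have : y / (1 + m) = y + (- y * (m / (1 + m))) by field; mlra.
  by move: (y / (1 + m)) (- y * (m / (1 + m))) (h + 2 - (h + 2 - y) * ((h + 1) / (h + 1 - m))) => u v w; mlra.
have e : h + 2 - (h + 2 - y) * ((h + 1) / (h + 1 - m)) = y + (y - h - 2) * (m / (h + 1 - m)).
  by field; mlra.
have : 0 <= (y - h - 2) * (m / (h + 1 - m)) by apply: mulr_ge0; [mlra|apply: divr_ge0; mlra].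
by rewrite e; move: (_ * (m / _)) (y / _) => u v; mlra.
Qed.

Lemma pushup_below h m y : 0 < h -> 0 <= m <= h -> 0 <= y <= 1 -> y <= pushup h m y <= 1 + m.
Proof.
move=> h0 mh y1; rewrite pushupE1 //; have : 0 <= y * m by apply: mulr_ge0; mlra.
have : 0 <= (1 - y) * (1 + m) by apply: mulr_ge0; mlra.
have -> : y * (1 + m) = y + y * m by ring.
have -> : (1 - y) * (1 + m) = 1 + m - y - y * m by ring.
by move: (y * m) => e; mlra.
Qed.

Lemma pushup_above h m y : 0 < h -> 0 <= m <= h -> 1 <= y <= h + 2 ->
  1 + m <= pushup h m y <= h + 2.
Proof.
move=> h0 mh y1; rewrite pushupE2 //.
have : 0 <= (y - 1) * ((h + 1 - m) / (h + 1)) by apply: mulr_ge0; [mlra|apply: divr_ge0; mlra].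
have : 0 <= (h + 2 - y) * ((h + 1 - m) / (h + 1)) by apply: mulr_ge0; [mlra|apply: divr_ge0; mlra].
have : (y - 1) * ((h + 1 - m) / (h + 1)) = h + 1 - m - (h + 2 - y) * ((h + 1 - m) / (h + 1)).
  by field; mlra.
by move: ((h + 2 - y) * _) ((y - 1) * _) => u v; mlra.
Qed.

Lemma pushupK h m : 0 < h -> 0 <= m <= h -> cancel (pushup h m) (pulldown h m).
Proof.
move=> h0 mh y; have [y0|y0] := leP y 0; first by rewrite pushupE0 ?pulldownE0 ?y0.
have [y2|y2] := leP (h + 2) y; first by rewrite pushupE0 ?pulldownE0 ?y2 ?orbT.
have [y1|y1] := leP y 1.
  have b : 0 <= y <= 1 by mlra.
  have := pushup_below h0 mh b => u; rewrite pulldownE1 //; last by mlra.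
  by rewrite pushupE1 //; field; mlra.
have b : 1 <= y <= h + 2 by mlra.
have := pushup_above h0 mh b => u; rewrite pulldownE2 //.
by rewrite pushupE2 //; field; apply/andP; split; mlra.
Qed.

Lemma pulldownK h m : 0 < h -> 0 <= m <= h -> cancel (pulldown h m) (pushup h m).
Proof.
move=> h0 mh y; have [y0|y0] := leP y 0; first by rewrite pulldownE0 ?pushupE0 ?y0.
have [y2|y2] := leP (h + 2) y; first by rewrite pulldownE0 ?pushupE0 ?y2 ?orbT.
have [y1|y1] := leP y (1 + m).
  rewrite pulldownE1 ?pushupE1 //; [by field; mlra| |by mlra].
  by rewrite divr_ge0 ?ler_pdivrMr /=; mlra.
rewrite pulldownE2 ?pushupE2 //; [by field; apply/andP; split; mlra| |by mlra].
have : 0 <= (h + 2 - y) * ((h + 1) / (h + 1 - m)) by apply: mulr_ge0; [mlra|apply: divr_ge0; mlra].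
have : 0 <= (y - 1 - m) * ((h + 1) / (h + 1 - m)) by apply: mulr_ge0; [mlra|apply: divr_ge0; mlra].
have : (y - 1 - m) * ((h + 1) / (h + 1 - m)) = h + 1 - (h + 2 - y) * ((h + 1) / (h + 1 - m)).
  by field; mlra.
by move: ((h + 2 - y) * _) ((y - 1 - m) * _) => u v; mlra.
Qed.

Lemma stretchE1 s w : 0 <= s <= 2^-1 -> w <= 1 - s -> stretch s w = (1 - s)^-1.
Proof.
move=> s0 w1; rewrite /stretch.
have i1 : 1 <= (1 - s)^-1 by rewrite invf_ge1; mlra.
suff : (1 - s)^-1 <= (1 + 2 * s / Num.max w 2^-1) / (1 + s) by move: (_ / (1 + s)) => u; mlra.
have m0 : 0 < Num.max w 2^-1 by mlra.
rewrite ler_pdivlMr; last mlra.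
have : 2 * s / (1 - s) <= 2 * s / Num.max w 2^-1.
  by apply: ler_wpM2l; [mlra|rewrite lef_pV2 ?posrE; mlra].
have : (1 - s)^-1 * (1 + s) = 1 + 2 * s / (1 - s) by field; mlra.
by move: (_ / Num.max _ _) (2 * s / _) => u v; mlra.
Qed.

Lemma stretchE2 s w : 0 <= s <= 2^-1 -> 1 - s <= w <= 2 ->
  stretch s w = (w + 2 * s) / (w * (1 + s)).
Proof.
move=> s0 w1; rewrite /stretch.
have -> : Num.max w 2^-1 = w by mlra.
have -> : (1 + 2 * s / w) / (1 + s) = (w + 2 * s) / (w * (1 + s)) by field; apply/andP; split; mlra.
have w0 : 0 < w * (1 + s) by apply: mulr_gt0; mlra.
have : 1 <= (w + 2 * s) / (w * (1 + s)).
  rewrite ler_pdivlMr // mul1r; have : 0 <= (2 - w) * s by apply: mulr_ge0; mlra.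
  have -> : (2 - w) * s = 2 * s - w * s by ring.
  have -> : w * (1 + s) = w + w * s by ring.
  by move: (w * s) => u; mlra.
have : (w + 2 * s) / (w * (1 + s)) <= (1 - s)^-1.
  rewrite ler_pdivrMr //; have : 0 <= 2 * s * (w - (1 - s)) / (1 - s).
    by apply: divr_ge0; [apply: mulr_ge0|]; mlra.
  have : (1 - s)^-1 * (w * (1 + s)) = w + 2 * s + 2 * s * (w - (1 - s)) / (1 - s).
    by field; mlra.
  by move: (2 * s * (w - (1 - s)) / (1 - s)) ((1 - s)^-1 * (w * (1 + s))) => u v; mlra.
by move: ((w + 2 * s) / (w * (1 + s))) ((1 - s)^-1) => u v; mlra.
Qed.

Lemma stretchE3 s w : 0 <= s <= 2^-1 -> 2 <= w -> stretch s w = 1.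
Proof.
move=> s0 w1; rewrite /stretch.
have -> : Num.max w 2^-1 = w by mlra.
suff : (1 + 2 * s / w) / (1 + s) <= 1 by move: ((1 + 2 * s / w) / (1 + s)) ((1 - s)^-1) => u v; mlra.
rewrite ler_pdivrMr; last mlra.
have : 2 * s / w <= s by rewrite ler_pdivrMr; [nra|mlra].
by move: (_ / w) => u; mlra.
Qed.

Lemma shrinkE1 s w : 0 <= s <= 2^-1 -> w <= 1 -> shrink s w = 1 - s.
Proof.
move=> s0 w1; rewrite /shrink.
suff : 2 * s <= 2 * s / Num.max w 2^-1 by move: (_ / _) => u; mlra.
rewrite ler_pdivlMr; last by mlra.
have : Num.max w 2^-1 <= 1 by mlra.
by move: (Num.max _ _) => u; nra.
Qed.

Lemma shrinkE2 s w : 0 <= s <= 2^-1 -> 1 <= w <= 2 -> shrink s w = 1 + s - 2 * s / w.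
Proof.
move=> s0 w1; rewrite /shrink.
have -> : Num.max w 2^-1 = w by mlra.
have : s <= 2 * s / w by rewrite ler_pdivlMr; [nra|mlra].
have : 2 * s / w <= 2 * s by rewrite ler_pdivrMr; [nra|mlra].
by move: (_ / _) => u; mlra.
Qed.

Lemma shrinkE3 s w : 0 <= s <= 2^-1 -> 2 <= w -> shrink s w = 1.
Proof.
move=> s0 w1; rewrite /shrink.
have -> : Num.max w 2^-1 = w by mlra.
have : 2 * s / w <= s by rewrite ler_pdivrMr; [nra|mlra].
by move: (_ / _) => u; mlra.
Qed.

Lemma stretch_rng s w : 0 <= s <= 2^-1 -> 0 <= w -> w <= 2 -> stretch s w * w <= 2.
Proof.
move=> s0 w0 w2; have [w1|w1] := leP w (1 - s).
  rewrite stretchE1 //; rewrite mulrC ler_pdivrMr; mlra.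
rewrite stretchE2 //; last mlra.
have -> : (w + 2 * s) / (w * (1 + s)) * w = (w + 2 * s) / (1 + s) by field; apply/andP; split; mlra.
by rewrite ler_pdivrMr; mlra.
Qed.

Lemma stretch_lt s w : 0 <= s <= 2^-1 -> 0 <= w -> w < 2 -> stretch s w * w < 2.
Proof.
move=> s0 w0 w2; have [w1|w1] := leP w (1 - s).
  rewrite stretchE1 //; rewrite mulrC ltr_pdivrMr; mlra.
rewrite stretchE2 //; last mlra.
have -> : (w + 2 * s) / (w * (1 + s)) * w = (w + 2 * s) / (1 + s) by field; apply/andP; split; mlra.
by rewrite ltr_pdivrMr; mlra.
Qed.

Lemma stretch_ge1 s w : 1 <= stretch s w.
Proof. by rewrite /stretch le_max lexx. Qed.

Lemma stretch_in s w : 0 <= s <= 2^-1 -> 0 <= w -> w <= 1 - s -> stretch s w * w <= 1.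
Proof. by move=> s0 w0 w1; rewrite stretchE1 // mulrC ler_pdivrMr; mlra. Qed.

Lemma stretch_out s w : 0 <= s <= 2^-1 -> 1 - s <= w -> 1 <= stretch s w * w.
Proof.
move=> s0 w1; have [w2|w2] := leP w 2; last by rewrite stretchE3 //; mlra.
rewrite stretchE2 //; last mlra.
have -> : (w + 2 * s) / (w * (1 + s)) * w = (w + 2 * s) / (1 + s) by field; apply/andP; split; mlra.
by rewrite ler_pdivlMr; mlra.
Qed.

Lemma shrink_gt0 s w : 0 <= s <= 2^-1 -> 0 < shrink s w.
Proof. by move=> s0; rewrite /shrink; move: (_ / _) => u; mlra. Qed.

Lemma stretchK s w : 0 <= s <= 2^-1 -> 0 <= w -> shrink s (stretch s w * w) * stretch s w = 1.
Proof.
move=> s0 w0; have [w1|w1] := leP w (1 - s).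
  by rewrite shrinkE1 ?stretch_in // stretchE1 // mulfV; mlra.
have [w2|w2] := leP w 2; last first.
  by rewrite stretchE3 ?shrinkE3 ?mulr1 ?mul1r //; mlra.
have o := @stretch_out s w s0 (ltW w1); have u := stretch_rng s0 w0 w2.
rewrite shrinkE2 ?o //; rewrite stretchE2 //; last mlra.
have e1 : w + 2 * s != 0 by mlra.
by field; repeat (apply/andP; split); mlra.
Qed.

Lemma shrinkK s w : 0 <= s <= 2^-1 -> 0 <= w -> stretch s (shrink s w * w) * shrink s w = 1.
Proof.
move=> s0 w0; have [w1|w1] := leP w 1.
  rewrite shrinkE1 // stretchE1 ?mulVf //; first mlra.
  by nra.
have [w2|w2] := leP w 2; last first.
  by rewrite shrinkE3 ?stretchE3 ?mulr1 ?mul1r //; mlra.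
rewrite shrinkE2 //; last mlra.
have e : (1 + s - 2 * s / w) * w = (1 + s) * w - 2 * s by field; mlra.
have f1 : 0 <= (w - 1) * (1 + s) by apply: mulr_ge0; mlra.
have f2 : 0 <= (2 - w) * (1 + s) by apply: mulr_ge0; mlra.
rewrite e stretchE2 //; last by nra.
have e1 : (1 + s) * w - 2 * s != 0 by nra.
by field; repeat (apply/andP; split); mlra.
Qed.

Lemma stretch0 w : stretch 0 w = 1.
Proof. by rewrite /stretch subr0 mulr0 mul0r addr0 invr1 mulr1; mlra. Qed.

Lemma pushup_id h y : 0 < h -> pushup h 0 y = y.
Proof.
move=> h0; have H10 : h + 1 != 0 by lra.
by rewrite /pushup addr0 mulr1 subr0 divff // mulr1; mlra.
Qed.

End Profiles.

Section Homeo.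
Variables (R : realType) (n : nat).
Notation V := 'rV[R]_n.
Notation Z := 'rV[int]_n.

Definition ambient (f f' : V -> V) :=
  [/\ continuous f, continuous f', cancel f f' & cancel f' f].

Definition cubes (X : set Z) : set V := \bigcup_(g in X) @unit_cube R n g.

Lemma cubes_cover (p : V) : exists g : Z, @unit_cube R n g p.
Proof.
exists (\row_l Num.floor (p 0 l)) => l; rewrite mxE.
have := Num.Theory.floor_itv (p 0 l); rewrite intrD => /andP [-> lt] /=; exact: ltW.
Qed.

Lemma unit_cube_closed (g : Z) : closed (@unit_cube R n g).
Proof.
have -> : @unit_cube R n g = \bigcap_(l in [set: 'I_n])
    ((fun p : V => p 0 l) @^-1` [set x | (g 0 l)%:~R <= x] `&`
     (fun p : V => p 0 l) @^-1` [set x | x <= (g 0 l)%:~R + 1]).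
  apply/seteqP; split=> p /= H l; first by move=> _; apply/andP; exact: H.
  by have := H l I => /= -[-> ->].
apply: closed_bigI => l _; apply: closedI.
  apply: preimage_closed; last exact: closed_ge.
  by move=> p _; exact: coord_continuous.
apply: preimage_closed; last exact: closed_le.
by move=> p _; exact: coord_continuous.
Qed.

Lemma cubes_closed (X : set Z) (r : int) : (forall g, X g -> nearby r g) -> closed (cubes X).
Proof.
move=> bX; apply: closed_bigcup => [|g _]; last exact: unit_cube_closed.
apply: (@sub_finite_set _ _ [set g | g \in win n (absz r)]).
  by move=> g Xg /=; apply/mem_win => l; have := bX g Xg l; lia.
exact: finite_seq.
Qed.

Lemma unit_cube_interior (g : Z) (p : V) (e : R) : @unit_cube R n g p -> 0 < e ->
  exists2 q : V, `|p - q| < e & forall l, (g 0 l)%:~R < q 0 l < (g 0 l)%:~R + 1.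
Proof.
move=> gp e0; pose d := Num.min (e / 2) 1.
have d0 : 0 < d by rewrite /d lt_min ltr01 andbT divr_gt0.
have d1 : d <= 1 by rewrite /d ge_min lexx orbT.
have de : d < e by rewrite /d gt_min ltr_pdivrMr // ltr_pMr // ltr1n.
exists (\row_l ((1 - d) * p 0 l + d * ((g 0 l)%:~R + 2^-1))) => [|l].
  apply: le_lt_trans de; apply: norm_le => [|l]; first lra.
  rewrite coordD coordN mxE.
  have -> : p 0 l - ((1 - d) * p 0 l + d * ((g 0 l)%:~R + 2^-1)) =
     d * (p 0 l - (g 0 l)%:~R - 2^-1) by ring.
  rewrite normrM (gtr0_norm d0) ler_piMr ?(ltW d0) // ler_norml.
  by have := gp l; lra.
rewrite mxE; have := gp l; move: (g 0 l)%:~R (p 0 l) => G P GP; nra.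
Qed.

Lemma unit_cube_interior_uniq (g h : Z) (q : V) :
  (forall l, (g 0 l)%:~R < q 0 l < (g 0 l)%:~R + 1) -> @unit_cube R n h q -> g = h.
Proof.
move=> gq hq; apply: latP => l.
have h1 : (g 0 l)%:~R < (h 0 l + 1)%:~R :> R by rewrite intrD; have := gq l; have := hq l; lra.
have h2 : (h 0 l)%:~R < (g 0 l + 1)%:~R :> R by rewrite intrD; have := gq l; have := hq l; lra.
by move: h1 h2; rewrite !ltr_int; lia.
Qed.

(** Only forward inclusions have to be checked, one for [X] and one for its complement. A point of
    [cubes X'] is a limit of interior points [q] of a single cube; if [f' q] were in a cube outside
    [X], then [q] would be in a cube outside [X']. The rest is closedness. *)
Lemma ambient_cubes f f' (X X' : set Z) (r : int) : ambient f f' ->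
  (forall g, X g -> nearby r g) ->
  (forall p, cubes X p -> cubes X' (f p)) ->
  (forall p, cubes (~` X) p -> cubes (~` X') (f p)) ->
  (forall g, X' g -> nearby r g) ->
  cubes X' = f @` cubes X.
Proof.
move=> [cf cf' fK f'K] bX fX fXc bX'; apply/seteqP; split=> [p [g Xg gp]|p [q Xq <-]]; last exact: fX.
exists (f' p) => //.
apply: (closed_approx (cubes_closed bX)) => e e0.
have /cvgrPdist_lt /(_ e e0) := cf' p.
move=> /nbhs_ballP [d /= d0 Hd].
have [q pq gq] := unit_cube_interior gp d0.
exists (f' q); last by apply: Hd; rewrite -ball_normE.
have [h hq] := cubes_cover (f' q).
have [Xh|nXh] := pselect (X h); first by exists h.
have [k nXk kq] : cubes (~` X') (f (f' q)) by apply: fXc; exists h.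
by rewrite f'K in kq; case: nXk; rewrite -(unit_cube_interior_uniq gq kq).
Qed.

Section Maps.
Variables (zc : 'I_n -> R) (A C H : R) (t : 'I_n).
Hypotheses (A0 : 0 <= A) (H1 : 1 <= H).

(** Horizontal excess over the box of half-width [A]; its sup norm [w] is the distance from the
    vertical column over that box. The companion coordinate [ht] is normalised so that the
    hyperplane x_t = [C] has height 1. *)
Definition core (p : V) : V :=
  \row_l (if l == t then 0 else soft A (p 0 l - zc l)).

Let w (p : V) := `|core p|.
Let ht (p : V) : R := p 0 t - (C - 1).
Let e : V := delta_mx 0 t.

Definition lift (p : V) : V := p + (pushup H (H * ramp (w p)) (ht p) - ht p) *: e.
Definition unlift (p : V) : V := p + (pulldown H (H * ramp (w p)) (ht p) - ht p) *: e.
Definition spread (p : V) : V := p + (stretch (slope H (ht p)) (w p) - 1) *: core p.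
Definition unspread (p : V) : V := p + (shrink (slope H (ht p)) (w p) - 1) *: core p.

Let e_t : e 0 t = 1. Proof. by rewrite mxE !eqxx. Qed.
Let e_l l : l != t -> e 0 l = 0. Proof. by move=> /negbTE lt; rewrite mxE lt andbF. Qed.

Let core_shift (p : V) (x : R) : core (p + x *: e) = core p.
Proof.
apply/rowP => l; rewrite !mxE; case: ifP => // /negbT lt.
by rewrite (negbTE lt) /= mulr0 addr0.
Qed.

Let ht_shift (p : V) (x : R) : ht (p + x *: e) = ht p + x.
Proof. by rewrite /ht coordD coordZ e_t mulr1; ring. Qed.

Let core_spread (p : V) (k : R) : 0 <= k -> core (p + (k - 1) *: core p) = k *: core p.
Proof.
move=> k0; apply/rowP => l; rewrite !mxE; case: eqP => _; first by rewrite mulr0.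
by rewrite -[RHS]soft_scale //; congr (soft _ _); ring.
Qed.

Let ht_spread (p : V) (k : R) : ht (p + k *: core p) = ht p.
Proof. by rewrite /ht coordD coordZ [core p 0 t]mxE eqxx mulr0 addr0. Qed.

Let m_rng (p : V) : 0 <= H * ramp (w p) <= H.
Proof.
have HH : 0 <= H := le_trans ler01 H1.
by have /andP [r0 r1] := ramp_rng (w p); rewrite mulr_ge0 //= ler_piMr.
Qed.

Let H0 : 0 < H. Proof. exact: lt_le_trans ltr01 H1. Qed.

Let liftK : cancel lift unlift.
Proof.
move=> p; rewrite /unlift {1 2 3}/lift /w core_shift !ht_shift -/(w p).
set u := pushup _ _ _; have -> : ht p + (u - ht p) = u by ring.
by rewrite pushupK // -addrA -scalerDl (_ : u - ht p + (ht p - u) = 0) ?scale0r ?addr0 //; ring.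
Qed.

Let unliftK : cancel unlift lift.
Proof.
move=> p; rewrite /lift {1 2 3}/unlift /w core_shift !ht_shift -/(w p).
set u := pulldown _ _ _; have -> : ht p + (u - ht p) = u by ring.
by rewrite pulldownK // -addrA -scalerDl (_ : u - ht p + (ht p - u) = 0) ?scale0r ?addr0 //; ring.
Qed.

Let w0 (p : V) : 0 <= w p. Proof. exact: normr_ge0. Qed.

Let spreadK : cancel spread unspread.
Proof.
move=> p; pose s := slope H (ht p); pose k := stretch s (w p).
have s0 : 0 <= s <= 2^-1 := slope_rng _ _.
have k0 : 0 <= k by have := stretch_ge1 s (w p); rewrite -/k; lra.
have hs : ht (spread p) = ht p by rewrite /spread ht_spread.
have cs : core (spread p) = k *: core p by rewrite /spread core_spread.
have ws : w (spread p) = k * w p by rewrite /w cs normrZ ger0_norm.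
rewrite /unspread hs ws cs -/s scalerA /spread -/s -/k -addrA -scalerDl.
have -> : k - 1 + (shrink s (k * w p) - 1) * k = shrink s (k * w p) * k - 1 by ring.
by rewrite stretchK // subrr scale0r addr0.
Qed.

Let unspreadK : cancel unspread spread.
Proof.
move=> p; pose s := slope H (ht p); pose k := shrink s (w p).
have s0 : 0 <= s <= 2^-1 := slope_rng _ _.
have k0 : 0 <= k by exact/ltW/shrink_gt0.
have hs : ht (unspread p) = ht p by rewrite /unspread ht_spread.
have cs : core (unspread p) = k *: core p by rewrite /unspread core_spread.
have ws : w (unspread p) = k * w p by rewrite /w cs normrZ ger0_norm.
rewrite /spread hs ws cs -/s scalerA /unspread -/s -/k -addrA -scalerDl.
have -> : k - 1 + (stretch s (k * w p) - 1) * k = stretch s (k * w p) * k - 1 by ring.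
by rewrite shrinkK // subrr scale0r addr0.
Qed.

Let cid : continuous (fun p : V => p). Proof. by move=> p. Qed.

Let c_core : continuous core.
Proof.
apply: cts_row => l; rewrite /core.
have [lt|lt] := eqVneq l t.
  by under eq_fun do rewrite mxE lt eqxx; exact: cts_cst.
under eq_fun do rewrite mxE (negbTE lt) /soft.
have cl : continuous (fun p : V => p 0 l - zc l).
  by apply: cts_add; [exact: cts_coord|exact: cts_cst].
apply: cts_add; first apply: cts_max; first exact: cts_cst.
  by apply: cts_add => //; exact: cts_cst.
apply: cts_opp; apply: cts_max; first exact: cts_cst.
by apply: cts_add; [exact: cts_cst|exact: cts_opp].
Qed.

Let c_w : continuous w. Proof. exact: cts_normv. Qed.

Let c_ht : continuous ht.
Proof. by apply: cts_add; [exact: cts_coord|exact: cts_cst]. Qed.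

Let c_ramp : continuous (fun p => ramp (w p)).
Proof.
apply: cts_max; first exact: cts_cst.
apply: cts_min; first exact: cts_cst.
apply: cts_mul; first exact: cts_cst.
by apply: cts_add; [exact: cts_cst|exact: cts_opp].
Qed.

Let c_slope : continuous (fun p => slope H (ht p)).
Proof.
apply: cts_max; first exact: cts_cst.
apply: cts_min; first exact: cts_cst.
apply: cts_min.
  apply: cts_mul; last exact: cts_cst.
  by apply: cts_add => //; exact: cts_cst.
by apply: cts_add; [exact: cts_cst|exact: cts_opp].
Qed.

Let c_m : continuous (fun p => H * ramp (w p)).
Proof. by apply: cts_mul => //; exact: cts_cst. Qed.

Let c_lift : continuous lift.
Proof.
apply: cts_addv; first by move=> p; exact: cvg_id.
apply: cts_scale; last exact: cst_continuous.
apply: cts_add; last exact: cts_opp.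
apply: cts_max => //; apply: cts_min.
  apply: cts_mul => //; apply: cts_add => //; exact: cts_cst.
apply: cts_add; first exact: cts_cst.
apply: cts_opp; apply: cts_mul.
  by apply: cts_add; [exact: cts_cst|exact: cts_opp].
apply: cts_mul; last exact: cts_cst.
by apply: cts_add; [exact: cts_cst|exact: cts_opp].
Qed.

Let c_unlift : continuous unlift.
Proof.
apply: cts_addv; first by move=> p; exact: cvg_id.
apply: cts_scale; last exact: cst_continuous.
apply: cts_add; last exact: cts_opp.
apply: cts_min => //; apply: cts_max.
  apply: cts_mul => //; apply: cts_inv.
    by move=> p; have := m_rng p; lra.
  by apply: cts_add => //; exact: cts_cst.
apply: cts_add; first exact: cts_cst.
apply: cts_opp; apply: cts_mul.
  by apply: cts_add; [exact: cts_cst|exact: cts_opp].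
apply: cts_mul; first exact: cts_cst.
apply: cts_inv; first by move=> p; have := m_rng p; lra.
by apply: cts_add; [exact: cts_cst|exact: cts_opp].
Qed.

Let c_ratio : continuous (fun p => 2 * slope H (ht p) / Num.max (w p) 2^-1).
Proof.
apply: cts_mul; first by apply: cts_mul => //; exact: cts_cst.
apply: cts_inv; last by apply: cts_max => //; exact: cts_cst.
by move=> p; apply: lt0r_neq0; rewrite lt_max invr_gt0 ltr0n orbT.
Qed.

Let c_spread : continuous spread.
Proof.
apply: cts_addv; first by move=> p; exact: cvg_id.
apply: cts_scale; last exact: c_core.
apply: cts_add; last exact: cts_cst.
apply: cts_max; first exact: cts_cst.
apply: cts_min.
  apply: cts_inv; first by move=> p; have := slope_rng H (ht p); lra.
  by apply: cts_add; [exact: cts_cst|exact: cts_opp].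
apply: cts_mul; first by apply: cts_add => //; exact: cts_cst.
apply: cts_inv; first by move=> p; have := slope_rng H (ht p); lra.
by apply: cts_add => //; exact: cts_cst.
Qed.

Let c_unspread : continuous unspread.
Proof.
apply: cts_addv; first by move=> p; exact: cvg_id.
apply: cts_scale; last exact: c_core.
apply: cts_add; last exact: cts_cst.
apply: cts_min; first exact: cts_cst.
apply: cts_max.
  by apply: cts_add; [exact: cts_cst|exact: cts_opp].
apply: cts_add; last exact: cts_opp.
by apply: cts_add => //; exact: cts_cst.
Qed.

Definition raise (p : V) := spread (lift p).

Lemma raise_ambient : ambient raise (fun p => unlift (unspread p)).
Proof.
split.
- by move=> p; apply: (@continuous_comp _ _ _ lift spread); [exact: c_lift|exact: c_spread].
- by move=> p; apply: (@continuous_comp _ _ _ unspread unlift); [exact: c_unspread|exact: c_unlift].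
- by move=> p; rewrite /raise spreadK liftK.
by move=> p; rewrite /raise unliftK unspreadK.
Qed.

(* k is the stretching factor of [spread] at p. *)
Lemma raiseP (p : V) : exists k : R, 1 <= k /\
  (forall l, l != t -> raise p 0 l = p 0 l + (k - 1) * soft A (p 0 l - zc l)) /\
  (forall l, l != t -> soft A (raise p 0 l - zc l) = k * soft A (p 0 l - zc l)) /\
  (w p < 2 -> k * w p < 2) /\
  ([\/ 2 <= w p, p 0 t <= C - 1 | C + H + 1 <= p 0 t] -> raise p = p) /\
  (C - 1 < p 0 t <= C -> C - 1 < raise p 0 t /\ (raise p 0 t <= C \/
     k * w p <= 1 /\ raise p 0 t <= C + H)) /\
  (C <= p 0 t < C + H + 1 -> C <= raise p 0 t <= C + H + 1 /\
     (C + H <= raise p 0 t \/ 1 <= k * w p)).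
Proof.
set m := H * ramp (w p); have m1 := m_rng p; rewrite -/m in m1.
have cl : core (lift p) = core p by rewrite /lift core_shift.
have hl : ht (lift p) = pushup H m (ht p) by rewrite /lift ht_shift; rewrite -/m; ring.
set s := slope H (ht (lift p)); have s0 : 0 <= s <= 2^-1 := slope_rng _ _.
set k := stretch s (w p).
have k1 : 1 <= k := stretch_ge1 _ _.
have rE : raise p = lift p + (k - 1) *: core p by rewrite /raise /spread cl /w cl.
have ll l : l != t -> lift p 0 l = p 0 l by move=> lt; rewrite /lift coordD coordZ e_l // mulr0 addr0.
have rl l : l != t -> raise p 0 l = p 0 l + (k - 1) * soft A (p 0 l - zc l).
  by move=> lt; rewrite rE coordD coordZ ll // [core p 0 l]mxE (negbTE lt).
have rt : raise p 0 t - (C - 1) = pushup H m (ht p).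
  by rewrite -/(ht (raise p)) rE -cl ht_spread hl.
exists k; split=> //; split; first exact: rl.
split.
  move=> l lt; rewrite rl // -[RHS]soft_scale //; last lra.
  by congr (soft _ _); ring.
split; first by move=> w2; apply: stretch_lt.
split.
  move=> out; have lp : lift p = p.
    have e1 : pushup H m (ht p) = ht p.
      case: out => [w2|lo|hi].
      + have m0 : m = 0.
          by rewrite /m ramp0 ?mulr0 //; apply: le_trans w2; lra.
        by rewrite m0 pushup_id.
      + by apply: pushupE0 => //; rewrite /ht; apply/orP; left; lra.
      + by apply: pushupE0 => //; rewrite /ht; apply/orP; right; lra.
    by rewrite /lift -/m e1 subrr scale0r addr0.
  have k_1 : k = 1; last by rewrite rE lp k_1 subrr scale0r addr0.
  case: out => [w2|lo|hi]; first exact: stretchE3.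
    have s00 : s = 0.
      rewrite /s lp /slope; have : (ht p - 1) / (2 * H) <= 0.
        by rewrite ler_pdivrMr ?mulr_gt0 // mul0r /ht; lra.
      by move=> u0; apply: clamp_low; left.
    by rewrite /k s00 stretch0.
  have s00 : s = 0.
    by rewrite /s lp; apply: clamp_low; right; rewrite /ht; lra.
  by rewrite /k s00 stretch0.
split.
  move=> pt; have y1 : 0 <= ht p <= 1 by rewrite /ht; lra.
  have := pushup_below H0 m1 y1; rewrite -rt {1}/ht => b; split; first by lra.
  have [|gt] := leP (raise p 0 t) C; first by left.
  right; split; last by move: b m1; rewrite /ht; lra.
  apply: stretch_in => //.
  (* This quotient [u] is the fraction of [H] by which the lifted point exceeds [C]. A point that
     started below [C] can have risen so far only if [ramp (w p)] is at least [u], which means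
     [w p <= 1 - u / 2]. Since [s] equals [u / 2] here, [stretch] keeps the point within the rim w =
     1. *)
  have u1 : 0 < (pushup H m (ht p) - 1) / H by apply: divr_gt0; lra.
  have u2 : (pushup H m (ht p) - 1) / H <= 1 by rewrite ler_pdivrMr; lra.
  have u3 : (pushup H m (ht p) - 1) / H <= ramp (w p).
    by rewrite ler_pdivrMr // mulrC -/m -rt; lra.
  have := ramp_ge u1 u3.
  have -> : s = ((pushup H m (ht p) - 1) / H) / 2.
    rewrite /s /slope hl; have -> : (pushup H m (ht p) - 1) / (2 * H) = ((pushup H m (ht p) - 1) / H) / 2.
      by field; lra.
    by apply: clamp_mid; lra.
  by move: (_ / H) => u; lra.
move=> pt; have y1 : 1 <= ht p <= H + 2 by rewrite /ht; lra.
have := pushup_above H0 m1 y1; rewrite -rt => b; split; first by lra.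
have [|lt] := leP (C + H) (raise p 0 t); first by left.
right; apply: stretch_out => //.
have u0 : 0 <= (pushup H m (ht p) - 1) / H by apply: divr_ge0; lra.
have u1 : (pushup H m (ht p) - 1) / H < 1 by rewrite ltr_pdivrMr; lra.
have u3 : ramp (w p) <= (pushup H m (ht p) - 1) / H.
  by rewrite ler_pdivlMr // mulrC -/m -rt; lra.
have -> : s = ((pushup H m (ht p) - 1) / H) / 2.
  rewrite /s /slope hl; have -> : (pushup H m (ht p) - 1) / (2 * H) = ((pushup H m (ht p) - 1) / H) / 2.
    by field; lra.
  by apply: clamp_mid; lra.
exact: ramp_le.
Qed.

End Maps.
End Homeo.

Ltac ilia R := repeat match goal with H : context [R] |- _ => clear H end; lia.

(** * Extruding a set of unit cubes through a block *)

Section Extrusion.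
Variables (R : realType) (n : nat).
Notation V := 'rV[R]_n.
Notation Z := 'rV[int]_n.
Variables (z : Z) (a c h : int) (t : 'I_n).
Hypotheses (a2 : 2 <= a) (h1 : 1 <= h).

Definition window (g : Z) :=
  (forall l, l != t -> z 0 l - a - 1 <= g 0 l < z 0 l + a + 1) /\ c - 1 <= g 0 t <= c + h.

Definition over (g : Z) := forall l, l != t -> z 0 l - a <= g 0 l < z 0 l + a.

Definition block (g : Z) := over g /\ c <= g 0 t < c + h.

Definition extruded (X : set Z) : set Z :=
  [set g | (block g -> X (upd g t (c - 1))) /\ (~ block g -> X g)].

(** Around the block, horizontal facets of [X] occur at height [c] only; the top [c + h] is included
    in the ban. Vertical facets may cross the block but not lie on its side planes: horizontal
    motion takes place only within distance one of these planes, and no other integral hyperplane is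
    met there. *)
Definition extrudable (X : set Z) :=
  (forall g, window g -> c < g 0 t -> X g = X (dn t g)) /\
  (forall g l, l != t -> window g -> g 0 l = z 0 l - a \/ g 0 l = z 0 l + a ->
     X g = X (dn l g)).

Let adjacent (x y : int) l := x = y \/
  (exists2 f : int, f = z 0 l - a \/ f = z 0 l + a & (f - 1 <= x <= f) /\ (f - 1 <= y <= f)).

Let slide (X : set Z) g g' : extrudable X -> window g -> window g' ->
  (forall l, l != t -> adjacent (g 0 l) (g' 0 l) l) ->
  (g 0 t = g' 0 t \/ c <= g 0 t /\ c <= g' 0 t) -> X g = X g'.
Proof.
move=> [E1 E2] wg wg' adj ht; apply: no_wall_const => l u uk ul; apply.
have wu : window u.
  split=> [k kt|]; [have [b _] := wg; have [b' _] := wg'; have := b _ kt; have := b' _ kt|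
    have [_ b] := wg; have [_ b'] := wg'; move: b b'].
    by have := uk k; lia.
  by have := uk t; lia.
have [lt|lt] := eqVneq l t; first by subst l; apply: E1 => //; have := uk t; lia.
apply: E2 => //; have ukl := uk l; have [e|[f fE [b b']]] := adj _ lt; first lia.
by have -> : u 0 l = f by lia.
Qed.

Let zr l : R := (z 0 l)%:~R.
(** With half-width [a - 1] the side planes of the block are at w = 1, and w = 2, where the map
    becomes the identity, is one unit further out. *)
Let A : R := a%:~R - 1.
Let C : R := c%:~R.
Let H : R := h%:~R.
Let phi := raise zr A C H t.

Let A0 : 0 <= A.
Proof. by rewrite /A subr_ge0 (_ : 1 = 1%:~R) // ler_int; lia. Qed.

Let H1 : 1 <= H.
Proof. by rewrite /H (_ : 1 = 1%:~R) // ler_int. Qed.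

Let lt_intr (x y : int) : x%:~R < y%:~R :> R -> x < y.
Proof. by rewrite ltr_int. Qed.

Let pick_unit (x : R) (i j : int) : i%:~R <= x <= j%:~R -> i < j ->
  exists k : int, [/\ i <= k, k < j & k%:~R <= x <= k%:~R + 1].
Proof.
move=> /andP [ix xj] ij; have [e|ne] := eqVneq x j%:~R.
  exists (j - 1); split; [lia|lia|]; rewrite e intrB; lra.
have := Num.Theory.floor_itv x; rewrite intrD => /andP [f1 f2].
exists (Num.floor x); split; last by rewrite f1 ltW.
  suff : i < Num.floor x + 1 by lia.
  by apply: lt_intr; rewrite intrD; apply: le_lt_trans f2.
by apply: lt_intr; apply: le_lt_trans f1 _; rewrite lt_neqAle ne.
Qed.

Let softE (x : R) : A < x -> soft A x = x - A.
Proof. by move=> Ax; rewrite /soft; move: A0; mlra. Qed.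
Let softN (x : R) : x < - A -> soft A x = x + A.
Proof. by move=> Ax; rewrite /soft; move: A0; mlra. Qed.
Let soft0 (x : R) : - A <= x <= A -> soft A x = 0.
Proof. by move=> Ax; rewrite /soft; move: A0; mlra. Qed.

Let norm_soft (p : V) l : l != t -> `|soft A (p 0 l - zr l)| <= `|core zr A t p|.
Proof.
move=> lt; have := norm_coord (core zr A t p) l.
by rewrite [core _ _ _ _ 0 l]mxE (negbTE lt).
Qed.

(** Follows one horizontal coordinate. Its unit interval is kept or replaced by one touching the
    same side plane, so no facet of an extrudable set is crossed. When the excess becomes exactly 1
    the image lies on the side plane, and both the inner and the outer interval are available. *)
Let shift_coord (x x' k : R) (g : int) l : 1 <= k -> g%:~R <= x <= g%:~R + 1 ->
  `|soft A (x - zr l)| < 2 -> `|k * soft A (x - zr l)| < 2 ->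
  x' = x + (k - 1) * soft A (x - zr l) ->
  exists g' : int, [/\ g'%:~R <= x' <= g'%:~R + 1, adjacent g g' l,
    z 0 l - a - 1 <= g' < z 0 l + a + 1,
    `|k * soft A (x - zr l)| <= 1 -> z 0 l - a <= g' < z 0 l + a &
    1 <= `|k * soft A (x - zr l)| ->
      exists g'' : int, [/\ g''%:~R <= x' <= g''%:~R + 1, adjacent g g'' l,
    z 0 l - a - 1 <= g'' < z 0 l + a + 1 & ~ (z 0 l - a <= g'' < z 0 l + a)]].
Proof.
move=> k1 gx s2 ks2 x'E.
have AE : A = (a - 1)%:~R by rewrite intrB.
have [hi|hi] := ltP A (x - zr l).
  have se := softE hi; rewrite se in s2 ks2 x'E *.
  have kp : 0 <= k * (x - zr l - A) by apply: mulr_ge0; lra.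
  have x'2 : x' = zr l + A + k * (x - zr l - A) by rewrite x'E; ring.
  rewrite (ger0_norm kp) in ks2 *; rewrite ger0_norm in s2; last lra.
  have g1 : g < z 0 l + a + 1.
    by apply: lt_intr; rewrite !intrD; move: s2; rewrite /zr /A; lra.
  have g2 : z 0 l + a - 2 < g.
    by apply: lt_intr; rewrite !intrD; move: hi; rewrite /zr /A; lra.
  have adj (f : int) : z 0 l + a - 1 <= f <= z 0 l + a -> adjacent g f l.
    by move=> fb; right; exists (z 0 l + a); [right|clear -fb g1 g2; lia].
  have [le|gt] := leP (k * (x - zr l - A)) 1.
    exists (z 0 l + a - 1); split; [|by apply: adj; clear -a2; lia|clear -a2; lia|clear -a2; lia|].
      by rewrite !intrD /=; move: x'2 kp le; rewrite /zr /A; move: (k * _) => u; lra.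
    move=> ge; exists (z 0 l + a); split; [|by apply: adj; clear -a2; lia|clear -a2; lia|clear -a2; lia].
    by rewrite !intrD /=; move: x'2 ge le; rewrite /zr /A; move: (k * _) => u; lra.
  exists (z 0 l + a); split; [|by apply: adj; clear -a2; lia|clear -a2; lia|by []|].
    by rewrite !intrD /=; move: x'2 gt ks2; rewrite /zr /A; move: (k * _) => u; lra.
  move=> _; exists (z 0 l + a); split; [|by apply: adj; clear -a2; lia|clear -a2; lia|clear -a2; lia].
  by rewrite !intrD /=; move: x'2 gt ks2; rewrite /zr /A; move: (k * _) => u; lra.
have [lo|lo] := ltP (x - zr l) (- A).
  have se := softN lo; rewrite se in s2 ks2 x'E *.
  have kp : k * (x - zr l + A) <= 0 by rewrite mulr_ge0_le0; lra.
  have x'2 : x' = zr l - A + k * (x - zr l + A) by rewrite x'E; ring.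
  rewrite (ler0_norm kp) in ks2 *; rewrite ler0_norm in s2; last lra.
  have g1 : g < z 0 l - a + 1.
    by apply: lt_intr; rewrite !intrD !intrN; move: lo; rewrite /zr /A; lra.
  have g2 : z 0 l - a - 2 < g.
    by apply: lt_intr; rewrite !intrD !intrN; move: s2; rewrite /zr /A; lra.
  have adj (f : int) : z 0 l - a - 1 <= f <= z 0 l - a -> adjacent g f l.
    by move=> fb; right; exists (z 0 l - a); [left|clear -fb g1 g2; lia].
  have [le|gt] := leP (- (k * (x - zr l + A))) 1.
    exists (z 0 l - a); split; [|by apply: adj; clear -a2; lia|clear -a2; lia|clear -a2; lia|].
      by rewrite !intrD !intrN /=; move: x'2 kp le; rewrite /zr /A; move: (k * _) => u; lra.
    move=> ge; exists (z 0 l - a - 1); split; [|by apply: adj; clear -a2; lia|clear -a2; lia|clear -a2; lia].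
    by rewrite !intrD !intrN /=; move: x'2 ge le; rewrite /zr /A; move: (k * _) => u; lra.
  exists (z 0 l - a - 1); split; [|by apply: adj; clear -a2; lia|clear -a2; lia|by []|].
    by rewrite !intrD !intrN /=; move: x'2 gt ks2; rewrite /zr /A; move: (k * _) => u; lra.
  move=> _; exists (z 0 l - a - 1); split; [|by apply: adj; clear -a2; lia|clear -a2; lia|clear -a2; lia].
  by rewrite !intrD !intrN /=; move: x'2 gt ks2; rewrite /zr /A; move: (k * _) => u; lra.
have se : soft A (x - zr l) = 0 by apply: soft0; lra.
rewrite se in x'E *; rewrite mulr0 addr0 in x'E; rewrite mulr0 normr0 x'E.
have g1 : z 0 l - a <= g.
  suff : z 0 l - a < g + 1 by clear; lia.
  by apply: lt_intr; rewrite !intrD !intrN; move: lo; rewrite /zr /A; lra.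
have g2 : g < z 0 l + a.
  by apply: lt_intr; rewrite !intrD; move: hi; rewrite /zr /A; lra.
by exists g; split; [exact: gx|left|clear -g1 g2; lia|rewrite g1 g2|rewrite ler10].
Qed.

(** Away from the block nothing moves. A point from below [c] stays below or enters the block, where
    [extruded X] copies the layer [c - 1]. A point from above [c] is driven out through the top or
    through a side, where membership is as before. *)
Let forward (X : set Z) p : extrudable X -> cubes X p -> cubes (extruded X) (phi p).
Proof.
move=> EX [g Xg gp]; set w := `|core zr A t p|.
have [k [k1 [raiseL [softL [kw2 [rid [rlow rhigh]]]]]]] := raiseP zr C t A0 H1 p.
rewrite -/w -/phi in raiseL softL kw2 rid rlow rhigh.
have [out|ins] := pselect ([\/ 2 <= w, p 0 t <= C - 1 | C + H + 1 <= p 0 t]).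
  rewrite rid //; exists g => //; split=> [[ov /andP [ct ch]]|_ //]; exfalso.
  have pt := gp t.
  case: out => [w2|lo|hi].
  - have : w <= 1.
      apply: norm_le => // l; rewrite mxE; case: (eqVneq l t) => [_|lt]; first by rewrite normr0.
      have /andP [q1 q2] := ov _ lt; have pl := gp l.
      have q1' : (z 0 l)%:~R - a%:~R <= (g 0 l)%:~R :> R by rewrite -intrB ler_int.
      have q2' : (g 0 l)%:~R + 1 <= (z 0 l)%:~R + a%:~R :> R.
        by rewrite -[1]/(1%:~R) -!intrD ler_int; ilia R.
      by apply: soft_le => //; rewrite /zr /A; lra.
    by lra.
  - have : c%:~R <= (g 0 t)%:~R :> R by rewrite ler_int.
    by move: lo; rewrite /C; lra.
  have : (g 0 t)%:~R + 1 <= c%:~R + h%:~R :> R.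
    by rewrite -[1]/(1%:~R) -!intrD ler_int; ilia R.
  by move: hi; rewrite /C /H; lra.
have w2 : w < 2 by rewrite ltNge; apply/negP => ?; apply: ins; constructor 1.
have plo : C - 1 < p 0 t by rewrite ltNge; apply/negP => ?; apply: ins; constructor 2.
have phi_ : p 0 t < C + H + 1 by rewrite ltNge; apply/negP => ?; apply: ins; constructor 3.
have kw := kw2 w2.
clear rid; move: (phi p) raiseL softL rlow rhigh => q raiseL softL rlow rhigh.
have s2 l : l != t -> `|soft A (p 0 l - zr l)| < 2.
  by move=> lt; apply: le_lt_trans (norm_soft p lt) w2.
have ks l : l != t -> `|k * soft A (p 0 l - zr l)| <= k * w.
  move=> lt; have k0 : 0 <= k := le_trans ler01 k1.
  by rewrite normrM ger0_norm //; apply: ler_wpM2l => //; exact: norm_soft.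
have wing : window g.
  split=> [l lt|].
    have := soft_lt A0 (ltr0Sn _ 1) (s2 _ lt); have := gp l; rewrite /zr /A => pl sl.
    apply/andP; split.
      suff : z 0 l - a - 1 < g 0 l + 1 by ilia R.
      by apply: lt_intr; rewrite !intrD !intrN; lra.
    by apply: lt_intr; rewrite !intrD; lra.
  have := gp t => pt; apply/andP; split.
    suff : c - 1 < g 0 t + 1 by ilia R.
    by apply: lt_intr; rewrite !intrD !intrN; move: plo; rewrite /C; lra.
  suff : g 0 t < c + h + 1 by ilia R.
  by apply: lt_intr; rewrite !intrD; move: phi_; rewrite /C /H; lra.
pose ok (l : 'I_n) (v : int) := [/\ v%:~R <= q 0 l <= v%:~R + 1, adjacent (g 0 l) v l,
    z 0 l - a - 1 <= v < z 0 l + a + 1 & k * w <= 1 -> z 0 l - a <= v < z 0 l + a].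
have ex l : exists v, l != t -> ok l v.
  have [->|lt] := eqVneq l t; first by exists 0.
  have [v [v1 v2 v3 v4 _]] := shift_coord k1 (gp l) (s2 _ lt) (le_lt_trans (ks _ lt) kw) (raiseL _ lt).
  by exists v => _; split=> // kw1; apply: v4; apply: le_trans kw1; exact: ks.
pose f l := projT1 (cid (ex l)).
have fP l : l != t -> ok l (f l) by exact: projT2 (cid (ex l)).
have build (f' : 'I_n -> int) (v : int) :
    (forall l, l != t -> [/\ (f' l)%:~R <= q 0 l <= (f' l)%:~R + 1,
       adjacent (g 0 l) (f' l) l & z 0 l - a - 1 <= f' l < z 0 l + a + 1]) ->
    v%:~R <= q 0 t <= v%:~R + 1 -> c - 1 <= v <= c + h ->
    let g' := upd (\row_l f' l) t v in
    ((c <= v -> c <= g 0 t) /\ (c <= g 0 t -> c <= v) /\ (~ block g') \/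
      block g' /\ g 0 t = c - 1) ->
    cubes (extruded X) (q).
  move=> f'P pv vb g' cs.
  have gc l : g' 0 l = if l == t then v else f' l by rewrite updE mxE.
  have wg' : window g'.
    split=> [l lt|]; last by rewrite gc eqxx.
    by rewrite gc (negbTE lt); have [] := f'P _ lt.
  exists g'; last first.
    move=> l; rewrite gc; have [->//|lt] := eqVneq l t.
    by have [] := f'P _ lt.
  have adj l : l != t -> adjacent (g 0 l) (g' 0 l) l.
    by move=> lt; rewrite gc (negbTE lt); have [] := f'P _ lt.
  case: cs => [[i1 [i2 nb]]|[bl gt]]; split=> // _.
    rewrite -(slide EX wing wg') // gc eqxx.
    have [lo|hi] := ltP (g 0 t) c; last by right; have := i2 hi; ilia R.
    by left; have [_ wt] := wing; have : ~ c <= v by [move=> /i1; ilia R]; ilia R.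
  have wg2 : window (upd g' t (c - 1)).
    have [b1 b2] := wg'; split=> [l lt|]; last by rewrite updE eqxx; ilia R.
    by rewrite updE (negbTE lt); exact: b1.
  rewrite -(slide EX wing wg2) //; last by left; rewrite updE eqxx.
  by move=> l lt; rewrite updE (negbTE lt); exact: adj.
have fP' l : l != t -> [/\ (f l)%:~R <= q 0 l <= (f l)%:~R + 1,
       adjacent (g 0 l) (f l) l & z 0 l - a - 1 <= f l < z 0 l + a + 1].
  by move=> /fP [].
have pt := gp t; have [_ gtb] := wing.
have [lo|hi] := ltP (g 0 t) c.
  have ge : g 0 t = c - 1 by ilia R.
  rewrite ge intrB in pt.
  have [r1 r2] := rlow ltac:(rewrite /C; lra).
  have [le|gt] := leP (q 0 t) C.
    apply: (build f (c - 1)) => //; [by rewrite intrB; move: r1 le; rewrite /C; lra|ilia R|].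
    by left; split; [ilia R|split; [ilia R|]] => -[_]; rewrite updE eqxx; ilia R.
  case: r2 => [|[kw1 r3]]; first lra.
  have [v [v1 v2 v3]] := @pick_unit (q 0 t) c (c + h)
     ltac:(rewrite intrD; move: gt r3; rewrite /C /H; lra) ltac:(ilia R).
  apply: (build f v) => //; first ilia R.
  right; split=> //; split=> [l lt|]; last by rewrite updE eqxx; ilia R.
  by rewrite updE (negbTE lt) mxE; have [_ _ _] := fP _ lt; exact.
have gC : C <= p 0 t.
  have : c%:~R <= (g 0 t)%:~R :> R by rewrite ler_int.
  by rewrite /C; lra.
have [r1 r2] := rhigh ltac:(lra).
have [ge|lt1] := leP (C + H) (q 0 t).
  apply: (build f (c + h)) => //; [by rewrite intrD; move: ge r1; rewrite /C /H; lra|ilia R|].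
  by left; split=> //; split; [ilia R|] => -[_]; rewrite updE eqxx; ilia R.
case: r2 => [|kw1]; first lra.
(* To be outside the base it is enough that one coordinate is. A coordinate attaining the norm is
   given the outer interval; the others keep the choice [f]. *)
have [l0 l0P] : exists l, 1 <= `|(k *: core zr A t p) 0 l|.
  by apply: norm_attained => //; rewrite normrZ ger0_norm //; lra.
have l0t : l0 != t.
  by apply/eqP => e; move: l0P; rewrite coordZ mxE e eqxx mulr0 normr0 ler10.
rewrite coordZ mxE (negbTE l0t) in l0P.
have [_ [_ _ _ _ far]] := shift_coord k1 (gp l0) (s2 _ l0t) (le_lt_trans (ks _ l0t) kw) (raiseL _ l0t).
have [v0 [v01 v02 v03 v04]] := far l0P.
have [v [v1 v2 v3]] := @pick_unit (q 0 t) c (c + h)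
   ltac:(rewrite intrD; move: lt1 r1; rewrite /C /H; lra) ltac:(ilia R).
apply: (build (fun l => if l == l0 then v0 else f l) v) => //; [|ilia R|].
  by move=> l lt; case: eqP => [->|_]; [split|exact: fP'].
left; split=> //; split; first ilia R.
by move=> [ov _]; apply: v04; have := ov _ l0t; rewrite updE (negbTE l0t) mxE eqxx.
Qed.

Lemma extruded_ambient (X : set Z) (r : int) : extrudable X ->
  (forall g, X g -> nearby r g) -> (forall g, extruded X g -> nearby r g) ->
  exists f f' : V -> V, ambient f f' /\ cubes (extruded X) = f @` cubes X.
Proof.
move=> EX bX bX'; have [g am] : exists g, ambient phi g.
  by eexists; exact: (raise_ambient zr C t A0 H1).
exists phi, g; split=> //.
apply: (ambient_cubes am bX _ _ bX') => p; first exact: forward.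
have EXc : extrudable (~` X).
  have [E1 E2] := EX; split=> [u wu ct|u l lt wu fl].
    by rewrite /setC /mkset (E1 u).
  by rewrite /setC /mkset (E2 u l).
move=> /(forward EXc) [u [g1 g2] gp]; exists u => //= -[g3 g4].
by have [b|b] := pselect (block u); [exact: (g1 b) (g3 b)|exact: (g2 b) (g4 b)].
Qed.

End Extrusion.

(** * Balls *)

Section Balls.
Variables (R : realType) (n : nat).
Notation V := 'rV[R]_n.
Notation Z := 'rV[int]_n.

Definition sup_ball : set V := [set p | `|p| <= 1].

(** A homeomorphism of the region alone would neither determine its boundary in the ambient space
    nor compose with the extrusions. *)
Definition ambient_ball (X : set V) :=
  exists f f', ambient f f' /\ X = f @` sup_ball.

Lemma ambient_ball_image f f' X : ambient f f' -> ambient_ball X -> ambient_ball (f @` X).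
Proof.
move=> [cf cf' fK f'K] [g [g' [[cg cg' gK g'K] ->]]].
exists (f \o g), (g' \o f'); split; last by rewrite image_comp.
split.
- by move=> x; apply: continuous_comp; [exact: cg|exact: cf].
- by move=> x; apply: continuous_comp; [exact: cf'|exact: cg'].
- by move=> x /=; rewrite fK gK.
by move=> x /=; rewrite g'K f'K.
Qed.

Lemma ambient_ball_box (lo hi : 'I_n -> int) : (forall l, lo l < hi l) ->
  ambient_ball (@cubes R n [set g : Z | forall l, lo l <= g 0 l < hi l]).
Proof.
move=> lh; pose m l : R := ((lo l)%:~R + (hi l)%:~R) / 2.
pose r l : R := ((hi l)%:~R - (lo l)%:~R) / 2.
have r0 l : 0 < r l by rewrite /r; have : (lo l)%:~R < (hi l)%:~R :> R by [rewrite ltr_int]; lra.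
exists (fun p => \row_l (m l + r l * p 0 l)), (fun p => \row_l ((r l)^-1 * (p 0 l - m l))).
split; [split|].
- apply: cts_row => l; under eq_fun do rewrite mxE.
  apply: cts_add; first exact: cts_cst.
  by apply: cts_mul; [exact: cts_cst|exact: coord_continuous].
- apply: cts_row => l; under eq_fun do rewrite mxE.
  apply: cts_mul; first exact: cts_cst.
  by apply: cts_add; [exact: coord_continuous|exact: cts_cst].
- by move=> p; apply/rowP => l; rewrite !mxE; field; exact: lt0r_neq0.
- by move=> p; apply/rowP => l; rewrite !mxE; field; exact: lt0r_neq0.
have boxE p : @cubes R n [set g : Z | forall l, lo l <= g 0 l < hi l] p <->
    forall l, (lo l)%:~R <= p 0 l <= (hi l)%:~R.
  split=> [[g /= gb gp] l|H].
    have /andP [b1 b2] := gb l; have := gp l.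
    have c1 : (lo l)%:~R <= (g 0 l)%:~R :> R by rewrite ler_int.
    have c2 : (g 0 l)%:~R + 1 <= (hi l)%:~R :> R by rewrite -[1]/(1%:~R) -intrD ler_int; lia.
    by lra.
  have ex l : exists k : int, lo l <= k < hi l /\ k%:~R <= p 0 l <= k%:~R + 1.
    have := H l => /andP [h1 h2]; have [e|ne] := eqVneq (p 0 l) (hi l)%:~R.
      exists (hi l - 1); have := lh l; split; first lia.
      by rewrite e intrB; lra.
    have := Num.Theory.floor_itv (p 0 l); rewrite intrD => /andP [f1 f2].
    exists (Num.floor (p 0 l)); split; last by rewrite f1 ltW.
    apply/andP; split.
      suff : lo l < Num.floor (p 0 l) + 1 by lia.
      by rewrite -(@ltr_int R) intrD; apply: le_lt_trans f2.
    by rewrite -(@ltr_int R); apply: le_lt_trans f1 _; rewrite lt_neqAle ne.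
  exists (\row_l projT1 (cid (ex l))) => l; rewrite mxE; by case: cid => k [].
apply/seteqP; split=> [p /boxE H|p [q /= q1 <-]].
  exists (\row_l ((r l)^-1 * (p 0 l - m l))); last first.
    by apply/rowP => l; rewrite !mxE; field; exact: lt0r_neq0.
  apply: norm_le => // l; rewrite mxE normrM normfV (gtr0_norm (r0 l)) mulrC ler_pdivrMr //.
  by rewrite mul1r ler_norml /m /r; have := H l; lra.
apply/boxE => l; rewrite mxE; have := le_trans (norm_coord q l) q1; rewrite ler_norml => /andP [a1 a2].
have b1 : 0 <= r l * (1 - q 0 l) by apply: mulr_ge0; [exact: ltW|lra].
have b2 : 0 <= r l * (1 + q 0 l) by apply: mulr_ge0; [exact: ltW|lra].
have e1 : r l * (1 - q 0 l) = r l - r l * q 0 l by ring.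
have e2 : r l * (1 + q 0 l) = r l + r l * q 0 l by ring.
rewrite e1 in b1; rewrite e2 in b2; move: (r l * q 0 l) b1 b2 => u; rewrite /m /r; lra.
Qed.

Lemma star_connected (c : V) (X : set V) : X c ->
  (forall p s, X p -> 0 <= s <= 1 -> X (c + s *: (p - c))) -> connected X.
Proof.
move=> Xc st.
have -> : X = \bigcup_(p in X) [set c + s *: (p - c) | s in `[0, 1 : R]].
  apply/seteqP; split=> [p Xp|q [p Xp [s /= s1 <-]]].
    exists p => //; exists 1; first by rewrite /= in_itv /= ler01 lexx.
    by rewrite scale1r addrC subrK.
  by apply: st => //; move: s1; rewrite in_itv.
apply: bigcup_connected.
  exists c => p Xp; exists 0; first by rewrite /= in_itv /= ler01 lexx.
  by rewrite scale0r addr0.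
move=> p Xp; apply: connected_continuous_connected; first exact: segment_connected.
apply: continuous_subspaceT; apply: cts_addv; first exact: cst_continuous.
by apply: cts_scale; [move=> s|exact: cst_continuous].
Qed.

Lemma sup_ball_connected : connected sup_ball.
Proof.
apply: (@star_connected 0); first by rewrite /sup_ball /= normr0.
move=> p s /= p1 s1; rewrite add0r subr0 /sup_ball /= normrZ ger0_norm; last by lra.
by rewrite mulr_ile1 //; lra.
Qed.

Let sphere : set V := [set p | `|p| = 1].
Let facet l (s : R) : set V := [set p : V | `|p| <= 1 /\ p 0 l = s].

Let corner2 (i j : 'I_n) (s s' : R) : V := \row_l (if l == i then s else if l == j then s' else 0).

Let corner2_facet i j s s' : i != j -> `|s| = 1 -> `|s'| = 1 ->
  facet i s (corner2 i j s s') /\ facet j s' (corner2 i j s s').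
Proof.
move=> ij s1 s'1; have N : `|corner2 i j s s'| <= 1.
  apply: norm_le => // l; rewrite mxE; case: ifP => _; first by rewrite s1.
  by case: ifP => _; rewrite ?s'1 ?normr0.
by split; split=> //; rewrite mxE ?eqxx // eq_sym (negbTE ij).
Qed.

Let facet_connected l s : `|s| = 1 -> connected (facet l s).
Proof.
move=> s1; pose c : V := \row_k (if k == l then s else 0).
have c1 : `|c| <= 1 by apply: norm_le => // k; rewrite mxE; case: ifP; rewrite ?s1 ?normr0.
have cl : c 0 l = s by rewrite mxE eqxx.
apply: (@star_connected c) => // p t [p1 pl] t1; split; last first.
  by rewrite coordD coordZ coordD coordN cl pl subrr mulr0 addr0.
have -> : c + t *: (p - c) = (1 - t) *: c + t *: p.
  by apply/rowP => k; rewrite !mxE; ring.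
apply: le_trans (ler_normD _ _) _; rewrite !normrZ !ger0_norm; [|lra|lra].
have : (1 - t) * `|c| <= (1 - t) * 1 by apply: ler_wpM2l => //; lra.
have : t * `|p| <= t * 1 by apply: ler_wpM2l => //; lra.
by move: (_ * `|c|) (_ * `|p|) => u v; lra.
Qed.

(** The facet x_i0 = 1 meets every facet of another direction. The opposite facet x_i0 = -1 does not
    meet it and is attached through x_i1 = 1, which is where a second direction is needed. *)
Lemma sphere_connected : (2 <= n)%N -> connected sphere.
Proof.
move=> n2; pose i0 : 'I_n := Ordinal (ltnW n2); pose i1 : 'I_n := Ordinal n2.
have i01 : i0 != i1 by [].
pose P (u : 'I_n * R) := u.1 != i0 /\ `|u.2| = 1.
pose A := \bigcup_(u in P) (facet i0 1 `|` facet u.1 u.2).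
have n1 : `|1 : R| = 1 by exact: normr1.
have nN1 : `|-1 : R| = 1 by rewrite normrN1.
have -> : sphere = A `|` facet i0 (-1).
  apply/seteqP; split=> p.
    move=> /= p1; have [l lp] : exists l, 1 <= `|p 0 l| by apply: norm_attained; rewrite ?p1.
    have pl : `|p 0 l| = 1 by apply/eqP; rewrite eq_le lp andbT -p1 norm_coord.
    have [e|ne] := eqVneq l i0; last first.
      by left; exists (l, p 0 l) => //; right; split=> //=; rewrite p1.
    have [ge|lt] := leP 0 (p 0 l).
      left; exists (i1, 1); first by split=> //; rewrite eq_sym.
      left; split; first by rewrite p1.
      by rewrite -e -pl ger0_norm.
    by right; split; [rewrite p1|rewrite -e -pl ltr0_norm ?opprK].
  have fs l s : `|s| = 1 -> facet l s p -> sphere p.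
    move=> s1 [p1 pl]; apply/eqP; rewrite eq_le p1 /= -s1 -pl; exact: norm_coord.
  move=> [[[l s] [_ s1] [|]]|]; [exact: fs|exact: fs|exact: fs].
apply: connectedU; last exact: facet_connected.
  have [f1 f2] := corner2_facet i01 nN1 n1.
  exists (corner2 i0 i1 (-1) 1); split=> //.
  by exists (i1, 1); [split=> //; rewrite eq_sym|right].
apply: bigcup_connected.
  exists (corner2 i0 i1 1 1) => u _; left; by have [] := corner2_facet i01 n1 n1.
move=> [l s] [/= li s1]; apply: connectedU; [|exact: facet_connected|exact: facet_connected].
exists (corner2 i0 l 1 s); apply: corner2_facet => //; by rewrite eq_sym.
Qed.

Lemma ambient_ball_connected X : ambient_ball X -> connected X.
Proof.
move=> [f [f' [[cf _ _ _] ->]]]; apply: connected_continuous_connected.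
  exact: sup_ball_connected.
exact: continuous_subspaceT.
Qed.

Lemma sup_ball_closed : closed sup_ball.
Proof.
have -> : sup_ball = (fun p : V => `|p|) @^-1` [set x | x <= 1] by [].
by apply: preimage_closed; [move=> p _; exact: norm_continuous|exact: closed_le].
Qed.

Lemma ambient_ball_boundary X : (2 <= n)%N -> ambient_ball X -> connected (boundary X).
Proof.
move=> n2 [f [f' [[cf cf' fK f'K] XE]]].
have XE' : X = f' @^-1` sup_ball.
  rewrite XE; apply/seteqP; split=> [p [q q1 <-]|p /= p1]; first by rewrite /= fK.
  by exists (f' p).
have cX : closed X.
  by rewrite XE'; apply: preimage_closed sup_ball_closed => p _; exact: cf'.
have -> : boundary X = f @` sphere; last first.
  apply: connected_continuous_connected; first exact: sphere_connected.
  exact: continuous_subspaceT.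
rewrite /boundary -(iffLR (closure_id X) cX); apply/seteqP; split.
  move=> p [Xp nI]; exists (f' p); last exact: f'K.
  rewrite XE' /sup_ball /= in Xp; apply/eqP; rewrite eq_le Xp /= leNgt; apply/negP => lt.
  apply: nI; rewrite XE' /interior.
  have : nbhs (f' p) [set q : V | `|q| < 1].
    by apply: (@norm_continuous _ V (f' p) [set x | x < 1]); exact: lt_nbhsl.
  move=> H; have H2 : nbhs p (f' @^-1` [set q : V | `|q| < 1]) := cf' p _ H.
  by apply: filterS H2 => q /= /ltW.
move=> p [q /= q1 <-]; split; first by rewrite XE'; rewrite /= fK /sup_ball /= q1.
move=> XN; have /nbhs_ballP [e /= e0 He] : nbhs q (f @^-1` X) := cf q _ XN.
have : X (f ((1 + e / 2) *: q)).
  apply: He; rewrite -ball_normE /= scalerDl scale1r opprD addrA subrr add0r normrN normrZ q1 mulr1.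
  by rewrite ger0_norm; lra.
by rewrite XE' /= fK /sup_ball /= normrZ q1 mulr1 ger0_norm; lra.
Qed.

Let enorm (p : V) : R := Num.sqrt (\sum_l p 0 l ^+ 2).

Let enorm_continuous : continuous enorm.
Proof.
have c : continuous (fun p : V => \sum_l p 0 l ^+ 2).
  elim: (index_enum _) => [|l s IH].
    by under eq_fun do rewrite big_nil; exact: cts_cst.
  under eq_fun do rewrite big_cons expr2.
  by apply: cts_add => //; apply: cts_mul; exact: coord_continuous.
by move=> p; apply: (@continuous_comp _ _ _ _ Num.sqrt); [exact: c|exact: sqrt_continuous].
Qed.

Let enormZ (k : R) p : 0 <= k -> enorm (k *: p) = k * enorm p.
Proof.
move=> k0; rewrite /enorm; under eq_bigr do rewrite coordZ exprMn.
by rewrite -mulr_sumr sqrtrM ?sqr_ge0 // sqrtr_sqr ger0_norm.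
Qed.

Let norm_enorm p : `|p| <= enorm p.
Proof.
apply: norm_le => [|l]; first exact: sqrtr_ge0.
rewrite -sqrtr_sqr; apply: ler_wsqrtr; rewrite (bigD1 l) //= lerDl.
by apply: sumr_ge0 => k _; exact: sqr_ge0.
Qed.

Let enorm_norm p : enorm p <= n%:R * `|p|.
Proof.
have h0 : 0 <= n%:R * `|p| by rewrite mulr_ge0.
rewrite -(ger0_norm h0) -sqrtr_sqr; apply: ler_wsqrtr.
apply: (@le_trans _ _ (\sum_(l < n) `|p| ^+ 2)).
  apply: ler_sum => l _; rewrite -[leLHS]real_normK ?num_real //.
  by apply: lerXn2r; rewrite ?nnegrE //; exact: norm_coord.
rewrite sumr_const card_ord exprMn -[leLHS]mulr_natl; apply: ler_wpM2r; first exact: sqr_ge0.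
by rewrite -natrX ler_nat; case: (n) => // k; rewrite -{1}[k.+1]expn1 leq_pexp2l.
Qed.

Let enorm_gt0 p : p != 0 -> 0 < enorm p.
Proof. by move=> p0; apply: lt_le_trans (norm_enorm p); rewrite normr_gt0. Qed.

(** At 0 the factor need not be continuous; since it is bounded, its product with [p] still tends to
    0. *)
Let radial_continuous (u v : V -> R) (M : R) : continuous u -> continuous v ->
  (forall p, p != 0 -> 0 < v p) -> (forall p, `|u p / v p| <= M) ->
  continuous (fun p => (u p / v p) *: p).
Proof.
move=> cu cv v0 b p; have [->|p0] := eqVneq p 0; last first.
  have cuv : (fun q : V => u q / v q) @ p --> u p / v p.
    have H1 : u @ p --> u p := cu p.
    have H2 : v @ p --> v p := cv p.
    by apply: (cvgM H1); apply: (cvgV _ H2); rewrite gt_eqF ?v0.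
  exact: cvgZ cuv cvg_id.
rewrite /continuous_at scaler0.
suff : (fun q : V => (u q / v q) *: q) @ nbhs (0 : V) --> (0 : V) by [].
apply/cvgrPdist_lt => e e0.
have M0 : 0 <= M := le_trans (normr_ge0 _) (b 0).
have : nbhs (0 : V) (ball (0 : V) (e / (M + 1))) by apply: nbhsx_ballx; apply: divr_gt0; lra.
apply: filterS => q; rewrite -ball_normE /= !sub0r !normrN ltr_pdivlMr; last lra.
move=> lt; rewrite normrZ; apply: le_lt_trans lt; rewrite mulrC; apply: ler_wpM2l => //.
by apply: le_trans (b q) _; lra.
Qed.

(** Each ray is rescaled so that the sup norm becomes the Euclidean norm; the two norms are
    comparable, hence the factors are bounded. *)
Lemma ambient_ball_homeomorphic X : ambient_ball X -> homeomorphic X (closed_unit_ball R n).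
Proof.
move=> [f [f' [[cf cf' fK f'K] XE]]].
pose F (p : V) : V := (`|p| / enorm p) *: p.
pose G (p : V) : V := (enorm p / `|p|) *: p.
have cF : continuous F.
  apply: (@radial_continuous _ _ 1); [exact: norm_continuous|exact: enorm_continuous|exact: enorm_gt0|].
  move=> p; have [->|p0] := eqVneq p 0; first by rewrite normr0 mul0r normr0 ler01.
  by rewrite ger0_norm ?divr_ge0 ?sqrtr_ge0 // ler_pdivrMr ?enorm_gt0 // mul1r norm_enorm.
have cG : continuous G.
  apply: (@radial_continuous _ _ n%:R); [exact: enorm_continuous|exact: norm_continuous| |].
    by move=> p; rewrite normr_gt0.
  move=> p; have [->|p0] := eqVneq p 0; first by rewrite normr0 invr0 mulr0 normr0 ler0n.
  by rewrite ger0_norm ?divr_ge0 ?sqrtr_ge0 // ler_pdivrMr ?normr_gt0 // enorm_norm.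
have e0 : enorm 0 = 0 by apply/eqP; rewrite eq_le sqrtr_ge0 andbT; have := enorm_norm 0; rewrite normr0 mulr0.
have eF p : enorm (F p) = `|p|.
  have [->|p0] := eqVneq p 0; first by rewrite /F scaler0 normr0.
  rewrite enormZ ?divr_ge0 ?sqrtr_ge0 // mulfVK // gt_eqF ?enorm_gt0 //.
have nG p : `|G p| = enorm p.
  have [->|p0] := eqVneq p 0; first by rewrite /G scaler0 normr0.
  by rewrite normrZ ger0_norm ?divr_ge0 ?sqrtr_ge0 // mulfVK // normr_eq0.
have nF p : p != 0 -> `|F p| = `|p| * (`|p| / enorm p).
  by move=> p0; rewrite normrZ ger0_norm ?divr_ge0 ?sqrtr_ge0 // mulrC.
have eG p : p != 0 -> enorm (G p) = enorm p * (enorm p / `|p|).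
  by move=> p0; rewrite enormZ ?divr_ge0 ?sqrtr_ge0 // mulrC.
have FK : cancel F G.
  move=> p; have [->|p0] := eqVneq p 0; first by rewrite /F /G !scaler0.
  rewrite {1}/G eF nF // /F scalerA.
  have := enorm_gt0 p0; have : 0 < `|p| by rewrite normr_gt0.
  move: (`|p|) (enorm p) => a b a0 b0.
  have -> : a / (a * (a / b)) * (a / b) = 1 by field; apply/andP; split; exact: lt0r_neq0.
  by rewrite scale1r.
have GK : cancel G F.
  move=> p; have [->|p0] := eqVneq p 0; first by rewrite /F /G !scaler0.
  rewrite {1}/F nG eG // /G scalerA.
  have := enorm_gt0 p0; have : 0 < `|p| by rewrite normr_gt0.
  move: (`|p|) (enorm p) => a b a0 b0.
  have -> : b / (b * (b / a)) * (b / a) = 1 by field; apply/andP; split; exact: lt0r_neq0.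
  by rewrite scale1r.
have ballE p : closed_unit_ball R n p <-> enorm p <= 1.
  rewrite /closed_unit_ball /= /enorm -{2}[1]sqrtr1; split=> H; first exact: ler_wsqrtr.
  by rewrite -ler_sqrt.
exists (F \o f'), (f \o G); split.
- apply: continuous_subspaceT => p; apply: continuous_comp; [exact: cf'|exact: cF].
- apply: continuous_subspaceT => p; apply: continuous_comp; [exact: cG|exact: cf].
- move=> p; rewrite XE => -[q q1 <-] /=; rewrite fK; split; last by rewrite FK.
  by apply/ballE; rewrite eF.
move=> q /ballE q1; split; last by rewrite /= fK GK.
by rewrite XE; exists (G q) => //; rewrite /sup_ball /= nG.
Qed.

End Balls.

(** * Faces and walls *)

Section Faces.
Variables (R : realType) (n : nat).
Notation V := 'rV[R]_n.
Notation Z := 'rV[int]_n.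
Implicit Types (S : set Z) (i l : 'I_n).

Let nbhs_coords (q : V) (D : 'I_n -> bool) (a b : 'I_n -> R) :
  (forall l, D l -> a l < q 0 l < b l) ->
  nbhs q [set r : V | forall l, D l -> a l < r 0 l < b l].
Proof.
move=> H; apply: (@filter_forall V _ (fun l => [set x : V | D l -> a l < x 0 l < b l]) (nbhs q)) => l.
have [Dl|nD] := pselect (D l); last by apply: filterE => x /= Dl; case: nD.
have /andP [al bl] := H l Dl.
have c : {for q, continuous (fun r : V => r 0 l)} by exact: coord_continuous.
have N1 : nbhs q ((fun r : V => r 0 l) @^-1` [set x | x < b l]) := c _ (lt_nbhsl bl).
have N2 : nbhs q ((fun r : V => r 0 l) @^-1` [set x | a l < x]) := c _ (lt_nbhsr al).
by apply: filterS2 N1 N2 => r /= r1 r2 _; apply/andP.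
Qed.

Lemma not_boundary_open_cube S (g : Z) (q : V) (r : int) : (forall g, S g -> nearby r g) ->
  (forall l, (g 0 l)%:~R < q 0 l < (g 0 l)%:~R + 1) -> ~ boundary (cubes S) q.
Proof.
move=> bS gq [cq nI].
have qS : cubes S q by rewrite (iffLR (closure_id _) (cubes_closed bS)).
have [h Sh hq] := qS; have e := unit_cube_interior_uniq gq hq.
apply: nI; rewrite /interior.
have := @nbhs_coords q predT (fun l => (g 0 l)%:~R) (fun l => (g 0 l)%:~R + 1) (fun l _ => gq l).
by apply: filterS => x /= H; exists g; [rewrite e|move=> l; have := H l isT; lra].
Qed.

Lemma boundary_facet S i (g : Z) (q : V) (r : int) : (forall g, S g -> nearby r g) ->
  (forall l, l != i -> (g 0 l)%:~R < q 0 l < (g 0 l)%:~R + 1) -> q 0 i = (g 0 i)%:~R ->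
  boundary (cubes S) q -> wall S i g.
Proof.
move=> bS gq gi [cq nI] e.
have qS : cubes S q by rewrite (iffLR (closure_id _) (cubes_closed bS)).
have [h Sh hq] := qS.
have hl l : l != i -> h 0 l = g 0 l.
  move=> li; have h1 : (g 0 l)%:~R < (h 0 l + 1)%:~R :> R.
    by rewrite intrD; have := gq l li; have := hq l; lra.
  have h2 : (h 0 l)%:~R < (g 0 l + 1)%:~R :> R.
    by rewrite intrD; have := gq l li; have := hq l; lra.
  by move: h1 h2; rewrite !ltr_int; lia.
have hi : h 0 i = g 0 i \/ h 0 i = g 0 i - 1.
  have := hq i; rewrite gi => /andP [h1 h2].
  have h3 : (g 0 i)%:~R <= (h 0 i + 1)%:~R :> R by rewrite intrD.
  by move: h1 h3; rewrite !ler_int; lia.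
have Sg : S g.
  case: hi => hi.
    by have <- : h = g by apply: latP => l; have [->//|/hl] := eqVneq l i.
  rewrite e; have <- : h = dn i g => //.
  by apply: latP => l; rewrite dnE; case: eqP => [->//|/eqP /hl].
have Sd : S (dn i g) by rewrite -e.
apply: nI; rewrite /interior.
pose a l : R := if l == i then (g 0 i)%:~R - 1 else (g 0 l)%:~R.
have := @nbhs_coords q predT a (fun l => (g 0 l)%:~R + 1) _.
have ab l : predT l -> a l < q 0 l < (g 0 l)%:~R + 1.
  by move=> _; rewrite /a; case: eqP => [->|/eqP /gq //]; rewrite gi; lra.
move=> /(_ ab); apply: filterS => x /= H.
have [ge|lt] := leP (g 0 i)%:~R (x 0 i).
  exists g => // l; have := H l isT; rewrite /a; case: eqP => [->|_]; lra.
exists (dn i g) => // l; have := H l isT; rewrite /a dnE; case: eqP => [->|_].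
  by rewrite intrB; lra.
by lra.
Qed.

(** The condition on flat pieces gives a point [p'] near [p] that is interior to [P] within the
    hyperplane. A further small move inside [P] makes the other coordinates non-integral. As a
    boundary point cannot lie in an open unit cube, the hyperplane is integral, and the new point is
    in the relative interior of one facet. *)
Lemma face_facet S i (P : set V) (p : V) (e : R) (r : int) :
  (forall g, S g -> nearby r g) ->
  face i (cubes S) P -> P p -> 0 < e -> exists q (g : Z),
  [/\ P q, `|p - q| < e, wall S i g, q 0 i = (g 0 i)%:~R &
      forall l, l != i -> (g 0 l)%:~R <= q 0 l <= (g 0 l)%:~R + 1].
Proof.
move=> bS [_ [c [Pb Pc]] _ _] Pp e0.
have [p' [[Pp' wP] pp']] : [set p | P p /\ within (hyperplane i c) (nbhs p) P] `&` ball p (e / 2) !=set0.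
  by apply: (Pc p Pp); apply: nbhsx_ballx; lra.
rewrite -ball_normE /= in pp'.
have /nbhs_ballP [d /= d0 Hd] : nbhs p' [set q | hyperplane i c q -> P q] by [].
have [_ p'c] := Pb _ Pp'; rewrite /hyperplane /= in p'c.
have [m m0 [md me]] : exists2 m, 0 < m & m < d /\ m <= e / 2.
  by exists (Num.min (d / 2) (e / 2)); [|split]; mlra.
pose fl l := Num.floor (p' 0 l).
have flP l : (fl l)%:~R <= p' 0 l < (fl l)%:~R + 1.
  by have := Num.Theory.floor_itv (p' 0 l); rewrite intrD.
pose q : V := \row_l (if l == i then c else
   p' 0 l + Num.min m (((fl l)%:~R + 1 - p' 0 l) / 2)).
have qi : q 0 i = c by rewrite mxE eqxx.
have qp : `|p' - q| <= m.
  apply: norm_le => [|l]; first exact: ltW.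
  rewrite coordD coordN mxE; case: eqP => [->|_]; first by rewrite p'c subrr normr0 ltW.
  rewrite opprD addrA subrr add0r normrN; have /andP [f1 f2] := flP l; move: f1 f2 m0.
  by move: ((fl l)%:~R) (p' 0 l) => u v f1 f2 w0; rewrite ger0_norm; mlra.
have qfl l : l != i -> (fl l)%:~R < q 0 l < (fl l)%:~R + 1.
  move=> li; rewrite mxE (negbTE li); have /andP [f1 f2] := flP l; move: f1 f2 m0.
  by move: ((fl l)%:~R) (p' 0 l) => u v f1 f2 w0; mlra.
have Pq : P q.
  apply: Hd => //; rewrite -ball_normE /=; exact: le_lt_trans qp _.
have [bq _] := Pb _ Pq.
have ci : c = (fl i)%:~R.
  apply/eqP; apply: contrapT => /negP ne.
  apply: (@not_boundary_open_cube S (\row_l fl l) q r) => // l; rewrite [(\row__ _) _ _]mxE.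
  have [->|/qfl //] := eqVneq l i; rewrite qi -p'c; have /andP [f1 f2] := flP i.
  by rewrite f2 andbT lt_neqAle f1 andbT p'c eq_sym.
exists q, (\row_l fl l); split=> //.
- have -> : p - q = (p - p') + (p' - q) by rewrite addrA subrK.
  apply: le_lt_trans (ler_normD _ _) _.
  by move: qp pp' me; move: (`|p - p'|) (`|p' - q|) => u v; lra.
- by apply: (boundary_facet bS) bq => [l li|]; rewrite mxE; [exact: qfl|rewrite qi].
- by rewrite mxE qi.
by move=> l /qfl; rewrite [(\row__ _) _ _]mxE; lra.
Qed.

Definition slab i (lo hi : Z) : set V :=
  [set p | p 0 i = (lo 0 i)%:~R /\
    forall l, l != i -> (lo 0 l)%:~R <= p 0 l <= (hi 0 l)%:~R + 1].

Lemma slab_flat S i (lo hi : Z) (r : int) : (forall g, S g -> nearby r g) ->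
  (forall l, lo 0 l <= hi 0 l) -> lo 0 i = hi 0 i ->
  (forall g : Z, (forall l, lo 0 l <= g 0 l <= hi 0 l) -> wall S i g) ->
  flat_piece i (cubes S) (slab i lo hi).
Proof.
move=> bS lh lhi W; exists (lo 0 i)%:~R; split=> p [pi pl].
  split=> //; have ex l : exists k : int, lo 0 l <= k <= hi 0 l /\
      (l != i -> k%:~R <= p 0 l <= k%:~R + 1).
    have [->|li] := eqVneq l i; first by exists (lo 0 i); have := lh i; split; [lia|].
    have /andP [h1 h2] := pl l li; have [e|ne] := eqVneq (p 0 l) ((hi 0 l)%:~R + 1).
      by exists (hi 0 l); have := lh l; split=> [|_]; [lia|rewrite e; lra].
    have := Num.Theory.floor_itv (p 0 l); rewrite intrD => /andP [f1 f2].
    exists (Num.floor (p 0 l)); split; last by rewrite f1 ltW.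
    apply/andP; split.
      suff : lo 0 l < Num.floor (p 0 l) + 1 by lia.
      by rewrite -(@ltr_int R) intrD; apply: le_lt_trans f2.
    suff : Num.floor (p 0 l) < hi 0 l + 1 by lia.
    by rewrite -(@ltr_int R) intrD; apply: le_lt_trans f1 _; rewrite lt_neqAle ne.
  pose g : Z := \row_l projT1 (cid (ex l)).
  have gP l : lo 0 l <= g 0 l <= hi 0 l /\ (l != i -> (g 0 l)%:~R <= p 0 l <= (g 0 l)%:~R + 1).
    by rewrite mxE; case: cid.
  have w : wall S i g by apply: W => l; have [] := gP l.
  have gi : g 0 i = lo 0 i by have [b _] := gP i; lia.
  have pg : @unit_cube R n g p.
    by move=> l; have [->|li] := eqVneq l i; [rewrite gi pi; lra|have [_] := gP l; exact].
  have pd : @unit_cube R n (dn i g) p.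
    move=> l; rewrite dnE; case: eqP => [->|/eqP li]; first by rewrite gi pi intrB; lra.
    by have [_] := gP l; exact.
  have [h [h' [hp h'p Sh nSh']]] : exists h h' : Z,
      [/\ @unit_cube R n h p, @unit_cube R n h' p, S h & ~ S h'].
    have [Sg|nSg] := pselect (S g).
      exists g, (dn i g); split=> // Sd; apply: w; exact/propext.
    exists (dn i g), g; split=> //; apply: contrapT => nSd; apply: w; exact/propext.
  split; first by apply: subset_closure; exists h.
  move=> /nbhs_ballP [e /= e0 He].
  have [q pq qh'] := unit_cube_interior h'p e0.
  have [k Sk kq] : cubes S q by apply: He; rewrite -ball_normE.
  by apply: nSh'; rewrite (unit_cube_interior_uniq qh' kq).
move=> U /nbhs_ballP [e /= e0 He].
pose d := Num.min (e / 2) 1.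
pose w : R := \sum_l ((hi 0 l)%:~R + 1 - (lo 0 l)%:~R).
have lh' l : (lo 0 l)%:~R <= (hi 0 l)%:~R :> R by rewrite ler_int.
have wl l : (hi 0 l)%:~R + 1 - (lo 0 l)%:~R <= w.
  rewrite /w (bigD1 l) //= lerDl; apply: sumr_ge0 => k _; have := lh' k; lra.
have w0 : 0 < w by apply: lt_le_trans (wl i); have := lh' i; lra.
pose m l : R := ((lo 0 l)%:~R + ((hi 0 l)%:~R + 1)) / 2.
pose s := Num.min (e / (2 * w)) 1.
have s0 : 0 < s by rewrite /s lt_min ltr01 andbT; apply: divr_gt0 => //; lra.
have s1 : s <= 1 by rewrite /s ge_min lexx orbT.
pose q : V := \row_l (if l == i then p 0 i else (1 - s) * p 0 l + s * m l).
have qin l : l != i -> (lo 0 l)%:~R < q 0 l < (hi 0 l)%:~R + 1.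
  move=> li; rewrite mxE (negbTE li); have /andP [h1 h2] := pl l li.
  have b1 : 0 <= (1 - s) * (p 0 l - (lo 0 l)%:~R) by apply: mulr_ge0; lra.
  have b2 : 0 <= (1 - s) * ((hi 0 l)%:~R + 1 - p 0 l) by apply: mulr_ge0; lra.
  have b3 : 0 < s * (m l - (lo 0 l)%:~R) by apply: mulr_gt0 => //; rewrite /m; have := lh' l; lra.
  have e1 : (1 - s) * p 0 l + s * m l - (lo 0 l)%:~R =
    (1 - s) * (p 0 l - (lo 0 l)%:~R) + s * (m l - (lo 0 l)%:~R) by ring.
  have e2 : (hi 0 l)%:~R + 1 - ((1 - s) * p 0 l + s * m l) =
    (1 - s) * ((hi 0 l)%:~R + 1 - p 0 l) + s * (m l - (lo 0 l)%:~R) by rewrite /m; field.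
  by move: b1 b2 b3 e1 e2; move: (_ * _) (_ * _) (_ * _) (_ + _ * _) => *; lra.
have qs : slab i lo hi q.
  by split=> [|l li]; [rewrite mxE eqxx|have := qin l li; lra].
exists q; split.
  split=> //; have := @nbhs_coords q (fun l => l != i) _ _ qin.
  by apply: filterS => x /= H xi; split=> // l li; have := H l li; lra.
apply: He; rewrite -ball_normE /=.
apply: (@le_lt_trans _ _ (e / 2)); last by lra.
apply: norm_le => [|l]; first by lra.
rewrite coordD coordN mxE; have [->|li] := eqVneq l i; first by rewrite subrr normr0; lra.
have -> : p 0 l - ((1 - s) * p 0 l + s * m l) = s * (p 0 l - m l) by ring.
rewrite normrM (gtr0_norm s0).
have a1 : `|p 0 l - m l| <= w.
  by have := pl l li; have := wl l; have := lh' l; rewrite ler_norml /m; lra.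
have : s <= e / (2 * w) by rewrite /s ge_min lexx.
rewrite ler_pdivlMr; last by lra.
have : s * `|p 0 l - m l| <= s * w by apply: ler_wpM2l => //; exact: ltW.
have -> : s * (2 * w) = 2 * (s * w) by ring.
by move: (s * w) (s * `|_|) => u v; lra.
Qed.

Lemma slab_connected i (lo hi : Z) : (forall l, lo 0 l <= hi 0 l) -> connected (slab i lo hi).
Proof.
move=> lh; pose c : V := map_mx intr lo.
have cs : slab i lo hi c.
  split=> [|l li]; rewrite mxE //.
  by have : (lo 0 l)%:~R <= (hi 0 l)%:~R :> R by [rewrite ler_int]; lra.
apply: (star_connected cs) => p s [pi pl] s1; split.
  by rewrite coordD coordZ coordD coordN pi mxE subrr mulr0 addr0.
move=> l li; rewrite coordD coordZ coordD coordN.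
have [_ /(_ l li)] := cs; have := pl l li; move: (c 0 l) (p 0 l) => u v.
move: ((lo 0 l)%:~R) ((hi 0 l)%:~R + 1) => a b /andP [v1 v2] /andP [u1 u2].
have e1 : u + s * (v - u) = (1 - s) * u + s * v by ring.
have : 0 <= (1 - s) * (u - a) + s * (v - a).
  by apply: addr_ge0; apply: mulr_ge0; lra.
have : 0 <= (1 - s) * (b - u) + s * (b - v).
  by apply: addr_ge0; apply: mulr_ge0; lra.
have -> : (1 - s) * (b - u) + s * (b - v) = b - (u + s * (v - u)) by ring.
have -> : (1 - s) * (u - a) + s * (v - a) = (u + s * (v - u)) - a by ring.
by move: (u + _) => y; lra.
Qed.

(** Maximality of faces: the union of [P] with a slab of walls that meets it is again a connected
    flat piece in the same hyperplane. *)
Lemma face_slab S i (P : set V) (lo hi : Z) (q : V) (r : int) : (forall g, S g -> nearby r g) ->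
  (forall l, lo 0 l <= hi 0 l) -> lo 0 i = hi 0 i ->
  (forall g : Z, (forall l, lo 0 l <= g 0 l <= hi 0 l) -> wall S i g) ->
  face i (cubes S) P -> P q -> slab i lo hi q -> slab i lo hi `<=` P.
Proof.
move=> bS lh lhi W [_ [c [Pb Pc]] cP max] Pq sq.
have [c' [sb sc]] := slab_flat bS lh lhi W.
have cc : c' = c by have [_ <-] := sb _ sq; have [_ <-] := Pb _ Pq.
have -> : P = P `|` slab i lo hi; last by move=> p; right.
apply/esym; apply: max; last by move=> p; left.
  exists c; rewrite -{2}cc; split=> p [Pp|sp]; rewrite ?cc.
  - exact: Pb.
  - by rewrite -cc; exact: sb.
  - have := Pc _ Pp; apply: closureS => x [Px wx]; split; first by left.
    by apply: filterS wx => y; left.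
  have := sc _ sp; apply: closureS => x [Px wx]; split; first by right.
  by move: wx; rewrite cc; apply: filterS => y; right.
by apply: connectedU => //; [exists q|exact: slab_connected].
Qed.

(** Close points of the faces can be taken inside wall facets by [face_facet]. The additional 1 pays
    for passing from points of facets to their integer corners. *)
Lemma faces_far S S' i (P P' : set V) (d : int) (r : int) :
  (forall g, S g -> nearby r g) -> (forall g, S' g -> nearby r g) ->
  (forall g g', wall S i g -> wall S' i g' -> ~ nearby (d + 1) (g - g')) ->
  face i (cubes S) P -> face i (cubes S') P' -> (d%:~R%:E <= set_dist P P')%E.
Proof.
move=> bS bS' far fP fP'; rewrite leNgt; apply/negP.
move=> /ereal_inf_lt [_ [p Pp [q Pq <-]]]; rewrite lte_fin => lt.
pose e := (d%:~R - `|p - q|) / 2.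
have e0 : 0 < e by rewrite /e; lra.
have [p1 [g [_ pp1 wg pg gl]]] := face_facet bS fP Pp e0.
have [q1 [h [_ qq1 wh qh hl]]] := face_facet bS' fP' Pq e0.
apply: (far _ _ wg wh) => l.
have : `|p1 - q1| < d%:~R.
  have -> : p1 - q1 = - (p - p1) + (p - q) + (q - q1).
    by apply/rowP => k; rewrite !(coordD, coordN); ring.
  apply: le_lt_trans (ler_normD _ _) _; move: (ler_normD (- (p - p1)) (p - q)).
  rewrite normrN; move: pp1 qq1; rewrite /e.
  by move: (`|p - p1|) (`|q - q1|) (`|p - q|) (`|_ + _|) => a b c f; lra.
move=> /(le_lt_trans (norm_coord _ l)); rewrite coordD coordN ltr_norml subE.
have gb : (g 0 l)%:~R <= p1 0 l <= (g 0 l)%:~R + 1.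
  by have [->|/gl//] := eqVneq l i; rewrite pg; lra.
have hb : (h 0 l)%:~R <= q1 0 l <= (h 0 l)%:~R + 1.
  by have [->|/hl//] := eqVneq l i; rewrite qh; lra.
move=> b; have b1 : (g 0 l - h 0 l)%:~R < (d + 1)%:~R :> R by rewrite intrB intrD; lra.
have b2 : (- (d + 1))%:~R < (g 0 l - h 0 l)%:~R :> R by rewrite intrN intrB intrD; lra.
by move: b1 b2; rewrite !ltr_int; clear; lia.
Qed.

End Faces.

Section Faces.
Variables (R : realType) (n : nat).
Notation V := 'rV[R]_n.
Notation Z := 'rV[int]_n.
Implicit Types (S : set Z) (i l : 'I_n).

(* Two walls at distance less than d lie in a common hyperplane, and near them
   all walls in any other direction also lie in a common hyperplane; the two
   faces then contain a common point. *)
Lemma faces_near S S' i (P P' : set V) (d : int) (r : int) : 0 <= d ->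
  (forall g, S g -> nearby r g) -> (forall g, S' g -> nearby r g) ->
  (forall l g g', wall S l g \/ wall S' l g -> wall S l g' \/ wall S' l g' ->
     nearby (6 * d + 20) (g - g') -> g 0 l = g' 0 l) ->
  face i (cubes S) P -> face i (cubes S') P' ->
  ~ (set_dist P P' <= 1%:E)%E -> (d%:~R%:E <= set_dist P P')%E.
Proof.
move=> d0 bS bS' uniq fP fP' n1; rewrite leNgt; apply/negP.
move=> /ereal_inf_lt [_ [p Pp [q Pq <-]]]; rewrite lte_fin => lt.
pose e := (d%:~R - `|p - q|) / 2.
have e0 : 0 < e by rewrite /e; lra.
have [p1 [g [Pp1 pp1 wg pg gl]]] := face_facet bS fP Pp e0.
have [q1 [h [Pq1 qq1 wh qh hl]]] := face_facet bS' fP' Pq e0.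
have gh : nearby (d + 1) (g - h).
  move=> l; have : `|p1 - q1| < d%:~R.
    have -> : p1 - q1 = - (p - p1) + (p - q) + (q - q1).
      by apply/rowP => k; rewrite !(coordD, coordN); ring.
    apply: le_lt_trans (ler_normD _ _) _; move: (ler_normD (- (p - p1)) (p - q)).
    rewrite normrN; move: pp1 qq1; rewrite /e.
    by move: (`|p - p1|) (`|q - q1|) (`|p - q|) (`|_ + _|) => a b c f; lra.
  move=> /(le_lt_trans (norm_coord _ l)); rewrite coordD coordN ltr_norml subE.
  have gb : (g 0 l)%:~R <= p1 0 l <= (g 0 l)%:~R + 1.
    by have [->|/gl//] := eqVneq l i; rewrite pg; lra.
  have hb : (h 0 l)%:~R <= q1 0 l <= (h 0 l)%:~R + 1.
    by have [->|/hl//] := eqVneq l i; rewrite qh; lra.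
  move=> b; have b1 : (g 0 l - h 0 l)%:~R < (d + 1)%:~R :> R by rewrite intrB intrD; lra.
  have b2 : (- (d + 1))%:~R < (g 0 l - h 0 l)%:~R :> R by rewrite intrN intrB intrD; lra.
  by move: b1 b2; rewrite !ltr_int; clear; lia.
have ghi : g 0 i = h 0 i.
  by apply: uniq; [left|right|move=> l; have := gh l; lia].
(* [sep l c] says that a hyperplane containing an [l]-wall separates the cubes at [g] and [h]. Two
   such walls are within [4 * d + 10] of each other, so by [uniq] there is at most one such [c]. *)
pose W l c := exists u, [/\ wall S l u \/ wall S' l u, nearby (2 * d + 5) (u - g) & u 0 l = c].
pose sep l c := W l c /\ Num.min (g 0 l) (h 0 l) < c <= Num.max (g 0 l) (h 0 l).
(* The pair gives the [l]-coordinates to which [g] and [h] can be moved towards each other without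
   crossing a wall: the unit intervals on their own sides of the separating hyperplane, or that of
   [h] for both if there is none. In either case the two intervals have a common point. *)
have ex l : exists vw : int * int, l != i -> [/\
    (forall c, sep l c -> vw.1 = (if g 0 l < c then c - 1 else c) /\
        vw.2 = (if h 0 l < c then c - 1 else c)),
    (~ (exists c, sep l c)) -> vw.1 = h 0 l /\ vw.2 = h 0 l &
    exists c : int, (vw.1 = c \/ vw.1 = c - 1) /\ (vw.2 = c \/ vw.2 = c - 1)].
  have [[c sc]|no] := pselect (exists c, sep l c).
    exists (if g 0 l < c then c - 1 else c, if h 0 l < c then c - 1 else c) => li; split.
    - move=> c' [[u' [w' n' e']] _]; have [[u [w nu eu]] _] := sc.
      suff -> : c' = c by [].
      rewrite -e' -eu; apply: uniq => // k.
      by have := n' k; have := nu k; rewrite !subE; lia.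
    - by case; exists c.
    by exists c => /=; split; case: ifP; auto.
  exists (h 0 l, h 0 l) => li; split=> [c sc|//|]; first by case: no; exists c.
  by exists (h 0 l); auto.
pose vw l := projT1 (cid (ex l)).
have vwP l : l != i -> [/\
    (forall c, sep l c -> (vw l).1 = (if g 0 l < c then c - 1 else c) /\
        (vw l).2 = (if h 0 l < c then c - 1 else c)),
    (~ (exists c, sep l c)) -> (vw l).1 = h 0 l /\ (vw l).2 = h 0 l &
    exists c : int, ((vw l).1 = c \/ (vw l).1 = c - 1) /\ ((vw l).2 = c \/ (vw l).2 = c - 1)].
  exact: projT2 (cid (ex l)).
pose g1 : Z := \row_l (if l == i then g 0 i else (vw l).1).
pose h1 : Z := \row_l (if l == i then g 0 i else (vw l).2).
have between l : Num.min (g 0 l) (h 0 l) <= g1 0 l <= Num.max (g 0 l) (h 0 l) /\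
    Num.min (g 0 l) (h 0 l) <= h1 0 l <= Num.max (g 0 l) (h 0 l).
  rewrite !mxE; have [->|li] := eqVneq l i; first by rewrite ghi; lia.
  have [A1 A2 _] := vwP l li; have [[c sc]|/A2 [-> ->]] := pselect (exists c, sep l c); last by lia.
  by have [-> ->] := A1 c sc; have [_ b] := sc; case: ifP; case: ifP; lia.
(* No wall separates the upper cubes of the facets between [x] and [x1], nor the lower ones.
   Therefore all these facets are walls along with [x], and they form a slab inside the face. *)
have same T (x x1 : Z) : (forall l u, wall T l u -> wall S l u \/ wall S' l u) ->
    x = g /\ x1 = g1 \/ x = h /\ x1 = h1 ->
    forall y : Z, (forall l, Num.min (x 0 l) (x1 0 l) <= y 0 l <= Num.max (x 0 l) (x1 0 l)) ->
    T x = T y :> Prop /\ T (dn i x) = T (dn i y) :> Prop.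
  move=> TS xx y yb.
  have xi : x 0 i = g 0 i /\ x1 0 i = g 0 i.
    by case: xx => -[-> ->]; rewrite mxE eqxx.
  have yi : y 0 i = x 0 i by have := yb i; lia.
  have xb l : Num.min (g 0 l) (h 0 l) <= x 0 l <= Num.max (g 0 l) (h 0 l) /\
      Num.min (g 0 l) (h 0 l) <= x1 0 l <= Num.max (g 0 l) (h 0 l).
    by have [b1 b2] := between l; case: xx => -[-> ->]; lia.
  have no l (u : Z) : l != i -> wall T l u -> nearby (2 * d + 5) (u - g) ->
      Num.min (x 0 l) (y 0 l) < u 0 l <= Num.max (x 0 l) (y 0 l) -> False.
    move=> li wu nu ub; have [A1 A2 _] := vwP l li.
    have sp : sep l (u 0 l).
      split; first by exists u; split=> //; exact: TS wu.
      by have := xb l; have := yb l; lia.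
    have [e1 e2] := A1 _ sp; have := yb l.
    by case: xx => -[ex1 ->]; rewrite mxE (negbTE li) ?e1 ?e2 ex1;
       move: ub; rewrite ex1; case: ifP; lia.
  have nb l (u : Z) : (forall k, k != i -> Num.min (x 0 k) (y 0 k) <= u 0 k <= Num.max (x 0 k) (y 0 k)) ->
      (g 0 i - 1 <= u 0 i <= g 0 i) -> nearby (2 * d + 5) (u - g).
    move=> uk ui k; rewrite subE; have [->|ki] := eqVneq k i; first by lia.
    have := uk k ki; have := yb k; have := xb k; have := gh k; rewrite subE; lia.
  split; apply: no_wall_const => l u uk ul wu.
    have li : l != i by apply/eqP => e1; move: (uk l) ul; rewrite e1 yi; lia.
    apply: (no l u li wu); last by have := uk l; lia.
    by apply: (nb l) => [k _|]; [exact: uk|have := uk i; rewrite yi; lia].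
  have li : l != i by apply/eqP => e1; move: (uk l) ul; rewrite e1 !dnE eqxx yi; lia.
  apply: (no l u li wu).
    apply: (nb l) => [k ki|]; first by have := uk k; rewrite !dnE (negbTE ki).
    by have := uk i; rewrite !dnE eqxx yi; lia.
  by move: (uk l) ul; rewrite !dnE (negbTE li); lia.
have sub T P0 (x x1 : Z) (x2 : V) : (forall y, T y -> nearby r y) ->
    (forall l u, wall T l u -> wall S l u \/ wall S' l u) ->
    x = g /\ x1 = g1 \/ x = h /\ x1 = h1 -> face i (cubes T) P0 -> P0 x2 -> wall T i x ->
    x2 0 i = (x 0 i)%:~R -> (forall l, l != i -> (x 0 l)%:~R <= x2 0 l <= (x 0 l)%:~R + 1) ->
    forall y : V, y 0 i = (g 0 i)%:~R ->
      (forall l, l != i -> (x1 0 l)%:~R <= y 0 l <= (x1 0 l)%:~R + 1) -> P0 y.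
  move=> bT TS xx fT Tx wx xi xl y yi yl.
  pose lo : Z := \row_l Num.min (x 0 l) (x1 0 l); pose hi : Z := \row_l Num.max (x 0 l) (x1 0 l).
  have x1i : x 0 i = g 0 i /\ x1 0 i = g 0 i by case: xx => -[-> ->]; rewrite mxE eqxx.
  have lor l : (lo 0 l)%:~R <= (x 0 l)%:~R :> R /\ (x 0 l)%:~R <= (hi 0 l)%:~R :> R.
    by rewrite !ler_int !mxE; lia.
  have lor1 l : (lo 0 l)%:~R <= (x1 0 l)%:~R :> R /\ (x1 0 l)%:~R <= (hi 0 l)%:~R :> R.
    by rewrite !ler_int !mxE; lia.
  have loi : lo 0 i = g 0 i by rewrite mxE; lia.
  apply: (@face_slab R n T i P0 lo hi x2 r bT _ _ _ fT Tx) => [l||u ub||].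
  - by rewrite !mxE; lia.
  - by rewrite !mxE; lia.
  - have [e1 e2] := same T x x1 TS xx u (fun l => ltac:(have := ub l; rewrite !mxE; lia)).
    by rewrite /wall -e1 -e2.
  - split; first by rewrite xi loi; case: x1i => ->.
    by move=> l li; have := xl l li; have := lor l; lra.
  split; first by rewrite loi.
  by move=> l li; have := yl l li; have := lor1 l; lra.
have ex2 l : exists z : R, l != i -> ((vw l).1%:~R <= z <= (vw l).1%:~R + 1) /\
    ((vw l).2%:~R <= z <= (vw l).2%:~R + 1).
  have [->|li] := eqVneq l i; first by exists 0.
  have [_ _ [c [c1 c2]]] := vwP l li; exists c%:~R => _.
  by split; [case: c1 => ->|case: c2 => ->]; rewrite ?intrB; lra.
pose z : V := \row_l (if l == i then (g 0 i)%:~R else projT1 (cid (ex2 l))).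
have zi : z 0 i = (g 0 i)%:~R by rewrite mxE ifT.
have zP l : l != i -> ((vw l).1%:~R <= z 0 l <= (vw l).1%:~R + 1) /\
    ((vw l).2%:~R <= z 0 l <= (vw l).2%:~R + 1).
  by move=> li; rewrite mxE ifN //; apply: (projT2 (cid (ex2 l))).
have Pz : P z.
  apply: (sub S P g g1 p1) => //; [by move=> l u; left|by left|].
  by move=> l li; rewrite mxE (negbTE li); have [] := zP l li.
have P'z : P' z.
  apply: (sub S' P' h h1 q1) => //; [by move=> l u; right|by right|].
  by move=> l li; rewrite mxE (negbTE li); have [] := zP l li.
apply: n1; apply: (@le_trans _ _ (`|z - z|)%:E).
  by apply: ereal_inf_lbound; exists z => //; exists z.
by rewrite subrr normr0 lee_fin ler01.
Qed.

End Faces.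

(** * One displacement step *)

Section Invariants.
Variable n : nat.
Notation Z := 'rV[int]_n.
Implicit Types (w wR wO : 'I_n -> Z -> Prop) (l t : 'I_n) (u v z g : Z) (r s e f : int).

Definition follows f w wR := forall l u, w l u ->
  exists l' v, wR l' v /\ nearby f (v - u).

Definition spaced s r w := forall l u v, w l u -> w l v -> nearby r (u - v) ->
  u 0 l <> v 0 l -> s < `|u 0 l - v 0 l|.

Definition apart s r w w' := forall l u v, w l u -> w' l v -> nearby r (v - u) ->
  s < `|u 0 l - v 0 l|.

(* [T] is the set of the directions that have not been treated yet; only there
   old walls, lying in the hyperplanes of wR, may be left. *)
Definition settled s bb e r (T : pred 'I_n) w wR wO := forall l u, w l u ->
  (T l /\ exists v, [/\ wR l v, nearby e (v - u) & v 0 l = u 0 l]) \/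
  (forall v, wO l v -> nearby r (v - u) -> s < `|u 0 l - v 0 l|) /\
  (T l -> forall v, wR l v -> nearby r (v - u) -> bb < `|u 0 l - v 0 l|).

End Invariants.

Section Step.
Variables (n : nat) (B bb s : int) (mk : 'rV[int]_n -> Prop) (a beta : 'rV[int]_n -> int).
Notation Z := 'rV[int]_n.
Variables (t : 'I_n) (wR wO : 'I_n -> Z -> Prop) (C : Z -> Z).
Implicit Types (l : 'I_n) (u v z g : Z).

Hypothesis B0 : 0 < B.
Hypothesis s0 : 0 < s.
Hypothesis bbB : bb < B.
Hypothesis mk_cov : forall g, exists2 z, mk z & nearby B (z - g).
Hypothesis a_rng : forall z, mk z -> B < a z <= 2 * B.
Hypothesis beta_rng : forall z, mk z -> s < beta z < bb.
Hypothesis R_uniq : forall l u v, wR l u -> wR l v -> nearby (40 * B) (u - v) ->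
  u 0 l = v 0 l.
Hypothesis side_sep : forall z z' l (v v' : int), mk z -> mk z' -> z <> z' ->
  nearby (20 * B) (z - z') -> sideplane a z l v -> sideplane a z' l v' -> bb < `|v - v'|.
Hypothesis beta_sep : forall z z', mk z -> mk z' -> z <> z' ->
  nearby (20 * B) (z - z') -> s < `|beta z - beta z'|.
(** For the walls in [wR] the distance [bb] matters, not only [s]: a later step in direction [l]
    puts blocks of height less than [bb] on their hyperplanes, and no other [l]-wall may meet those
    blocks. *)
Hypothesis a_avoid : forall l z u (v : int), mk z -> sideplane a z l v ->
  [\/ wall C l u, wR l u | wO l u] -> nearby (15 * B) (u - z) -> bb < `|v - u 0 l|.
Hypothesis beta_avoid : forall z c u, mk z -> sliced B t wR z c ->
  wall C t u \/ wO t u -> nearby (15 * B) (u - z) -> s < `|c + beta z - u 0 t|.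

Variable T : pred 'I_n.
Hypothesis Tt : T t.
Variables e r f : int.
Hypothesis r_rng : 8 * B <= r <= 9 * B.
Hypothesis e_rng : 0 <= e <= B.
Hypothesis f_rng : 7 * B <= f.
Hypothesis C_follows : follows f (wall C) wR.
Hypothesis C_spaced : spaced s r (wall C).
Hypothesis C_settled : settled s bb e r T (wall C) wR wO.

Let beta_rng' z : mk z -> 0 < beta z < bb.
Proof. by move=> /beta_rng; have := s0; lia. Qed.

Let source := src B mk a beta t wR.
Let C' := C \o source (fun _ => True).

Let bb0 : s < bb.
Proof. by have [z mz _] := mk_cov 0; have := beta_rng mz; lia. Qed.

Let wall' (S : Z -> Prop) l u := @displaced_wall n B bb mk a beta t wR B0 bbB mk_cov a_rng
  beta_rng' R_uniq _ C S l u.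

Let cutU := @sliced_uniq n B bb t wR B0 bbB R_uniq.

Let sub_bb (x y c d : Z) (k : int) : nearby bb (x - c) -> nearby bb (y - d) ->
  nearby (k - 2 * bb) (c - d) -> nearby k (x - y).
Proof. by move=> h1 h2 h3 l; have := h1 l; have := h2 l; have := h3 l; rewrite !subE; lia. Qed.

Lemma displaced_follows : follows (f + bb) (wall C') wR.
Proof.
move=> l u /wall' [[u' [w _ nu _]]|[z [c [_ _ [v [wv nv _]] nz _]]]|[z [c [_ _ [v [wv nv _]] nz _]]]].
- have [l' [v [wv nv]]] := C_follows w; exists l', v; split=> // k.
  by have := nu k; have := nv k; rewrite !subE; lia.
- by exists t, v; split=> // k; have := nv k; have := nz k; rewrite !subE; have := bb0; have := s0; lia.
by exists t, v; split=> // k; have := nv k; have := nz k; rewrite !subE; have := bb0; have := s0; lia.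
Qed.

(** Two old walls are compared at their previous places, each at most [bb] away, whence the loss of
    [2 * bb] in the radius. An old and a new wall are kept apart by the avoidance hypotheses, two
    new ones by the separation of sides or of heights. *)
Lemma displaced_spaced : spaced s (r - 2 * bb) (wall C').
Proof.
have main l u v : wall C' l u -> wall C' l v -> nearby (r - 2 * bb) (u - v) ->
    (exists u', [/\ wall C l u', u' 0 l = u 0 l, nearby bb (u' - u) & l = t -> u' = u]) ->
    u 0 l <> v 0 l -> s < `|u 0 l - v 0 l|.
  move=> wu /wall' wv nuv [u' [w' <- nu ut]] ne.
  case: wv ne => [[v' [wv' <- nv _]]|[z [c [_ mz cz nz [lt ev]]]]|[z [c [_ mz cz nz [lt sp]]]]] ne.
  - by apply: C_spaced => //; exact: sub_bb nu nv nuv.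
  - subst l; have uu := ut erefl; subst u'; rewrite ev distrC; apply: beta_avoid => //; first by left.
    by move=> k; have := nz k; have := nuv k; rewrite !subE; have := bb0; have := s0; lia.
  apply: le_lt_trans (ltW bb0) _; rewrite distrC; apply: (a_avoid mz sp); first exact: Or31.
  move=> k; have := nz k; have := nuv k; have := nu k; rewrite !subE; have := bb0; have := s0; lia.
move=> l u v wu wv nuv ne.
have [old|[z [c [_ mz cz nz [lt e1]]]]|[z [c [_ mz cz nz [lt sp]]]]] := wall' wu.
- exact: main wu wv nuv old ne.
- have [old|[z' [c' [_ mz' cz' nz' [_ e2]]]]|[_ [_ [_ _ _ _ [/eqP]]]] //] := wall' wv.
    by rewrite distrC; apply: (main _ _ _ wv wu) => //; [exact: nearby_sym|move=> e1'; apply: ne].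
  have nzz : nearby (20 * B) (z - z').
    by move=> k; have := nz k; have := nuv k; have := nz' k; rewrite !subE; have := bb0; have := s0; lia.
  have cc : c = c' by apply: (cutU cz cz') => k; have := nzz k; lia.
  subst l c'; rewrite e1 e2 in ne *; have -> : c + beta z - (c + beta z') = beta z - beta z' by lia.
  by apply: beta_sep => // zz; apply: ne; rewrite zz.
have [old|[_ [_ [_ _ _ _ [lt' _]]]]|[z' [c' [_ mz' cz' nz' [_ sp']]]]] := wall' wv.
- by rewrite distrC; apply: (main _ _ _ wv wu) => //; [exact: nearby_sym|move=> e1'; apply: ne].
- by rewrite lt' eqxx in lt.
have [zz|ne'] := pselect (z = z').
  have az := a_rng mz; subst z'; have := bb0; move: sp sp' ne; rewrite /sideplane.
  by move=> [->|->] [->|->]; lia.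
apply: lt_trans bb0 _; apply: side_sep sp sp' => //.
by move=> k; have := nz k; have := nuv k; have := nz' k; rewrite !subE; have := bb0; have := s0; lia.
Qed.

(** Direction [t] is finished after this step: by [displaced_old] no [t]-wall is left in a
    hyperplane of [wR] near it. In the other directions a wall keeps its hyperplane, and new sides
    avoid [wO] and [wR] from the start. *)
Lemma displaced_settled :
  settled s bb (e + bb) (r - 2 * bb) (fun l => T l && (l != t)) (wall C') wR wO.
Proof.
move=> l u wu.
have [[u' [w eu nu ut]]|[z [c [_ mz cz nz [lt e1]]]]|[z [c [_ mz cz nz [lt sp]]]]] := wall' wu.
- have wid v : nearby (r - 2 * bb) (v - u) -> nearby r (v - u').
    by move=> nv k; have := nv k; have := nu k; rewrite !subE; have := bb0; have := s0; lia.
  have [[Tl [v [wv nv ev]]]|[far farR]] := C_settled w.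
    have lt : l != t.
      apply/eqP => lt; subst l; have uu := ut erefl; subst u'.
      apply: (@displaced_old n B bb mk a beta t wR B0 bbB mk_cov a_rng beta_rng' R_uniq _ C u v wu wv _ ev).
      by move=> k; have := nv k; lia.
    left; rewrite Tl lt; split=> //; exists v; split=> //; last by rewrite ev.
    by move=> k; have := nv k; have := nu k; rewrite !subE; lia.
  right; rewrite -eu; split=> [v wv nv|/andP [Tl lt] v wv nv]; first by apply: far => //; exact: wid.
  by apply: farR => //; exact: wid.
- subst l; right; rewrite eqxx andbF; split=> // v wv nv; rewrite e1; apply: beta_avoid => //; first by right.
  by move=> k; have := nz k; have := nv k; rewrite !subE; have := bb0; have := s0; lia.
have nv' v : nearby (r - 2 * bb) (v - u) -> nearby (15 * B) (v - z).
  by move=> nv k; have := nz k; have := nv k; rewrite !subE; have := bb0; have := s0; lia.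
right; split=> [v wv /nv' nv|_ v wv /nv' nv].
  by apply: lt_trans bb0 _; apply: (a_avoid mz sp) => //; apply: Or33.
by apply: (a_avoid mz sp) => //; apply: Or32.
Qed.


Section Balls.
Variables (R : realType) (p : Z) (b : int).
Hypothesis Cp_bound : forall g, C g = p -> nearby b g.

Let X (S : Z -> Prop) : set Z := [set g | C (source S g) = p].

Let X_bound S g : X S g -> nearby (b + bb) g.
Proof.
move=> /Cp_bound h l.
have := @src_nearby n B bb mk a beta t wR B0 bbB mk_cov a_rng beta_rng' R_uniq S g l; have := h l.
by rewrite /source subE; lia.
Qed.

Let srcP' (S : Z -> Prop) g :
  (exists z c, [/\ S z, inblock B mk a beta t wR z c g & source S g = upd g t (c - 1)]) \/
  (forall z c, S z -> ~ inblock B mk a beta t wR z c g) /\ source S g = g.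
Proof. exact: (@srcP n B bb mk a beta t wR B0 bbB a_rng beta_rng' R_uniq). Qed.

Let src_in' (S : Z -> Prop) z c g : S z -> inblock B mk a beta t wR z c g ->
  source S g = upd g t (c - 1).
Proof. exact: (@src_in n B bb mk a beta t wR B0 bbB a_rng beta_rng' R_uniq). Qed.

Let src_out' (S : Z -> Prop) g : (forall z c, S z -> ~ inblock B mk a beta t wR z c g) ->
  source S g = g.
Proof. exact: src_out. Qed.

Let inblock_near := @inblock_nearby n B bb mk a beta t wR B0 bbB a_rng beta_rng'.

Let X_eq (S S' : Z -> Prop) :
  (forall z g c, inblock B mk a beta t wR z c g -> nearby (b + bb + bb) g -> S z <-> S' z) ->
  X S = X S'.
Proof.
have sub (S1 S2 : Z -> Prop) : (forall z g c, inblock B mk a beta t wR z c g ->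
    nearby (b + bb + bb) g -> S1 z <-> S2 z) -> X S1 `<=` X S2.
  move=> e12 g Xg; rewrite /X /=; suff -> : source S2 g = source S1 g by [].
  have bg : nearby (b + bb + bb) g by apply: nearby_le (X_bound Xg); have := bb0; have := s0; lia.
  have [[z [c [Sz Ez ->]]]|[no ->]] := srcP' S1 g.
    by apply: (src_in' _ Ez); apply/(e12 _ _ _ Ez bg).
  by apply: src_out' => z c Sz Ez; apply: (no z c) => //; apply/(e12 _ _ _ Ez bg).
move=> e12; apply/seteqP; split; apply: sub => // z g c Ez bg.
exact: iff_sym (e12 z g c Ez bg).
Qed.

(* Blocks are added in the order of decreasing heights, so that the upper
   sides of the earlier blocks stay out of the way of the later ones. *)
Let X_balls (L : seq Z) : sorted (fun z z' => beta z <= beta z') L ->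
  ambient_ball (@cubes R n [set g | C g = p]) -> ambient_ball (@cubes R n (X (fun z => z \in L))).
Proof.
move=> sL ball; elim: L sL => [|z L IH] /=.
  move=> _; suff -> : X (fun z => z \in [::]) = [set g | C g = p] by [].
  by apply/seteqP; split=> g; rewrite /X /= src_out'.
move=> pL; have {}IH := IH (path_sorted pL).
have minz z' : z' \in L -> beta z <= beta z'.
  by move=> zL; have := order_path_min _ pL; move=> /(_ (fun x y w => @le_trans _ _ _ _ _)) /allP; apply.
have [zL|zL] := boolP (z \in L).
  suff -> : X (fun z0 => z0 \in z :: L) = X (fun z0 => z0 \in L) by [].
  by apply: X_eq => z' g c _ _; rewrite inE; split=> [/orP [/eqP ->|]|->] //; rewrite orbT.
have [[mz [c cz]]|no] := pselect (mk z /\ exists c, sliced B t wR z c); last first.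
  suff -> : X (fun z0 => z0 \in z :: L) = X (fun z0 => z0 \in L) by [].
  apply: X_eq => z' g c [mz cz _ _] _; rewrite inE; split=> [/orP [/eqP zz|]|->] //; last by rewrite orbT.
  by case: no; rewrite -zz; split=> //; exists c.
have blockE g : block z (a z) c (beta z) t g <-> inblock B mk a beta t wR z c g.
  by split=> [[ov h]|[_ _ ov h]]; split.
have XE : X (fun z0 => z0 \in z :: L) = extruded z (a z) c (beta z) t (X (fun z0 => z0 \in L)).
  (* Nearby blocks have the same bottom [c], so the layer from which a block reads is never altered
     by other blocks. The colouring is thus independent of the order of the blocks; the order
     matters only for extrudability. *)
  have below g : inblock B mk a beta t wR z c g -> source (fun z0 => z0 \in L) (upd g t (c - 1)) = upd g t (c - 1).
    move=> Ez; apply: src_out' => z' c' _ Ez'; have n1 := inblock_near Ez; have n2 := inblock_near Ez'.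
    have [_ cz' _ h] := Ez'; have [_ _ _ h'] := Ez.
    have cc : c = c'.
      apply: (cutU cz cz') => k; have := n1 k; have := n2 k; rewrite !subE updE.
      by case: eqP => [->|_]; have := beta_rng mz; lia.
    by move: h; rewrite updE eqxx; lia.
  apply/seteqP; split=> g; rewrite /X /=.
    move=> Xg; split=> [/blockE Eg|nb] /=.
      rewrite below // -(src_in' (S := fun z0 => z0 \in z :: L) _ Eg) //=.
      by rewrite inE eqxx.
    move: Xg; have [[z' [c' [Sz Ez ->]]]|[no ->]] := srcP' (fun z0 => z0 \in z :: L) g.
      move: Sz; rewrite inE => /orP [/eqP zz|zL'].
        by subst z'; case: nb; apply/blockE; have [_ cz' _ _] := Ez; rewrite (cutU cz cz') // => k; rewrite subrr mxE; lia.
      by rewrite (src_in' zL' Ez).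
    by rewrite src_out' // => z' c' zL'; apply: no; rewrite inE zL' orbT.
  move=> [hin hout]; have [Eg|nE] := pselect (inblock B mk a beta t wR z c g).
    rewrite (src_in' _ Eg) ?inE ?eqxx //.
    by rewrite -{1}(below _ Eg); apply: hin; apply/blockE.
  have := hout (fun b => nE (iffLR (blockE g) b)); rewrite /X /=.
  have [[z' [c' [Sz Ez ->]]]|[no ->]] := srcP' (fun z0 => z0 \in L) g.
    by rewrite (src_in' _ Ez) // inE Sz orbT.
  rewrite src_out' // => z' c'; rewrite inE => /orP [/eqP zz|zL'] Ez; last exact: no Ez.
  subst z'; apply: nE; have [_ cz' _ _] := Ez; rewrite (cutU cz cz') // => k; rewrite subrr mxE; lia.
have az := a_rng mz; have bz := beta_rng mz; have [v [wv nv vc]] := cz.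
have near g : window z (a z) c (beta z) t g -> nearby (5 * B) (g - z).
  move=> [wg ht] k; rewrite subE; have [->|kt] := eqVneq k t; last by have := wg k kt; lia.
  by have := nv t; rewrite subE vc; lia.
have wallX l g : X (fun z0 => z0 \in L) g <> X (fun z0 => z0 \in L) (dn l g) ->
    wall (C \o source (fun z0 => z0 \in L)) l g.
  by move=> ne e1; apply: ne; rewrite /X /= -[C (source _ g)]/((C \o source (fun z0 => z0 \in L)) g) e1.
have EX : extrudable z (a z) c (beta z) t (X (fun z0 => z0 \in L)).
  split=> [g wg cg|g l lt wg sp]; apply: contrapT => /wallX /wall'.
    have ng := near g wg; have [_ ht] := wg.
    case=> [[u' [w _ _ ut]]|[z' [c' [zL' mz' cz' nz' [_ e1]]]]|[_ [_ [_ _ _ _ [/eqP]]]] //].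
      have uu := ut erefl; subst u'; have [[_ [v' [wv' nv' ev']]]|[_ far]] := C_settled w.
        have : v' 0 t = v 0 t.
          apply: R_uniq => // k; have := nv' k; have := ng k; have := nv k; rewrite !subE; lia.
        by rewrite ev' vc; lia.
      have : bb < `|g 0 t - v 0 t|.
        by apply: far => // k; have := ng k; have := nv k; rewrite !subE; lia.
      by rewrite vc; lia.
    have nzz : nearby (20 * B) (z - z').
      by move=> k; have := nz' k; have := ng k; rewrite !subE; lia.
    have cc : c' = c by apply: (cutU cz' cz) => k; have := nzz k; rewrite !subE; lia.
    have ne : z <> z' by move=> zz; rewrite zz zL' in zL.
    by have := beta_sep mz mz' ne nzz; have := minz _ zL'; have := s0; lia.
  have ng := near g wg; have spz : sideplane a z l (g 0 l) by [].
  case=> [[u' [w eu nu _]]|[z' [c' [_ _ _ _ [/eqP lt' _]]]]|[z' [c' [zL' mz' cz' nz' [_ sp']]]]].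
  - have : bb < `|g 0 l - u' 0 l|.
      apply: (a_avoid mz spz); first exact: Or31.
      by move=> k; have := nu k; have := ng k; rewrite !subE; lia.
    by rewrite eu subrr normr0; have := bb0; have := s0; lia.
  - by rewrite lt' in lt.
  have ne : z <> z' by move=> zz; rewrite zz zL' in zL.
  have : bb < `|g 0 l - g 0 l|.
    apply: side_sep spz sp' => // k; have := nz' k; have := ng k; rewrite !subE; lia.
  by rewrite subrr normr0; have := bb0; have := s0; lia.
have a2 : 2 <= a z by have := B0; lia.
have h1 : 1 <= beta z by have := s0; lia.
have bX g : extruded z (a z) c (beta z) t (X (fun z0 => z0 \in L)) g -> nearby (b + bb) g.
  by rewrite -XE; exact: X_bound.
have [fm [gm [am e1]]] := extruded_ambient R a2 h1 EX (@X_bound _) bX.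
by rewrite XE e1; exact: ambient_ball_image am IH.
Qed.

Lemma displaced_balls : ambient_ball (@cubes R n [set g | C g = p]) ->
  ambient_ball (@cubes R n [set g | C' g = p]).
Proof.
(* The region is bounded and moves by at most [bb], so every marker whose block can affect it is in
   this window. *)
move=> ball; pose L := sort (fun z z' => beta z <= beta z') (win n (absz (`|b| + 6 * B))).
have := X_balls (sort_sorted (fun x y => le_total (beta x) (beta y)) _) ball => /(_ (win n (absz (`|b| + 6 * B)))).
suff -> : X (fun z => z \in sort (fun z z' => beta z <= beta z') (win n (absz (`|b| + 6 * B)))) = [set g | C' g = p] by [].
apply: (@X_eq _ (fun=> True)) => z g c Ez bg; rewrite mem_sort; split=> // _.
apply/mem_win => k; have := inblock_near Ez k; have := bg k; rewrite !subE.
by move: (g 0 k) (z 0 k) B0 bbB b => x y h1 h2 b1; clear -h1 h2; lia.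
Qed.

End Balls.
End Step.

(** * Partitions given by equivariant colourings *)

Lemma size_flatten_le (I J : Type) (f : I -> seq J) (k : nat) (s : seq I) :
  (forall i, (size (f i) <= k)%N) -> (size (flatten [seq f i | i <- s]) <= size s * k)%N.
Proof. by move=> fk; elim: s => //= i s IH; rewrite size_cat mulSn leq_add. Qed.

Section Frames.
Variable n : nat.
Notation Z := 'rV[int]_n.
Implicit Types (x y : config n) (g h u v z : Z) (l t : 'I_n) (r : int).
Implicit Types (om : config n -> 'I_n -> Prop) (lam : config n -> Z).

(* A locally constant map [lam] encodes the partition of each orbit into the
   fibres of the colouring [colour lam x], which commutes with translations. *)
Definition colour lam x g : Z := g + lam (act g x).

Definition offset lam := lc lam /\ exists r, forall x, free_part x -> nearby r (lam x).

Definition walls lam x l : Prop := wall (colour lam x) l 0.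

Definition frame om x l u := om (act u x) l.

Lemma colour_act lam h x g : colour lam (act h x) g = colour lam x (g + h) - h.
Proof. by rewrite /colour actD (addrAC g h) addrK. Qed.

Lemma wall_frame lam x : wall (colour lam x) = frame (walls lam) x.
Proof.
apply/funext => l; apply/funext => u; apply/propext.
rewrite /frame /walls /wall !colour_act -dnD add0r.
by split=> ne e; apply: ne; [exact: addIr e|rewrite e].
Qed.

Lemma lc_walls lam : lc lam -> lc (walls lam).
Proof.
move=> lm; apply: (lc_local (r := 1) lm) => x x' _ _ e; apply/funext => l.
rewrite /walls /wall /colour (e 0) ?(e (dn l 0)) //; last exact: nearby0.
by move=> k; rewrite dnE !mxE; case: eqP; lia.
Qed.

(** Hyperplanes are counted, not walls: a wall forbids values through its position only, so this is
    the number that a greedy choice has to beat. *)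
Definition few (N : nat) r om := forall x, free_part x -> forall l,
  exists L : seq int, (size L <= N)%N /\ forall u, nearby r u -> frame om x l u -> u 0 l \in L.

Lemma few_or N N' r om om' : few N r om -> few N' r om' ->
  few (N + N') r (fun x l => om x l \/ om' x l).
Proof.
move=> fw fw' x fx l; have [L [sL HL]] := fw x fx l; have [L' [sL' HL']] := fw' x fx l.
exists (L ++ L'); split=> [|u nu [wu|wu]]; first by rewrite size_cat leq_add.
  by rewrite mem_cat HL.
by rewrite mem_cat orbC HL'.
Qed.

Lemma few_le N N' r r' om : (N <= N')%N -> r' <= r -> few N r om -> few N' r' om.
Proof.
move=> le le' fw x fx l; have [L [sL HL]] := fw x fx l; exists L; split=> [|u nu].
  exact: leq_trans le.
by apply: HL; apply: nearby_le nu.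
Qed.

Lemma few_uniq r om :
  (forall x l u v, free_part x -> frame om x l u -> frame om x l v -> nearby (2 * r) (u - v) ->
     u 0 l = v 0 l) -> few 1 r om.
Proof.
move=> H x fx l; have [[u [nu wu]]|no] := pselect (exists u, nearby r u /\ frame om x l u).
  exists [:: u 0 l]; split=> // v nv wv; rewrite inE; apply/eqP; apply: (H x) => // k.
  by have := nu k; have := nv k; rewrite !subE; lia.
by exists [::]; split=> // u nu wu; case: no; exists u.
Qed.

(** A greedy maximal separated set: a point is marked unless a point of smaller priority within [B]
    is. This gives the covering at once, and of two marked points within [B] the one of larger
    priority would have been refused. *)
Lemma markers (B : int) : 0 < B -> exists mu : config n -> Prop, [/\ lc mu,
  forall x g, free_part x -> mu x -> mu (act g x) -> g <> 0 -> ~ nearby B g &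
  forall x, free_part x -> exists2 g, nearby B g & mu (act g x)].
Proof.
move=> B0; have B0' := ltW B0.
pose Phi (x : config n) (F : Z -> option Prop) := ~ exists g p, F g = Some p /\ p.
have [f lf fE] := priority_rec (T := Prop) (Phi := Phi) B0' (lc_cst tt) (r' := 0) (fun x x' F _ => erefl).
have lower x g : nearby B g -> (priority B (act g x) < priority B x)%N -> f x -> f (act g x) -> False.
  move=> ng lt; rewrite {1}fE => nf fg; apply: nf; exists g, (f (act g x)); split=> //.
  by rewrite asboolT // lt.
exists f; split=> // [x g fx fx0 fg g0 ng|x fx].
  have ne := priority_neq B0' fx ng g0.
  have [lt|gt|/ne //] := ltngtP (priority B (act g x)) (priority B x).
    exact: (lower x g).
  apply: (lower (act g x) (- g)) => //; first exact: nearby_opp.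
    by rewrite actD addNr act0.
  by rewrite actD addNr act0.
have [fx0|nf] := pselect (f x); first by exists 0; [exact: nearby0|rewrite act0].
have [g [p [e pp]]] : exists g p, (if `[< nearby B g >] && (priority B (act g x) < priority B x)%N
                      then Some (f (act g x)) else None) = Some p /\ p.
  by apply: contrapT => no; apply: nf; rewrite fE.
case: ifP e => // /andP [/asboolP ng _] [e].
by exists g => //; rewrite e.
Qed.

Definition pm (v w : int) := w = v \/ w = - v.

(** [kappa] collects what the surroundings forbid and [conf] the conflicts with values at other
    markers. Of two markers only the one of larger priority sees the value of the other; the
    symmetry of [conf] makes this suffice. *)
Lemma spread_choice (mu : config n -> Prop) (kappa : config n -> int -> Prop)
    (conf : Z -> int -> int -> Prop) (D lo b : int) (N1 N2 M : nat) :
  0 <= D -> 0 <= b -> lc mu -> lc kappa ->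
  (forall x, free_part x -> exists L : seq Z, (size L <= M)%N /\
     forall g, nearby D g -> mu (act g x) -> g \in L) ->
  (forall x, free_part x -> exists L : seq int, (size L <= N1)%N /\
     forall v : int, kappa x v -> exists2 c, c \in L & `|v - c| <= b) ->
  (forall g (v' : int), exists L : seq int, (size L <= N2)%N /\
     forall v : int, conf g v v' -> exists2 c, c \in L & `|v - c| <= b) ->
  (forall g (v v' : int), conf g v v' -> conf (- g) v' v) ->
  exists2 f, lc f & forall x, free_part x ->
    [/\ lo <= f x <= lo + (N1 + M * N2)%N%:Z * (2 * b + 1), ~ kappa x (f x) &
      forall g, g <> 0 -> nearby D g -> mu x -> mu (act g x) -> ~ conf g (f x) (f (act g x))].
Proof.
move=> D0 b0 lmu lkap packed few1 few2 sym.
pose Bad (x : config n) (F : Z -> option int) (v : int) := kappa x v \/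
  exists g (v' : int), [/\ nearby D g, mu (act g x), F g = Some v' & conf g v v'].
have loc x x' (F : Z -> option int) (v : int) : (forall g, nearby D g ->
    (mu (act g x), kappa (act g x)) = (mu (act g x'), kappa (act g x'))) ->
    Bad x F v -> Bad x' F v.
  move=> e [kx|[g [v' [ng mg Fg cg]]]].
    by left; have [_] := e 0 (nearby0 D0); rewrite !act0 => <-.
  by right; exists g, v'; split=> //; have [<-] := e g ng.
have count x (F : Z -> option int) : free_part x -> exists L : seq int,
    (size L <= N1 + M * N2)%N /\ forall v : int, Bad x F v -> exists2 c, c \in L & `|v - c| <= b.
  move=> fx; have [L1 [s1 H1]] := few1 x fx; have [L [sL HL]] := packed x fx.
  pose L2 g := projT1 (cid (few2 g (odflt 0 (F g)))).
  have L2P g : (size (L2 g) <= N2)%N /\ forall v : int, conf g v (odflt 0 (F g)) ->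
      exists2 c, c \in L2 g & `|v - c| <= b by exact: projT2 (cid (few2 g (odflt 0 (F g)))).
  exists (L1 ++ flatten [seq L2 g | g <- L]); split.
    rewrite size_cat leq_add //; apply: (@leq_trans (size L * N2)); last exact: leq_mul.
    by apply: size_flatten_le => g; have [] := L2P g.
  move=> v [/H1 [c cL1 cv]|[g [v' [ng mg Fg cg]]]].
    by exists c => //; rewrite mem_cat cL1.
  have [_ /(_ v)] := L2P g; rewrite Fg => /(_ cg) [c cL cv]; exists c => //.
  rewrite mem_cat; apply/orP; right; apply/flatten_mapP; exists g => //; exact: HL.
have [f lf fP] := greedy D0 lo (lc_pair lmu lkap) b0 loc count.
exists f => // x fx; have [rng nb] := fP x fx; split=> //.
  by move=> kx; apply: nb; left.
move=> g g0 ng mx mg cg; have ne := priority_neq D0 fx ng g0.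
have [lt|gt|/ne //] := ltngtP (priority D (act g x)) (priority D x).
  by apply: nb; right; exists g, (f (act g x)); rewrite asboolT // lt.
have [_] := fP _ (free_act (g := g) fx); apply; right; exists (- g), (f x).
rewrite actD addNr act0 asboolT ?gt //; last exact: nearby_opp.
by split=> //; [exact: nearby_opp|exact: sym].
Qed.

(** For each direction, each of the [N] hyperplanes forbids two half-widths, one for either side of
    the cube. Each of the [M] markers nearby forbids four, since either side of one cube may come
    close to either side of the other. *)
Lemma choose_sides (mu : config n -> Prop) om (B b : int) (N M : nat) :
  0 <= B -> 0 <= b -> lc mu -> lc om ->
  (forall x, free_part x -> exists L : seq Z, (size L <= M)%N /\
     forall g, nearby (20 * B) g -> mu (act g x) -> g \in L) ->
  few N (15 * B) om ->
  1 + (n * (2 * N) + M * (n * 4))%N%:Z * (2 * b + 1) <= B ->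
  exists2 a : config n -> int, lc a & forall x, free_part x ->
    [/\ forall z, B < a (act z x) <= 2 * B,
      forall z l u (v : int), sideplane (fun z => a (act z x)) z l v -> frame om x l u ->
        nearby (15 * B) (u - z) -> b < `|v - u 0 l| &
      forall z z' l (v v' : int), mu (act z x) -> mu (act z' x) -> z <> z' ->
        nearby (20 * B) (z - z') -> sideplane (fun z => a (act z x)) z l v ->
        sideplane (fun z => a (act z x)) z' l v' -> b < `|v - v'|].
Proof.
move=> B0 b0 lmu lom packed fw bound.
pose kappa x (v : int) := exists l u w,
  [/\ pm v w, om (act u x) l, nearby (15 * B) u & `|w - u 0 l| <= b].
pose conf g (v v' : int) := exists l w w', [/\ pm v w, pm v' w' & `|w - (g 0 l + w')| <= b].
have lkap : lc kappa.
  apply: (lc_local (r := 15 * B) lom) => x x' _ _ e; apply/funext => v; apply/propext.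
  by split=> -[l [u [w [vw ou nu wu]]]]; exists l, u, w; split=> //; [rewrite -e|rewrite e].
have few1 x : free_part x -> exists L : seq int, (size L <= n * (2 * N))%N /\
    forall v : int, kappa x v -> exists2 c, c \in L & `|v - c| <= b.
  move=> fx; pose L l := projT1 (cid (fw x fx l)).
  have LP l : (size (L l) <= N)%N /\ forall u, nearby (15 * B) u -> frame om x l u -> u 0 l \in L l.
    exact: projT2 (cid (fw x fx l)).
  exists (flatten [seq L l ++ [seq - c | c <- L l] | l <- enum 'I_n]); split.
    apply: (@leq_trans (size (enum 'I_n) * (2 * N))); last by rewrite size_enum_ord.
    apply: size_flatten_le => l.
    by rewrite size_cat size_map mul2n -addnn; have [s1 _] := LP l; apply: leq_add.
  move=> v [l [u [w [vw ou nu wu]]]].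
  have uL : u 0 l \in L l by have [_] := LP l; apply.
  case: vw => ew; subst w.
    exists (u 0 l) => //; apply/flatten_mapP; exists l; first by rewrite mem_enum.
    by rewrite mem_cat uL.
  exists (- u 0 l); last by move: wu; lia.
  apply/flatten_mapP; exists l; first by rewrite mem_enum.
  by rewrite mem_cat; apply/orP; right; apply/mapP; exists (u 0 l).
have few2 g (v' : int) : exists L : seq int, (size L <= n * 4)%N /\
    forall v : int, conf g v v' -> exists2 c, c \in L & `|v - c| <= b.
  exists (flatten [seq [:: g 0 l + v'; g 0 l - v'; - (g 0 l + v'); - (g 0 l - v')] | l <- enum 'I_n]); split.
    apply: (@leq_trans (size (enum 'I_n) * 4)); last by rewrite size_enum_ord.
    exact: size_flatten_le.
  move=> v [l [w [w' [vw vw' ww]]]].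
  have fl c : c \in [:: g 0 l + v'; g 0 l - v'; - (g 0 l + v'); - (g 0 l - v')] -> `|v - c| <= b ->
      exists2 c, c \in flatten [seq [:: g 0 l + v'; g 0 l - v'; - (g 0 l + v'); - (g 0 l - v')] | l <- enum 'I_n] & `|v - c| <= b.
    by move=> cl cv; exists c => //; apply/flatten_mapP; exists l => //; rewrite mem_enum.
  case: vw vw' ww => -> [] -> ww.
  - by apply: (fl (g 0 l + v')) => //; rewrite !inE eqxx.
  - by apply: (fl (g 0 l - v')) => //; rewrite !inE eqxx ?orbT.
  - by apply: (fl (- (g 0 l + v'))); [rewrite !inE eqxx ?orbT|lia].
  by apply: (fl (- (g 0 l - v'))); [rewrite !inE eqxx ?orbT|lia].
have sym g (v v' : int) : conf g v v' -> conf (- g) v' v.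
  by move=> [l [w [w' [vw vw' ww]]]]; exists l, w', w; split=> //; rewrite oppE; lia.
have D0 : 0 <= 20 * B by lia.
have [a la aP] := spread_choice (B + 1) D0 b0 lmu lkap packed few1 few2 sym.
exists a => // x fx; split=> [z|z l u v sp ou nu|z z' l v v' mz mz' ne nz sp sp'].
- by have [] := aP _ (free_act (g := z) fx); move: (_ * _ : int) bound => q; lia.
- have [_ nk _] := aP _ (free_act (g := z) fx); rewrite ltNge; apply/negP => le; apply: nk.
  exists l, (u - z), (v - z 0 l); rewrite actD subrK; split=> //; last by rewrite subE; lia.
  by case: sp => ->; [right|left]; lia.
have [_ _ nc] := aP _ (free_act (g := z) fx); rewrite ltNge; apply/negP => le.
have e : act z' x = act (z' - z) (act z x) by rewrite actD subrK.
apply: (nc (z' - z)) => //.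
- by move=> /subr0_eq zz; apply: ne.
- exact: nearby_sym.
- by rewrite -e.
exists l, (v - z 0 l), (v' - z' 0 l); rewrite -e; split.
- by case: sp => ->; [right|left]; lia.
- by case: sp' => ->; [right|left]; lia.
by rewrite subE; move: le; lia.
Qed.

(** Near a marker the height [c] of the slice is unique, so a hyperplane forbids a single interval
    of heights. Neighbouring blocks share [c], and their tops are separated as soon as their heights
    are. *)
Lemma choose_heights (mu : config n -> Prop) om omR t (B s bb : int) (N M : nat) :
  0 <= B -> 0 <= s -> lc mu -> lc om -> lc omR ->
  (forall x, free_part x -> exists L : seq Z, (size L <= M)%N /\
     forall g, nearby (20 * B) g -> mu (act g x) -> g \in L) ->
  few N (15 * B) om ->
  (forall x l u v, free_part x -> frame omR x l u -> frame omR x l v -> nearby (40 * B) (u - v) ->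
     u 0 l = v 0 l) ->
  s + 2 + (N + M)%N%:Z * (2 * s + 1) <= bb ->
  exists2 beta : config n -> int, lc beta & forall x, free_part x ->
    [/\ forall z, s < beta (act z x) < bb,
      forall z c u, sliced B t (frame omR x) z c -> frame om x t u ->
        nearby (15 * B) (u - z) -> s < `|c + beta (act z x) - u 0 t| &
      forall z z', mu (act z x) -> mu (act z' x) -> z <> z' -> nearby (20 * B) (z - z') ->
        s < `|beta (act z x) - beta (act z' x)|].
Proof.
move=> B0 s0 lmu lom lR packed fw uniq bound.
pose sl x (c : int) := exists v, [/\ omR (act v x) t, nearby (3 * B) v & v 0 t = c].
pose kappa x (v : int) := exists c u,
  [/\ sl x c, om (act u x) t, nearby (15 * B) u & `|c + v - u 0 t| <= s].
pose conf (g : Z) (v v' : int) := `|v - v'| <= s.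
have lkap : lc kappa.
  apply: (lc_local (r := 15 * B) (lc_pair lom lR)) => x x' _ _ e.
  have e1 u : nearby (15 * B) u -> om (act u x) t = om (act u x') t by move=> /e [->].
  have e2 c : sl x c = sl x' c.
    apply/propext; split=> -[v [rv nv vc]]; exists v; split=> //.
      by have /e [_ <-] : nearby (15 * B) v by [move=> k; have := nv k; lia].
    by have /e [_ ->] : nearby (15 * B) v by [move=> k; have := nv k; lia].
  apply/funext => v; apply/propext.
  split=> -[c [u [sc ou nu cu]]]; exists c, u; split=> //.
  - by rewrite -e2.
  - by rewrite -e1.
  - by rewrite e2.
  by rewrite e1.
have few1 x : free_part x -> exists L : seq int, (size L <= N)%N /\
    forall v : int, kappa x v -> exists2 c, c \in L & `|v - c| <= s.
  move=> fx; have [L [sL HL]] := fw x fx t.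
  have [[c0 [v0 [r0 n0 e0]]]|no] := pselect (exists c, sl x c); last first.
    by exists [::]; split=> // v [c [u [sc _ _ _]]]; case: no; exists c.
  exists [seq c - c0 | c <- L]; split=> [|v [c [u [[v1 [r1 n1 e1]] ou nu cu]]]]; first by rewrite size_map.
  have cc : c = c0.
    rewrite -e1 -e0; apply: (uniq x) => // k.
    by have := n1 k; have := n0 k; rewrite subE; lia.
  exists (u 0 t - c0); first by apply/mapP; exists (u 0 t) => //; exact: HL.
  by move: cu; rewrite cc; lia.
have few2 g (v' : int) : exists L : seq int, (size L <= 1)%N /\
    forall v : int, conf g v v' -> exists2 c, c \in L & `|v - c| <= s.
  by exists [:: v']; split=> // v cv; exists v' => //; rewrite inE.
have sym g (v v' : int) : conf g v v' -> conf (- g) v' v by rewrite /conf; lia.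
have D0 : 0 <= 20 * B by lia.
have [a la aP] := spread_choice (s + 1) D0 s0 lmu lkap packed few1 few2 sym.
exists a => // x fx; split=> [z|z c u [v [rv nv vc]] ou nu|z z' mz mz' ne nz].
- have [] := aP _ (free_act (g := z) fx); rewrite muln1; move: (_ * _ : int) bound => q; lia.
- have [_ nk _] := aP _ (free_act (g := z) fx); rewrite ltNge; apply/negP => le; apply: nk.
  exists (c - z 0 t), (u - z); rewrite actD subrK; split=> //; last by rewrite subE; move: le; lia.
  by exists (v - z); rewrite actD subrK subE vc.
have [_ _ nc] := aP _ (free_act (g := z) fx); rewrite ltNge; apply/negP => le.
have e : act z' x = act (z' - z) (act z x) by rewrite actD subrK.
apply: (nc (z' - z)) => //.
- by move=> /subr0_eq zz; apply: ne.
- exact: nearby_sym.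
- by rewrite -e.
by rewrite /conf -e.
Qed.

End Frames.

(** * Locality and translation equivariance of boxes and displacements *)

Section Shift.
Variables (n : nat) (B : int).
Notation Z := 'rV[int]_n.
Implicit Types (g h u v z : Z) (l t : 'I_n) (mk : Z -> Prop) (a : Z -> int) (id : Z -> nat).
Implicit Types (wR : 'I_n -> Z -> Prop).
Hypothesis B0 : 0 < B.

Let b00 : 0 <= (0 : int) < B. Proof. by rewrite lexx. Qed.

(** Agreement, up to the translation by [h], of everything that [corner] and [src] consult at [g].
    The translation 0 yields local constancy, and the base point [g = 0] with arbitrary [h] yields
    the formula for the colouring on the whole orbit. *)
Definition shifted (U : Type) (f f' : Z -> U) g h := forall u, nearby (8 * B) (u - g) ->
  f u = f' (u + h).

Lemma shifted_sym U (f f' : Z -> U) g h : shifted f f' g h -> shifted f' f (g + h) (- h).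
Proof.
move=> e u nu; rewrite e ?subrK // => l; have := nu l; rewrite !latE; lia.
Qed.

Let pl_shift mk a id wR mk' a' id' wR' g h l (v : int) :
  (forall z, mk z -> B < a z <= 2 * B) -> (forall z, mk' z -> B < a' z <= 2 * B) ->
  shifted (fun u => (mk u, a u, id u, wR^~ u)) (fun u => (mk' u, a' u, id' u, wR'^~ u)) g h ->
  pl B mk a id wR g l v -> pl B mk' a' id' wR' (g + h) l (v + h 0 l).
Proof.
move=> ra ra' e [z [mz qz min] p]; have nz := inQ_nearby B0 b00 ra mz qz.
have e' u : nearby (8 * B) (u - g) -> [/\ mk u = mk' (u + h), a u = a' (u + h),
    id u = id' (u + h) & forall l, wR l u = wR' l (u + h)].
  by move=> /e [-> -> -> ew]; split=> // k; have := congr1 (fun f => f k) ew.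
have nz' : nearby (8 * B) (z - g) by apply: nearby_sym; apply: nearby_le nz; lia.
have [emz eaz eid _] := e' z nz'.
exists (z + h).
  split; first by rewrite -emz.
    by move=> k; have := qz k; rewrite !addE -eaz; lia.
  move=> z' mz' qz'; rewrite -eid.
  have nz1 := inQ_nearby B0 b00 ra' mz' qz'.
  have nz2 : nearby (8 * B) (z' - h - g).
    by move=> k; have := nz1 k; rewrite !latE; lia.
  have [emz' eaz' eid' _] := e' _ nz2; rewrite subrK in emz' eaz' eid'.
  rewrite -eid'; apply: min; first by rewrite emz'.
  by move=> k; have := qz' k; rewrite eaz' !latE; lia.
case: p => [[z' [mz' nz1 sp]]|[u [wu nu <-]]].
  have nz2 : nearby (8 * B) (z' - g).
    by move=> k; have := nz1 k; have := nz k; rewrite !subE; lia.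
  have [emz' eaz' _ _] := e' _ nz2; left; exists (z' + h); split; first by rewrite -emz'.
    by move=> k; have := nz1 k; rewrite !latE; lia.
  by rewrite /sideplane addE -eaz'; case: sp => ->; [left|right]; lia.
right; exists (u + h); split; last by rewrite addE.
  have nu2 : nearby (8 * B) (u - g).
    by move=> k; have := nu k; have := nz k; rewrite !subE; lia.
  by have [_ _ _ <-] := e' _ nu2.
by move=> k; have := nu k; rewrite !latE; lia.
Qed.

Lemma corner_shift mk a id wR mk' a' id' wR' g h :
  (forall z, mk z -> B < a z <= 2 * B) -> (forall z, mk' z -> B < a' z <= 2 * B) ->
  shifted (fun u => (mk u, a u, id u, wR^~ u)) (fun u => (mk' u, a' u, id' u, wR'^~ u)) g h ->
  corner B mk' a' id' wR' (g + h) = corner B mk a id wR g + h.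
Proof.
move=> ra ra' e; apply: latP => l; rewrite addE !mxE /lo addE.
suff -> : (fun k : nat => pl B mk' a' id' wR' (g + h) l (g 0 l + h 0 l - k%:Z)) =
    (fun k : nat => pl B mk a id wR g l (g 0 l - k%:Z)) by lia.
apply/funext => k; apply/propext; split=> p.
  have := pl_shift ra' ra (shifted_sym e) p.
  by rewrite addrK oppE; congr pl; lia.
by have := pl_shift ra ra' e p; congr pl; lia.
Qed.

Variables (bb : int) (t : 'I_n).
Hypothesis bbB : bb < B.

Let inblock_shift mk a beta wR mk' a' (beta' : Z -> int) wR' g h z (c : int) :
  (forall z, mk z -> B < a z <= 2 * B) -> (forall z, mk z -> 0 < beta z < bb) ->
  shifted (fun u => (mk u, a u, beta u, wR^~ u)) (fun u => (mk' u, a' u, beta' u, wR'^~ u)) g h ->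
  inblock B mk a beta t wR z c g -> inblock B mk' a' beta' t wR' (z + h) (c + h 0 t) (g + h).
Proof.
move=> ra rb e Eg; have nz := @inblock_nearby n B bb mk a beta t wR B0 bbB ra rb z c g Eg.
have [mz [v [wv nv vc]] base ht] := Eg.
have e' u : nearby (8 * B) (u - g) -> [/\ mk u = mk' (u + h), a u = a' (u + h),
    beta u = beta' (u + h) & forall l, wR l u = wR' l (u + h)].
  by move=> /e [-> -> -> ew]; split=> // k; have := congr1 (fun f => f k) ew.
have [emz eaz eb _] : [/\ mk z = mk' (z + h), a z = a' (z + h),
    beta z = beta' (z + h) & forall l, wR l z = wR' l (z + h)].
  by apply: e' => k; have := nz k; rewrite !subE; lia.
split; first by rewrite -emz.
- exists (v + h); split; last by rewrite addE vc.
    have [|_ _ _ <- //] := e' v; move=> k; have := nv k; have := nz k; rewrite !subE; lia.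
  by move=> k; have := nv k; rewrite !latE; lia.
- by move=> k kt; have := base k kt; rewrite !addE -eaz; lia.
by rewrite addE -eb; lia.
Qed.

Lemma src_shift mk a beta wR mk' a' beta' wR' g h :
  (forall z, mk z -> B < a z <= 2 * B) -> (forall z, mk z -> 0 < beta z < bb) ->
  (forall l u v, wR l u -> wR l v -> nearby (40 * B) (u - v) -> u 0 l = v 0 l) ->
  (forall z, mk' z -> B < a' z <= 2 * B) -> (forall z, mk' z -> 0 < beta' z < bb) ->
  (forall l u v, wR' l u -> wR' l v -> nearby (40 * B) (u - v) -> u 0 l = v 0 l) ->
  shifted (fun u => (mk u, a u, beta u, wR^~ u)) (fun u => (mk' u, a' u, beta' u, wR'^~ u)) g h ->
  src B mk' a' beta' t wR' (fun=> True) (g + h) = src B mk a beta t wR (fun=> True) g + h.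
Proof.
move=> ra rb uR ra' rb' uR' e.
have [[z [c [_ Eg ->]]]|[no ->]] :=
    @srcP n B bb mk a beta t wR B0 bbB ra rb uR (fun=> True) g.
  have Eg' := inblock_shift ra rb e Eg.
  rewrite (@src_in n B bb mk' a' beta' t wR' B0 bbB ra' rb' uR' (fun=> True) _ _ _ _ Eg') //.
  by rewrite -updD; congr upd; lia.
apply: src_out => z c _ Eg; apply: (no (z - h) (c - h 0 t)) => //.
have := inblock_shift ra' rb' (shifted_sym e) Eg.
by rewrite addrK oppE.
Qed.

End Shift.

(** * Boxes and displacement at one scale *)

Section Scale.
Variables (R : realType) (n : nat).
Notation Z := 'rV[int]_n.
Implicit Types (x y : config n) (g h u v z p : Z) (l t : 'I_n).
Implicit Types (om : config n -> 'I_n -> Prop) (lam : config n -> Z).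

Definition balls lam := forall x p, free_part x -> (exists g, colour lam x g = p) ->
  ambient_ball (@cubes R n [set g | colour lam x g = p]).

Lemma colour_bounded lam : offset lam -> forall p, exists b, forall x g, free_part x ->
  colour lam x g = p -> nearby b g.
Proof.
move=> [_ [r lr]] p; exists (r + \sum_l `|p 0 l|) => x g fx e l.
have pl : `|p 0 l| <= \sum_l `|p 0 l|.
  by rewrite (bigD1 l) //= lerDl sumr_ge0.
have := lr _ (free_act (g := g) fx) l; have := congr1 (fun q : Z => q 0 l) e.
by rewrite /= addE; move: (\sum_l _) pl => q; lia.
Qed.

Variables (B bb s : int) (M NO : nat) (mu : config n -> Prop).
(** Bound for the hyperplanes of walls in one direction near a point: one at the start, and in each
    of the [n] displacements three more per marker, for the top and two sides. [NA] adds one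
    hyperplane for the old walls and [NO] for the obstacles. *)
Definition NC := (3 * M * n).+1.
Definition NA := (NC + 1 + NO)%N.
Hypothesis n0 : (0 < n)%N.
Hypothesis s0 : 0 < s.
Hypothesis bb_big : s + 2 + (NA + M)%N%:Z * (2 * s + 1) <= bb.
Hypothesis B_big : 1 + (n * (2 * NA) + M * (n * 4))%N%:Z * (2 * bb + 1) <= B.
(** The [n] displacements cost at most [2 * (n * bb)] in any of the radii, so radii that start at
    [9 * B] and [18 * B] do not fall below [8 * B] and [17 * B]. *)
Hypothesis B_big' : 2 * (n%:Z * bb) + bb < B.
Hypothesis lmu : lc mu.
Hypothesis mu_cov : forall x, free_part x -> exists2 g, nearby B g & mu (act g x).
Hypothesis packed : forall x, free_part x -> exists L : seq Z, (size L <= M)%N /\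
  forall g, nearby (25 * B) g -> mu (act g x) -> g \in L.

Let bb0 : s < bb.
Proof.
have : 0 <= (NA + M)%N%:Z * (2 * s + 1) by apply: mulr_ge0; have := s0; lia.
by move: (_ * _ : int) bb_big => q; lia.
Qed.

Let nbb : bb <= n%:Z * bb.
Proof. by rewrite -[leLHS]mul1r; apply: ler_wpM2r; have := n0; have := bb0; have := s0; lia. Qed.

Let bbB : bb < B.
Proof. by move: (_ * bb) nbb B_big' => q; have := bb0; have := s0; lia. Qed.

Let B0 : 0 < B.
Proof. by have := bbB; have := bb0; have := s0; lia. Qed.

Let packed20 x : free_part x -> exists L : seq Z, (size L <= M)%N /\
  forall g, nearby (20 * B) g -> mu (act g x) -> g \in L.
Proof.
move=> /packed [L [sL HL]]; exists L; split=> // g ng; apply: HL.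
by apply: nearby_le ng; have := B0; lia.
Qed.

Let mk x z := mu (act z x).
Let id x z := priority (20 * B) (act z x).

Let mk_cov x : free_part x -> forall g, exists2 z, mk x z & nearby B (z - g).
Proof.
move=> fx g; have [z nz mz] := mu_cov (free_act (g := g) fx).
by exists (z + g); [rewrite /mk -actD|rewrite addrK].
Qed.

Let id_inj x : free_part x -> forall z z', mk x z -> mk x z' -> z <> z' ->
  nearby (20 * B) (z - z') -> id x z <> id x z'.
Proof.
move=> fx z z' mz mz' ne nz.
have D0 : 0 <= 20 * B by have := B0; lia.
have := priority_neq D0 (free_act (g := z') fx) nz; rewrite actD subrK; apply.
by move=> /subr0_eq.
Qed.

Let shifted_frames (U : Type) (w : config n -> U) x g :
  shifted B (fun u => w (act u (act g x))) (fun u => w (act u x)) 0 g.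
Proof. by move=> u _; rewrite actD. Qed.

Let shifted_local (U : Type) (w : config n -> U) x x' :
  (forall g, nearby (8 * B) g -> w (act g x) = w (act g x')) ->
  shifted B (fun u => w (act u x')) (fun u => w (act u x)) 0 0.
Proof. by move=> e u nu; rewrite addr0 e // -(subr0 u). Qed.

Lemma cells : exists lam, [/\ offset lam, balls lam, few NC (16 * B) (walls lam) &
  forall x l u v, free_part x -> frame (walls lam) x l u -> frame (walls lam) x l v ->
    nearby s (u - v) -> u 0 l = v 0 l].
Proof.
have B0' := ltW B0; have bb0' : 0 <= bb by have := bb0; have := s0; lia.
have fw : few NA (15 * B) (fun (_ : config n) (_ : 'I_n) => False).
  by move=> x fx l; exists [::]; split.
have [a la aP] := choose_sides B0' bb0' lmu (lc_cst _) packed20 fw B_big.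
pose aF x z := a (act z x); pose wR (l : 'I_n) (u : Z) := False.
pose crn x := corner B (mk x) (aF x) (id x) wR.
have ra x : free_part x -> forall z, mk x z -> B < aF x z <= 2 * B.
  by move=> fx z _; have [H _ _] := aP x fx; exact: H.
have b0 : 0 <= bb < B by rewrite bb0' bbB.
have sides x : free_part x -> forall z z' l (v v' : int), mk x z -> mk x z' -> z <> z' ->
    nearby (20 * B) (z - z') -> sideplane (aF x) z l v -> sideplane (aF x) z' l v' -> bb < `|v - v'|.
  by move=> fx z z' l v v'; have [_ _ H] := aP x fx; exact: H.
have R_uniq l u v : wR l u -> wR l v -> nearby (40 * B) (u - v) -> u 0 l = v 0 l by [].
pose lam x := crn x 0.
pose w x := (mu x, a x, priority (20 * B) x, (fun _ : 'I_n => False)).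
have colE x : free_part x -> colour lam x = crn x.
  move=> fx; apply/funext => g; rewrite /colour /lam /crn addrC.
  rewrite -(@corner_shift n B B0 (mk (act g x)) (aF (act g x)) (id (act g x)) wR (mk x) (aF x) (id x) wR 0 g).
  - by rewrite add0r.
  - exact: ra (free_act fx).
  - exact: ra fx.
  exact: (shifted_frames w).
have ol : offset lam.
  split.
    have lw : lc w by apply: lc_pair (lc_pair (lc_pair lmu la) (lc_priority _)) (lc_cst _); lia.
    apply: (lc_local (r := 8 * B) lw) => x x' fx fx' e.
    rewrite /lam /crn -[X in corner _ _ _ _ _ X = _](addr0 0).
    rewrite (@corner_shift n B B0 (mk x') (aF x') (id x') wR (mk x) (aF x) (id x) wR 0 0) ?addr0 //.
    - exact: ra.
    - exact: ra.
    exact: (shifted_local (w := w)).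
  exists (4 * B) => x fx; rewrite -(subr0 (lam x)).
  exact: (box_nearby B0 b0 (mk_cov fx) (ra x fx) (corner_box (id x) wR B0 b0 (mk_cov fx) (ra x fx) 0)).
have wallE x l u : free_part x -> frame (walls lam) x l u ->
    exists z, [/\ mk x z, nearby (7 * B) (z - u) & sideplane (aF x) z l (u 0 l)].
  move=> fx; rewrite -wall_frame colE // => /(corner_wall B0 b0 (mk_cov fx) (ra x fx) (id_inj fx)).
  move=> [z [mz nz [[z' [mz' nz' sp]]|[_ [[]]]]]]; exists z'; split=> // k.
  by have := nz k; have := nz' k; rewrite !subE; lia.
exists lam; split; first exact: ol.
- move=> x p fx [g0 e0]; rewrite colE // in e0 *.
  have -> : [set g | crn x g = p] = [set g | forall l,
      lo B (mk x) (aF x) (id x) wR g0 l <= g 0 l < hi B (mk x) (aF x) (id x) wR g0 l].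
    apply/seteqP; split=> g /=.
      rewrite -e0 => e.
      exact: (iffLR (corner_eq wR B0 b0 (mk_cov fx) (ra x fx) (id_inj fx) g0 g) (esym e)).
    move=> bg; rewrite -e0; apply: esym.
    exact: (iffRL (corner_eq wR B0 b0 (mk_cov fx) (ra x fx) (id_inj fx) g0 g) bg).
  apply: ambient_ball_box => l.
  by have := box_refl (id x) wR B0 b0 (mk_cov fx) (ra x fx) g0 l; lia.
- move=> x fx l; have [L [sL HL]] := packed fx.
  exists (flatten [seq [:: z 0 l - aF x z; z 0 l + aF x z] | z <- L]); split.
    apply: (@leq_trans (size L * 2)); first exact: size_flatten_le.
    by rewrite /NC; move: sL n0; clear; nia.
  move=> u nu /(wallE x l u fx) [z [mz nz sp]]; apply/flatten_mapP; exists z.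
    by apply: HL => // k; have := nu k; have := nz k; rewrite !subE; have := B0; lia.
  by rewrite !inE; case: sp => ->; rewrite eqxx ?orbT.
move=> x l u v fx /(wallE x l u fx) [z [mz nz sp]] /(wallE x l v fx) [z' [mz' nz' sp']] nuv.
have su := nuv l; rewrite subE in su.
have [zz|ne] := pselect (z = z').
  subst z'; have := ra x fx z mz; have := bb0; have := bbB.
  by move: su; case: sp => ->; case: sp' => ->; lia.
have : bb < `|u 0 l - v 0 l|.
  apply: (sides x fx z z' l) => // k; have := nz k; have := nz' k; have := nuv k.
  by rewrite !subE; have := bbB; have := bb0; have := s0; lia.
by have := bb0; lia.
Qed.

Section Displacement.
Variables omR omO : config n -> 'I_n -> Prop.
Hypotheses (lR : lc omR) (lO : lc omO).
Hypothesis R_uniq : forall x l u v, free_part x -> frame omR x l u -> frame omR x l v ->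
  nearby (40 * B) (u - v) -> u 0 l = v 0 l.
Hypothesis O_few : few NO (15 * B) omO.

Let stage (T : pred 'I_n) (e r f W : int) (N : nat) lam :=
  [/\ offset lam, balls lam, few N W (walls lam) & forall x, free_part x ->
    [/\ follows f (wall (colour lam x)) (frame omR x), spaced s r (wall (colour lam x)) &
      settled s bb e r T (wall (colour lam x)) (frame omR x) (frame omO x)]].

Let step (T : pred 'I_n) t (e r f W : int) (N : nat) lam : T t -> 8 * B <= r <= 9 * B -> 0 <= e <= B ->
  7 * B <= f -> 17 * B <= W <= 18 * B -> (N <= NC)%N -> stage T e r f W N lam ->
  exists lam', stage (fun l => T l && (l != t)) (e + bb) (r - 2 * bb) (f + bb) (W - bb) (N + 3 * M)%N lam'.
Proof.
move=> Tt r_rng e_rng f_rng W_rng NN [ol bl fl inv].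
have [lam_lc [rl lam_rl]] := ol.
have B0' := ltW B0; have bb0' : 0 <= bb by have := bb0; have := s0; lia.
pose om x l := (walls lam x l \/ omR x l) \/ omO x l.
have lw := lc_walls lam_lc.
have lom : lc om.
  pose P := 'I_n -> Prop.
  exact: (@lc_comp n P _ _ (fun (p : P * P * P) l => (p.1.1 l \/ p.1.2 l) \/ p.2 l)
    (lc_pair (lc_pair lw lR) lO)).
have fom : few NA (15 * B) om.
  apply: few_or O_few; apply: few_or.
    by apply: (few_le (N := N) (r := W)) => //; have := B0; lia.
  apply: few_uniq => x l u v fx ru rv nuv; apply: (R_uniq fx ru rv).
  by apply: nearby_le nuv; have := B0; lia.
have [a la aP] := choose_sides B0' bb0' lmu lom packed20 fom B_big.
have [beta lb bP] := choose_heights t B0' (ltW s0) lmu lom lR packed20 fom R_uniq bb_big.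
pose aF x z := a (act z x); pose bF x z := beta (act z x); pose RF x := frame omR x.
have ra x : free_part x -> forall z, mk x z -> B < aF x z <= 2 * B.
  by move=> fx z _; have [H _ _] := aP x fx; exact: H.
have rb x : free_part x -> forall z, mk x z -> s < bF x z < bb.
  by move=> fx z _; have [H _ _] := bP x fx; exact: H.
have rb0 x : free_part x -> forall z, mk x z -> 0 < bF x z < bb.
  by move=> fx z mz; have := rb x fx z mz; have := s0; lia.
have uR x : free_part x -> forall l u v, RF x l u -> RF x l v -> nearby (40 * B) (u - v) ->
    u 0 l = v 0 l.
  by move=> fx l u v; exact: R_uniq.
have sides x : free_part x -> forall z z' l (v v' : int), mk x z -> mk x z' -> z <> z' ->
    nearby (20 * B) (z - z') -> sideplane (aF x) z l v -> sideplane (aF x) z' l v' -> bb < `|v - v'|.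
  by move=> fx z z' l v v'; have [_ _ H] := aP x fx; exact: H.
have heights x : free_part x -> forall z z', mk x z -> mk x z' -> z <> z' ->
    nearby (20 * B) (z - z') -> s < `|bF x z - bF x z'|.
  by move=> fx z z'; have [_ _ H] := bP x fx; exact: H.
have av x : free_part x -> forall l z u (v : int), mk x z -> sideplane (aF x) z l v ->
    [\/ wall (colour lam x) l u, RF x l u | frame omO x l u] ->
    nearby (15 * B) (u - z) -> bb < `|v - u 0 l|.
  move=> fx l z u v _ sp wu; have [_ H _] := aP x fx; apply: (H z l u v sp).
  by move: wu; rewrite wall_frame => -[w|w|w]; [left; left|left; right|right].
have bv x : free_part x -> forall z c u, mk x z -> sliced B t (RF x) z c ->
    wall (colour lam x) t u \/ frame omO x t u -> nearby (15 * B) (u - z) ->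
    s < `|c + bF x z - u 0 t|.
  move=> fx z c u _ sz wu; have [_ H _] := bP x fx; apply: (H z c u sz).
  by move: wu; rewrite wall_frame => -[w|w]; [left; left|right].
pose sr x := src B (mk x) (aF x) (bF x) t (RF x) (fun=> True).
pose sg x := sr x 0.
pose w x := (mu x, a x, beta x, omR x).
have srE x g : free_part x -> sr x g = sg (act g x) + g.
  move=> fx; rewrite /sg /sr -[X in src _ _ _ _ _ _ _ X = _](add0r g).
  have fg := free_act (g := g) fx.
  rewrite (@src_shift n B B0 bb t bbB (mk (act g x)) (aF (act g x)) (bF (act g x)) (RF (act g x))
    (mk x) (aF x) (bF x) (RF x) 0 g) //.
  - exact: ra.
  - exact: rb0.
  - exact: uR.
  - exact: ra.
  - exact: rb0.
  - exact: uR.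
  exact: (shifted_frames w).
have sg_near x : free_part x -> nearby bb (sg x).
  move=> fx; rewrite -(subr0 (sg x)).
  exact: (@src_nearby n B bb (mk x) (aF x) (bF x) t (RF x) B0 bbB (mk_cov fx) (ra x fx) (rb0 x fx) (uR x fx)).
have lsg : lc sg.
  have lcw : lc w by exact: lc_pair (lc_pair (lc_pair lmu la) lb) lR.
  apply: (lc_local (r := 8 * B) lcw) => x x' fx fx' e1.
  rewrite /sg /sr -[X in src _ _ _ _ _ _ _ X = _](addr0 0).
  rewrite (@src_shift n B B0 bb t bbB (mk x') (aF x') (bF x') (RF x') (mk x) (aF x) (bF x) (RF x) 0 0) ?addr0 //.
  - exact: ra.
  - exact: rb0.
  - exact: uR.
  - exact: ra.
  - exact: rb0.
  - exact: uR.
  exact: (shifted_local (w := w)).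
pose lam' x := sg x + lam (act (sg x) x).
have colE x : free_part x -> colour lam' x = colour lam x \o sr x.
  move=> fx; apply/funext => g; rewrite /= srE // /colour /lam' actD.
  by rewrite addrCA addrA.
have llam' : lc lam'.
  apply: (lc_local (r := bb) (lc_pair lsg lam_lc)) => x x' fx fx' e1.
  have [es _] : (sg x, lam x) = (sg x', lam x') by have := e1 0 (nearby0 bb0'); rewrite !act0.
  by rewrite /lam' -es; have /e1 [_ ->] := sg_near x fx.
have ol' : offset lam'.
  split=> //; exists (bb + rl) => x fx; apply: nearby_add; first exact: sg_near.
  exact: lam_rl (free_act fx).
exists lam'; split=> //.
- move=> x p fx [g0 e0]; rewrite colE //.
  have [b bP'] := colour_bounded ol p.
  have [_ _ i3] := inv x fx; have [i1 i2 _] := inv x fx.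
  apply: (displaced_balls B0 s0 bbB (mk_cov fx) (ra x fx) (rb x fx) (uR x fx) (sides x fx)
    (heights x fx) (av x fx) Tt r_rng e_rng f_rng i3 (b := b)).
    by move=> g; exact: bP'.
  apply: bl => //; exists (sr x g0); by move: e0; rewrite colE.
- move=> x fx l; have [L [sL HL]] := fl x fx l; have [Lm [sLm HLm]] := packed fx.
  (* The slice of a marker has only one height, so each marker contributes one top. For a marker
     without a slice the default 0 merely adds an entry to the list. *)
  pose cz z := xget 0 [set c | sliced B t (RF x) z c].
  exists (L ++ flatten [seq [:: cz z + bF x z; z 0 l - aF x z; z 0 l + aF x z] | z <- Lm]); split.
    rewrite size_cat leq_add // mulnC; apply: (@leq_trans (size Lm * 3)); first exact: size_flatten_le.
    by rewrite leq_mul2r sLm orbT.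
  have inLm z c u : c \in [:: cz z + bF x z; z 0 l - aF x z; z 0 l + aF x z] -> mk x z ->
      nearby (W - bb) u -> nearby (4 * B) (z - u) ->
      c \in L ++ flatten [seq [:: cz z + bF x z; z 0 l - aF x z; z 0 l + aF x z] | z <- Lm].
    move=> cl mz nu nz; rewrite mem_cat; apply/orP; right; apply/flatten_mapP; exists z => //.
    by apply: HLm => // k; have := nu k; have := nz k; rewrite !subE; have := bb0; have := s0; lia.
  move=> u nu; rewrite -wall_frame colE // => wu.
  have [[u' [wu' <- nu' _]]|[z [c [_ mz sz nz [lt e1]]]]|[z [c [_ mz _ nz [_ sp]]]]] :=
    @displaced_wall n B bb (mk x) (aF x) (bF x) t (RF x) B0 bbB (mk_cov fx) (ra x fx) (rb0 x fx)
      (uR x fx) _ (colour lam x) (fun=> True) l u wu.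
  + rewrite mem_cat; apply/orP; left; apply: HL; last by rewrite -wall_frame.
    by move=> k; have := nu k; have := nu' k; rewrite !subE; lia.
  + subst l; rewrite e1; apply: (inLm z _ u) => //; rewrite inE; apply/orP; left.
    have -> : cz z = c; last by [].
    have cc : sliced B t (RF x) z (cz z) by exact: (xgetPex 0 (ex_intro _ c sz)).
    apply: (@sliced_uniq n B bb t (RF x) B0 bbB (uR x fx) _ _ _ _ cc sz) => k.
    by rewrite subrr mxE; have := B0; lia.
  by apply: (inLm z _ u) => //; rewrite !inE; case: sp => ->; rewrite eqxx ?orbT.
move=> x fx; have [i1 i2 i3] := inv x fx; rewrite colE //; split.
- exact: (displaced_follows B0 s0 bbB (mk_cov fx) (ra x fx) (rb x fx) (uR x fx)
    Tt r_rng e_rng f_rng i1).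
- exact: (displaced_spaced B0 s0 bbB (mk_cov fx) (ra x fx) (rb x fx) (uR x fx) (sides x fx)
    (heights x fx) (av x fx) (bv x fx) Tt r_rng e_rng f_rng i2).
exact: (displaced_settled B0 s0 bbB (mk_cov fx) (ra x fx) (rb x fx) (uR x fx)
    (av x fx) (bv x fx) Tt r_rng e_rng f_rng i3).
Qed.

Let uniq_size (ds : seq 'I_n) : uniq ds -> (size ds <= n)%N.
Proof. by move=> /card_uniqP <-; apply: leq_trans (max_card _) _; rewrite card_ord. Qed.

(** The list [ds] contains the directions already treated, at a price of [bb] each. The radius
    [7 * B] in [follows] comes from a new wall being within [4 * B] of its marker, which is within
    [3 * B] of the wall that slices it. *)
Let stages lam : offset lam -> balls lam -> walls lam = omR -> forall ds : seq 'I_n, uniq ds ->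
  exists lam', stage (fun l => l \notin ds) ((size ds)%:Z * bb) (9 * B - 2 * ((size ds)%:Z * bb))
    (7 * B + (size ds)%:Z * bb) (18 * B - (size ds)%:Z * bb) (1 + 3 * M * size ds)%N lam'.
Proof.
move=> ol bl wl; elim=> [_|t ds IH /= /andP [tds uds]].
  exists lam; rewrite /= !mul0r mulr0 !subr0 muln0 ?addr0 addn0; split=> //.
    rewrite wl; apply: few_uniq => x l u v fx ru rv nuv; apply: (R_uniq fx ru rv).
    by apply: nearby_le nuv; have := B0; lia.
  move=> x fx; rewrite wall_frame wl; split.
  - move=> l u ru; exists l, u; split=> //; rewrite subrr; apply: nearby0; have := B0; lia.
  - move=> l u v ru rv nuv ne; case: ne; apply: (R_uniq fx ru rv).
    by apply: nearby_le nuv; have := B0; lia.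
  move=> l u ru; left; split=> //; exists u; split=> //; rewrite subrr; exact: nearby0.
have [lam1 st] := IH uds.
have le : (size ds).+1%:Z * bb <= n%:Z * bb.
  apply: ler_wpM2r; first by have := bb0; have := s0; lia.
  by rewrite lez_nat; apply: (@uniq_size (t :: ds)); rewrite /= tds.
have le0 : 0 <= (size ds)%:Z * bb by apply: mulr_ge0; have := bb0; have := s0; lia.
have eS : (size ds).+1%:Z * bb = (size ds)%:Z * bb + bb by rewrite (_ : (size ds).+1%:Z = (size ds)%:Z + 1) ?mulrDl ?mul1r //; lia.
rewrite eS in le *.
have [||||||lam2 st2] := @step (fun l => l \notin ds) t _ _ _ _ _ lam1 _ _ _ _ _ _ st => //.
- by move: (_ * bb) (_ * bb) le le0 B_big' => q q'; have := bb0; have := s0; lia.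
- by move: (_ * bb) (_ * bb) le le0 B_big' => q q'; have := bb0; have := s0; lia.
- by move: (_ * bb) le0 => q'; lia.
- by move: (_ * bb) (_ * bb) le le0 B_big' => q q'; have := bb0; have := s0; lia.
- rewrite /NC; have := uniq_size uds.
  by move: (size ds) => k kn; rewrite add1n ltnS leq_mul2l kn orbT.
exists lam2.
have -> : (fun l => l \notin t :: ds) = (fun l => (l \notin ds) && (l != t)).
  by apply/funext => l; rewrite inE negb_or andbC.
have -> : (1 + 3 * M * (size ds).+1 = 1 + 3 * M * size ds + 3 * M)%N by lia.
have -> : 9 * B - 2 * ((size ds)%:Z * bb + bb) = 9 * B - 2 * ((size ds)%:Z * bb) - 2 * bb by lia.
by rewrite addrA opprD addrA.
Qed.

Lemma displace lam : offset lam -> balls lam -> walls lam = omR ->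
  exists lam', [/\ offset lam', balls lam', few NC (16 * B) (walls lam'),
    forall x, free_part x -> follows (8 * B) (frame (walls lam') x) (frame omR x) &
    forall x, free_part x -> forall l u, frame (walls lam') x l u ->
      (forall v, frame (walls lam') x l v -> nearby s (u - v) -> u 0 l = v 0 l) /\
      (forall v, frame omO x l v -> ~ nearby s (v - u))].
Proof.
move=> ol bl wl; have [lam' [ol' bl' fl inv]] := stages ol bl wl (enum_uniq 'I_n).
rewrite size_enum_ord in fl inv.
have nb0 : 0 <= n%:Z * bb by have := nbb; have := bb0; have := s0; lia.
exists lam'; split=> //.
- by apply: few_le fl => //; move: (_ * bb) nb0 B_big' => q; have := bb0; have := s0; lia.
- move=> x fx l u; have [fw _ _] := inv x fx; rewrite -wall_frame => /fw [l' [v [wv nv]]].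
  exists l', v; split=> //; apply: nearby_le nv.
  by move: (_ * bb) nb0 B_big' => q; have := bb0; have := s0; lia.
move=> x fx l u wu; have [_ sp st] := inv x fx; rewrite -wall_frame in wu *; split.
  move=> v wv nuv; apply/eqP; apply/negPn/negP => /eqP ne.
  have := nuv l; rewrite subE; have : s < `|u 0 l - v 0 l|; last by lia.
  apply: sp => //; apply: nearby_le nuv.
  by move: (_ * bb) nb0 B_big' => q; have := bb0; have := s0; lia.
move=> v wv nuv; have := nuv l; rewrite subE; have : s < `|u 0 l - v 0 l|; last by lia.
have [[]|[far _]] := st l u wu; first by rewrite mem_enum.
apply: far => //; apply: nearby_le nuv.
by move: (_ * bb) nb0 B_big' => q; have := bb0; have := s0; lia.
Qed.

End Displacement.
End Scale.

(** * The array of partitions *)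

Section Columns.
Variables (R : realType) (n : nat).
Notation Z := 'rV[int]_n.
Implicit Types (x y : config n) (g h u v z p : Z) (l t : 'I_n).
Implicit Types (om : config n -> 'I_n -> Prop) (lam : config n -> Z).
Hypothesis n0 : (0 < n)%N.

Let balls := @balls R n.
Let M := (51 ^ n)%N.
Let NC := NC n M.
(** At most [n + 1] labels are felt near a point, each with at most [NC] hyperplanes; the factor
    [51 ^ n] in [NC] is the packing bound for markers within [25 * B]. *)
Let NO := ((n.+1) * NC)%N.

(** What one scale provides, with the markers hidden: starting boxes, and displacement of a
    partition away from itself and from boundedly many obstacles. *)
Definition level_ok (s B : int) := [/\ s <= B,
  exists lam, [/\ offset lam, balls lam, few NC (16 * B) (walls lam) &
    forall x l u v, free_part x -> frame (walls lam) x l u -> frame (walls lam) x l v ->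
      nearby s (u - v) -> u 0 l = v 0 l] &
  forall omR omO lam, lc omR -> lc omO ->
    (forall x l u v, free_part x -> frame omR x l u -> frame omR x l v ->
       nearby (40 * B) (u - v) -> u 0 l = v 0 l) ->
    few NO (15 * B) omO -> offset lam -> balls lam -> walls lam = omR ->
    exists lam', [/\ offset lam', balls lam', few NC (16 * B) (walls lam'),
      forall x, free_part x -> follows (8 * B) (frame (walls lam') x) (frame omR x) &
      forall x, free_part x -> forall l u, frame (walls lam') x l u ->
        (forall v, frame (walls lam') x l v -> nearby s (u - v) -> u 0 l = v 0 l) /\
        (forall v, frame omO x l v -> ~ nearby s (v - u))]].

Lemma scale_markers (B : int) : 0 < B -> exists mu : config n -> Prop, [/\ lc mu,
  forall x, free_part x -> exists2 g, nearby B g & mu (act g x) &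
  forall x, free_part x -> exists L : seq Z, (size L <= M)%N /\
    forall g, nearby (25 * B) g -> mu (act g x) -> g \in L].
Proof.
move=> B0; have [mu [lmu sep cov]] := markers n B0; exists mu; split=> // x fx.
have [|L [sL HL]] := @packing n B 25 (fun z => mu (act z x)) 0 B0.
  move=> g h mg mh gh ng; apply: (sep _ (h - g) (free_act (g := g) fx) mg).
  - by rewrite actD subrK.
  - by move=> /subr0_eq hg; apply: gh.
  exact: nearby_sym.
exists L; split=> // g ng mg; apply: HL => //; rewrite subr0.
by apply: nearby_le ng; lia.
Qed.

(** All counts depend on [n] only, so there is no circularity in taking [bb] from [s] and then [B]
    from [bb]. *)
Lemma level s : 0 < s -> exists B, level_ok s B.
Proof.
move=> s0; pose bb : int := s + 2 + (NA n M NO + M)%N%:Z * (2 * s + 1).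
have bb0 : s < bb.
  have : 0 <= (NA n M NO + M)%N%:Z * (2 * s + 1) by apply: mulr_ge0; lia.
  by rewrite /bb; move: (_ * _ : int) => q; lia.
pose q1 : int := (n * (2 * NA n M NO) + M * (n * 4))%N%:Z * (2 * bb + 1).
have q10 : 0 <= q1 by apply: mulr_ge0; lia.
have nb0 : 0 <= n%:Z * bb by apply: mulr_ge0; lia.
pose B : int := 1 + q1 + (2 * (n%:Z * bb) + bb).
have B0 : 0 < B by rewrite /B; move: (_ * bb) nb0 => q; lia.
have B1 : 1 + q1 <= B by rewrite /B; move: (_ * bb) nb0 => q; lia.
have B2 : 2 * (n%:Z * bb) + bb < B by rewrite /B; lia.
have sB : s <= B by move: (_ * bb) nb0 B2 => q; lia.
have [mu [lmu cov packed]] := scale_markers B0.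
exists B; split=> //.
  exact: (cells R n0 s0 (lexx bb) B1 B2 lmu cov packed).
move=> omR omO lam lR lO uR fO ol bl wl.
exact: (displace n0 s0 (lexx bb) B1 B2 lmu cov packed lR lO uR fO ol bl wl).
Qed.

Lemma lc_exists (f : nat -> config n -> 'I_n -> Prop) k : (forall i, lc (f i)) ->
  lc (fun x l => exists2 i, (i < k)%N & f i x l).
Proof.
move=> lf; elim: k => [|k IH].
  have -> : (fun x l => exists2 i, (i < 0)%N & f i x l) = (fun _ _ => False).
    by apply/funext => x; apply/funext => l; apply/propext; split=> // -[].
  exact: lc_cst.
have -> : (fun x l => exists2 i, (i < k.+1)%N & f i x l) =
    (fun x l => (exists2 i, (i < k)%N & f i x l) \/ f k x l).
  apply/funext => x; apply/funext => l; apply/propext; split=> [[i ik fi]|[[i ik fi]|fk]].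
  - move: ik; rewrite ltnS leq_eqVlt => /orP [/eqP ik|ik]; first by right; rewrite -ik.
    by left; exists i.
  - by exists i => //; apply: ltnW.
  by exists k.
pose P := 'I_n -> Prop.
exact: (@lc_comp n P _ _ (fun (p : P * P) l => p.1 l \/ p.2 l) (lc_pair IH (lf k))).
Qed.

Variables sig Bs : nat -> int.
Hypothesis sig0 : forall j, 0 < sig j.
Hypothesis sigS : forall j, sig j.+1 = 50 * Bs j.
Hypothesis sigB : forall j, level_ok (sig j) (Bs j).

Implicit Types (F : nat -> nat -> config n -> Z) (C : nat -> config n -> Z).

(* F i j is the partition of label i at level j, and C the column of label m. *)
Definition level_inv m F C j := [/\ offset (C j), balls (C j), few NC (16 * Bs j) (walls (C j)),
  forall x, free_part x -> forall l u, frame (walls (C j)) x l u ->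
    (forall v, frame (walls (C j)) x l v -> nearby (sig j) (u - v) -> u 0 l = v 0 l) /\
    (forall i v, (j <= i < m)%N -> frame (walls (F i j)) x l v -> ~ nearby (sig j) (v - u)) &
  (j < m)%N -> forall x, free_part x ->
    follows (8 * Bs j) (frame (walls (C j)) x) (frame (walls (C j.+1)) x)].

Definition column_inv m F := forall j, (j <= m)%N -> level_inv m F (F m) j.

Let Bs0 j : 0 < Bs j.
Proof. by have [le _ _] := sigB j; have := sig0 j; lia. Qed.

(** The count must not grow with [m]. A nearby wall of label [i > j] is traced by [follows] to a
    wall of the same label at level [j.+1], and there each direction admits only one label; label
    [j] itself is counted apart. *)
Let obstacles_few m F j : (j < m)%N -> (forall i, (i < m)%N -> column_inv i F) ->
  few NO (15 * Bs j) (fun x l => exists2 i, (i < m)%N & (j <= i)%N /\ walls (F i j) x l).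
Proof.
move=> jm cF x fx l; have B0 := Bs0 j.
(* An obstacle within 15 B_j is within 8 B_j of its predecessor, which is therefore within 24 B_j.
   Two such predecessors are at most 48 B_j apart, less than the separation 50 B_j of level
   [j.+1]. *)
pose act_lab t i := [/\ (j < i)%N, (i < m)%N &
  exists2 v, nearby (24 * Bs j) v & frame (walls (F i j.+1)) x t v].
have lab_uniq t i i' : act_lab t i -> act_lab t i' -> (i < i')%N -> False.
  move=> [ji im [v nv wv]] [ji' im' [v' nv' wv']] ii'.
  have [_ _ _ gen _] := cF i' im' j.+1 ji'.
  have [_ no] := gen x fx t v' wv'; apply: (no i v _ wv); first by rewrite ji ii'.
  by rewrite sigS => k; have := nv k; have := nv' k; rewrite subE; lia.
have lst i : exists L : seq int, (i < m)%N -> (j <= i)%N -> (size L <= NC)%N /\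
    forall u, nearby (15 * Bs j) u -> frame (walls (F i j)) x l u -> u 0 l \in L.
  have [[im ji]|no] := pselect ((i < m)%N /\ (j <= i)%N); last first.
    by exists [::] => im ji; case: no.
  have [_ _ fw _ _] := cF i im j ji; have [L [sL HL]] := fw x fx l; exists L => _ _; split=> // u nu.
  by apply: HL; apply: nearby_le nu; lia.
pose L i := projT1 (cid (lst i)).
have LP i : (i < m)%N -> (j <= i)%N -> (size (L i) <= NC)%N /\
    forall u, nearby (15 * Bs j) u -> frame (walls (F i j)) x l u -> u 0 l \in L i.
  exact: projT2 (cid (lst i)).
pose Lt t := if pselect (exists i, act_lab t i) is left e then L (projT1 (cid e)) else [::].
exists (L j ++ flatten [seq Lt t | t <- enum 'I_n]); split.
  rewrite /NO mulSn size_cat leq_add //; first by have [] := LP j jm (leqnn j).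
  apply: (@leq_trans (size (enum 'I_n) * NC)); last by rewrite size_enum_ord.
  apply: size_flatten_le => t; rewrite /Lt.
  case: pselect => // e; case: cid => i [ji im _] /=.
  by have [] := LP i im (ltnW ji).
move=> u nu [i im [ji wu]]; rewrite mem_cat; apply/orP.
move: ji; rewrite leq_eqVlt => /orP [/eqP ij|ji].
  by subst i; left; have [_ H] := LP j jm (leqnn j); exact: H.
right; have [_ _ _ _ fol] := cF i im j (ltnW ji).
have [t [v [wv nv]]] := fol ji x fx l u wu.
have ai : act_lab t i.
  by split=> //; exists v => // k; have := nv k; have := nu k; rewrite subE; lia.
apply/flatten_mapP; exists t; first by rewrite mem_enum.
rewrite /Lt; case: pselect => [e|[]]; last by exists i.
case: cid => i' ai' /=; have -> : i' = i.
  have [lt|gt|//] := ltngtP i' i; [by case: (lab_uniq t _ _ ai' ai)|by case: (lab_uniq t _ _ ai ai')].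
by have [_ H] := LP i im (ltnW ji); exact: H.
Qed.

Lemma next_column m F : (forall i, (i < m)%N -> column_inv i F) ->
  exists C, forall j, (j <= m)%N -> level_inv m F C j.
Proof.
move=> cF; suff H k : (k <= m)%N -> exists C, forall j, (m - k <= j <= m)%N -> level_inv m F C j.
  by have [C HC] := H m (leqnn m); exists C => j jm; apply: HC; rewrite subnn.
elim: k => [_|k IH km].
  have [_ [lam [ol bl fl un]] _] := sigB m; exists (fun _ => lam) => j.
  rewrite subn0 => jm; have -> : j = m by lia.
  split=> //; last by rewrite ltnn.
  by move=> x fx l u wu; split=> [v wv|i v]; [exact: (un x l u v fx wu wv)|rewrite ltnNge andbN].
have [C HC] := IH (ltnW km); pose j := (m - k.+1)%N.
have jm : (j < m)%N by rewrite /j; lia.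
have [ol bl fl un _] : level_inv m F C j.+1 by apply: HC; rewrite /j; lia.
have [_ _ disp] := sigB j.
have lO : lc (fun x l => exists2 i, (i < m)%N & (j <= i)%N /\ walls (F i j) x l).
  pose f i : config n -> 'I_n -> Prop :=
    if (j <= i < m)%N then walls (F i j) else fun _ _ => False.
  have -> : (fun x l => exists2 i, (i < m)%N & (j <= i)%N /\ walls (F i j) x l) =
      (fun x l => exists2 i, (i < m)%N & f i x l).
    apply/funext => x; apply/funext => l; apply/propext; rewrite /f.
    split=> [[i im [ji w]]|[i im]]; first by exists i; rewrite ?ji ?im.
    by case: ifP => // /andP [ji _] w; exists i.
  apply: lc_exists => i; rewrite /f; case: ifP => [/andP [ji im]|_]; last exact: lc_cst.
  by have [[lF _] _ _ _ _] := cF i im j ji; exact: lc_walls.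
have [lC _] := ol.
have uR x l u v : free_part x -> frame (walls (C j.+1)) x l u -> frame (walls (C j.+1)) x l v ->
    nearby (40 * Bs j) (u - v) -> u 0 l = v 0 l.
  move=> fx wu wv nuv; have [H _] := un x fx l u wu; apply: H => //.
  by rewrite sigS; apply: nearby_le nuv; have := Bs0 j; lia.
have [lam' [ol' bl' fl' fw' gen]] := disp _ _ _ (lc_walls lC) lO uR (obstacles_few jm cF) ol bl erefl.
exists (fun i => if i == j then lam' else C i) => i ir.
have [ij|ij] := eqVneq i j; last first.
  have [a1 a2 a3 a4 a5] : level_inv m F C i by apply: HC; move: ij ir; rewrite /j; lia.
  rewrite /level_inv (negbTE ij); split=> // im.
  have -> : (i.+1 == j) = false by move: ir; rewrite /j; lia.
  exact: a5.
subst i; rewrite /level_inv eqxx; have -> : (j.+1 == j) = false by lia.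
split=> // x fx l u wu; have [g1 g2] := gen x fx l u wu; split=> // i v /andP [ji im] wv.
by apply: g2; exists i.
Qed.

Lemma columns : exists F, forall m, column_inv m F.
Proof.
have ex (mF : nat * (nat -> nat -> config n -> Z)) : exists C,
    (forall i, (i < mF.1)%N -> column_inv i mF.2) ->
    forall j, (j <= mF.1)%N -> level_inv mF.1 mF.2 C j.
  have [/next_column [C HC]|no] := pselect (forall i, (i < mF.1)%N -> column_inv i mF.2).
    by exists C => _.
  by exists (fun _ _ => 0).
have [c cP] := choice ex.
(* [H k] is the array with its first [k] columns filled in. Later stages leave these columns alone,
   so the diagonal [F] agrees with [H k] below [k]. *)
pose H := fix H k := if k is k'.+1 then fun i => if i == k' then c (k', H k') else H k' i
  else fun _ _ _ => 0.
pose F m := H m.+1 m.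
have HF k i : (i < k)%N -> H k i = F i.
  elim: k => // k IH; rewrite ltnS leq_eqVlt /= => /orP [/eqP ->|ik].
    by rewrite /F /= eqxx.
  by rewrite (ltn_eqF ik) IH.
have ext m G G' C : (forall i, (i < m)%N -> G i = G' i) -> forall j, level_inv m G C j ->
    level_inv m G' C j.
  move=> e j [a1 a2 a3 a4 a5]; split=> // x fx l u wu; have [g1 g2] := a4 x fx l u wu.
  by split=> // i v jim; rewrite -e; [exact: g2|case/andP: jim].
exists F => m; elim/ltn_ind: m => m IH.
have FE : F m = c (m, H m) by rewrite /F /= eqxx.
rewrite /column_inv FE => j jm; apply: (ext m (H m)); first by move=> i; exact: HF.
apply: (cP (m, H m)) => //= i im i' i'i; rewrite HF //.
by apply: (ext i F); [move=> k ki; rewrite HF //; exact: ltn_trans im|exact: IH].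
Qed.

End Columns.

Lemma generic_partitions (R : realType) (n : nat) (s : int) : (0 < n)%N -> 0 < s ->
  exists lam : nat -> config n -> 'rV[int]_n, [/\ forall m, offset (lam m),
    forall m, balls R (lam m) &
    forall x m m' l u v, free_part x -> frame (walls (lam m)) x l u ->
      frame (walls (lam m')) x l v -> nearby s (u - v) -> m = m' /\ u 0 l = v 0 l].
Proof.
move=> n0 s0.
have [Bf BfP] : exists Bf : int -> int, forall r, 0 < r -> level_ok R n r (Bf r).
  have ex (r : int) : exists B, 0 < r -> level_ok R n r B.
    have [r0|nr] := pselect (0 < r); last by exists 0.
    by have [B HB] := level R n0 r0; exists B.
  by have [Bf H] := choice ex; exists Bf.
(* Level 0 has the prescribed separation [s], and scales grow with the level; the coarse levels
   serve only to construct the partitions of level 0. *)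
pose sig := fix sig j := if j is j'.+1 then 50 * Bf (sig j') else s.
have sig0 j : 0 < sig j.
  by elim: j => //= j IH; have [le _ _] := BfP _ IH; lia.
have [F HF] := @columns R n n0 sig (fun j => Bf (sig j)) sig0 (fun _ => erefl) (fun j => BfP _ (sig0 j)).
exists (fun m => F m 0%N); split=> [m|m|x m m' l u v fx wu wv nuv].
- by have [] := HF m 0%N (leq0n m).
- by have [] := HF m 0%N (leq0n m).
have [mm|mm|mm] := ltngtP m m'.
- have [_ _ _ gen _] := HF m' 0%N (leq0n m').
  by have [_ no] := gen x fx l v wv; case: (no m u mm wu).
- have [_ _ _ gen _] := HF m 0%N (leq0n m).
  by have [_ no] := gen x fx l u wu; case: (no m' v mm wv); exact: nearby_sym.
subst m'; split=> //; have [_ _ _ gen _] := HF m 0%N (leq0n m).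
by have [H _] := gen x fx l u wu; exact: H.
Qed.

(** * Rectangles *)

Section Tiling.
Variables (n d : nat).
Notation Z := 'rV[int]_n.
Implicit Types (x y : config n) (g h u v z p : Z) (l t : 'I_n) (Q : set (config n)).
Hypothesis d2 : (2 <= d)%N.

Let tiled Q := disjoint_union_of_rectangles d Q.

Lemma tiled0 : tiled set0.
Proof.
exists 0%N, (fun _ => set0); split; first by case.
  by move=> [].
by rewrite bigcup0.
Qed.

Lemma tiledU Q Q' : Q `&` Q' = set0 -> tiled Q -> tiled Q' -> tiled (Q `|` Q').
Proof.
move=> dis [N [A [rA tA e]]] [N' [A' [rA' tA' e']]]; rewrite e e' in dis *.
pose C (k : 'I_(N + N')) := match fintype.split k with inl i => A i | inr i => A' i end.
exists (N + N')%N, C; split=> [k|k k' _ _ [x [Ck Ck']]|].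
- by rewrite /C; case: (fintype.split k).
- have no i i' : A i x -> A' i' x -> False.
    by move=> a a'; have : set0 x by rewrite -dis; split; [exists i|exists i'].
  move: Ck Ck'; rewrite /C -{2}(splitK k) -{2}(splitK k').
  case: (fintype.split k) (fintype.split k') => i [] i' /= a a'.
  + by congr lshift; apply: tA => //; exists x.
  + by case: (no _ _ a a').
  + by case: (no _ _ a' a).
  by congr rshift; apply: tA' => //; exists x.
apply/seteqP; split=> [x [[i _ ai]|[i _ ai]]|x [k _]].
- by exists (unsplit (inl i)) => //; rewrite /C unsplitK.
- by exists (unsplit (inr i)) => //; rewrite /C unsplitK.
by rewrite /C; case: (fintype.split k) => i ai; [left|right]; exists i.
Qed.

Definition orbit_box x (lo hi : Z) : set (config n) :=
  [set act g x | g in [set g : Z | forall l, lo 0 l <= g 0 l < hi 0 l]].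

(** The least number of lattice points along an admissible side: a side with L points has length L -
    1, which must be at least d / 2. *)
Let q : int := (uphalf d).+1%:Z.

Let q_rng : d%:Z + 2 <= 2 * q <= d%:Z + 3 /\ q <= d%:Z.
Proof.
rewrite /q uphalf_half; have := odd_double_half d; rewrite -muln2; move: d2.
by case: (odd d) => /=; move: (d./2) => k; lia.
Qed.

(* A side longer than d + 1 is cut so that the rest is not of length d + 2,
   which for odd d could not be cut further. *)
Lemma tiled_box x (lo hi : Z) : free_part x -> (forall l, 2 * q <= hi 0 l - lo 0 l) ->
  tiled (orbit_box x lo hi).
Proof.
move=> fx long; have [qd qd'] := q_rng.
have {long} : forall l, (q <= hi 0 l - lo 0 l <= d%:Z + 1) \/ 2 * q <= hi 0 l - lo 0 l by auto.
have [k] : exists k, (\sum_l absz (hi 0%R l - lo 0%R l) < k)%N by exists (\sum_l absz (hi 0%R l - lo 0%R l)).+1.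
elim: k lo hi => // k IH lo hi lek inv.
have [[l ll]|short] := pselect (exists l, d%:Z + 1 < hi 0 l - lo 0 l); last first.
  exists 1%N, (fun _ => orbit_box x lo hi); split=> [_|i j _ _ _|].
  - exists x, lo, (\row_l (hi 0 l - 1)); split.
      congr image; apply/seteqP; split=> g H l; have := H l; rewrite mxE; lia.
    move=> l; rewrite mxE; have : hi 0 l - lo 0 l <= d%:Z + 1.
      by rewrite leNgt; apply/negP => c; apply: short; exists l.
    by have := inv l; lia.
  - by rewrite (ord1 i) (ord1 j).
  by apply/seteqP; split=> [y Hy|y [i _ //]]; exists ord0.
pose c : int := lo 0 l + if hi 0 l - lo 0 l - q == d%:Z + 2 then q + 1 else q.
have c_rng : [/\ lo 0 l < c < hi 0 l, q <= c - lo 0 l <= d%:Z + 1 &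
    (q <= hi 0 l - c <= d%:Z + 1) \/ 2 * q <= hi 0 l - c].
  by have := inv l; rewrite /c; case: eqP => e; split; lia.
have [c1 c2 c3] := c_rng.
have -> : orbit_box x lo hi = orbit_box x lo (upd hi l c) `|` orbit_box x (upd lo l c) hi.
  apply/seteqP; split=> [y [g H <-]|y [[g H <-]|[g H <-]]].
  - have [lt|ge] := ltP (g 0 l) c; [left|right]; exists g => // j; have := H j; rewrite updE.
      by case: eqP => [->|_]; lia.
    by case: eqP => [->|_]; lia.
  - by exists g => // j; have := H j; rewrite updE; case: eqP => [->|_]; lia.
  by exists g => // j; have := H j; rewrite updE; case: eqP => [->|_]; lia.
have sum_lt (lo' hi' : Z) : (forall j, j != l -> hi' 0 j - lo' 0 j = hi 0 j - lo 0 j) ->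
    (absz (hi' 0%R l - lo' 0%R l) < absz (hi 0%R l - lo 0%R l))%N ->
    (\sum_j absz (hi' 0%R j - lo' 0%R j) < k)%N.
  move=> e lt; apply: leq_trans (_ : \sum_j absz (hi 0%R j - lo 0%R j) <= k)%N; last by [].
  rewrite (bigD1 l) //= [in leqRHS](bigD1 l) //= -addSn leq_add //.
  by apply: leq_sum => j jl; rewrite e.
apply: tiledU.
- apply/seteqP; split=> // y [[g H <-] [h H' /(act_inj fx) e]].
  by have := H l; have := H' l; rewrite e !updE eqxx; lia.
- apply: IH => [|j].
    apply: sum_lt => [j jl|]; first by rewrite updE (negbTE jl).
    by rewrite updE eqxx; move: c1; clear; lia.
  by rewrite updE; case: eqP => [->|_]; [left|exact: inv].
apply: IH => [|j].
  apply: sum_lt => [j jl|]; first by rewrite updE (negbTE jl).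
  by rewrite updE eqxx; move: c1; clear; lia.
by rewrite updE; case: eqP => [->|_]; [exact: c3|exact: inv].
Qed.

(** Fresh cubes, whose sides avoid the walls of the partition, cut every orbit together with these
    walls into boxes with sides longer than [2 * q]. Each region is a finite union of such boxes,
    and each box can be tiled by [tiled_box]. *)
Lemma tiled_classes : (0 < n)%N -> exists s : int, 0 < s /\ forall lam, offset lam ->
  (forall x l u v, free_part x -> frame (walls lam) x l u -> frame (walls lam) x l v ->
     nearby s (u - v) -> u 0 l = v 0 l) ->
  forall x p, free_part x -> tiled [set act g x | g in [set g | colour lam x g = p]].
Proof.
move=> n0; pose b : int := 2 * q; have b0 : 0 <= b by rewrite /b /q; lia.
pose e : int := (n * (2 * 1) + 51 ^ n * (n * 4))%N%:Z * (2 * b + 1).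
have e0 : 0 <= e by apply: mulr_ge0; lia.
pose B : int := 1 + e + b.
have B0 : 0 < B by rewrite /B; lia.
have bB : 0 <= b < B by rewrite /B; lia.
have be : 1 + e <= B by rewrite /B; lia.
exists (40 * B); split=> [|lam ol uniq x p fx]; first by lia.
have [ll _] := ol; have lw := lc_walls ll.
have [mu [lmu cov packed]] := scale_markers n0 B0.
have packed20 y : free_part y -> exists L : seq Z, (size L <= 51 ^ n)%N /\
    forall g, nearby (20 * B) g -> mu (act g y) -> g \in L.
  move=> /packed [L [sL HL]]; exists L; split=> // g ng; apply: HL.
  by apply: nearby_le ng; lia.
have fw : few 1 (15 * B) (walls lam).
  apply: few_uniq => y l u v fy wu wv nuv; apply: (uniq y l u v fy wu wv).
  by apply: nearby_le nuv; lia.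
have [a la aP] := choose_sides (ltW B0) b0 lmu lw packed20 fw be.
pose mk z := mu (act z x); pose aF z := a (act z x); pose id z := priority (20 * B) (act z x).
have [a1 a2 a3] := aP x fx.
have mk_cov g : exists2 z, mk z & nearby B (z - g).
  have [z nz mz] := cov _ (free_act (g := g) fx).
  by exists (z + g); [rewrite /mk -actD|rewrite addrK].
have id_inj z z' : mk z -> mk z' -> z <> z' -> nearby (20 * B) (z - z') -> id z <> id z'.
  move=> mz mz' ne nz; have D0 : 0 <= 20 * B by lia.
  have := priority_neq D0 (free_act (g := z') fx) nz; rewrite actD subrK; apply.
  by move=> /subr0_eq.
have a_rng z : mk z -> B < aF z <= 2 * B by move=> _; exact: a1.
pose wR := frame (walls lam) x.
have R_uniq l u v : wR l u -> wR l v -> nearby (40 * B) (u - v) -> u 0 l = v 0 l by exact: uniq.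
have R_avoid l z u (v : int) : mk z -> sideplane aF z l v -> wR l u -> nearby (15 * B) (u - z) ->
    b < `|v - u 0 l| by move=> _; exact: a2.
have sides z z' l (v v' : int) : mk z -> mk z' -> z <> z' -> nearby (20 * B) (z - z') ->
  sideplane aF z l v -> sideplane aF z' l v' -> b < `|v - v'| by exact: a3.
pose lo' g : Z := \row_l lo B mk aF id wR g l; pose hi' g : Z := \row_l hi B mk aF id wR g l.
have boxE g : orbit_box x (lo' g) (hi' g) = [set act h x | h in box B mk aF id wR g].
  by congr image; apply/seteqP; split=> h H l; have := H l; rewrite !mxE.
have tb g : tiled (orbit_box x (lo' g) (hi' g)).
  apply: tiled_box => // l; rewrite !mxE.
  by have := box_side B0 bB mk_cov a_rng sides id_inj R_uniq R_avoid g l; lia.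
have tl (L : seq Z) : tiled (\bigcup_(g in [set` L]) orbit_box x (lo' g) (hi' g)).
  elim: L => [|g L IH]; first by rewrite set_nil bigcup_set0; exact: tiled0.
  have -> : [set` g :: L] = g |` [set` L].
    apply/seteqP; split=> h /=; rewrite inE; first by move=> /orP [/eqP ->|]; [left|right].
    by move=> [->|->]; rewrite ?eqxx ?orbT.
  rewrite bigcup_setU1.
  have [[g' g'L bg]|no] := pselect (exists2 g', g' \in L & box B mk aF id wR g' g).
    suff -> : orbit_box x (lo' g) (hi' g) `|` \bigcup_(g in [set` L]) orbit_box x (lo' g) (hi' g) =
        \bigcup_(g in [set` L]) orbit_box x (lo' g) (hi' g) by [].
    apply/setUidPr => y; rewrite boxE => -[h bh <-]; exists g' => //; rewrite boxE; exists h => //.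
    exact: (box_trans B0 bB mk_cov a_rng id_inj bg bh).
  apply: tiledU => //; apply/seteqP; split=> // y [].
  rewrite boxE => -[h bh <-] [g' g'L]; rewrite boxE => -[h' bh' /(act_inj fx) hh].
  rewrite hh in bh'; case: no; exists g' => //.
  apply: (box_trans B0 bB mk_cov a_rng id_inj bh').
  exact: (box_sym B0 bB mk_cov a_rng id_inj bh).
have [r bd] := colour_bounded ol p.
have -> : [set act g x | g in [set g | colour lam x g = p]] =
    \bigcup_(g in [set` [seq g <- win n (absz r) | `[< colour lam x g = p >]]]) orbit_box x (lo' g) (hi' g).
  apply/seteqP; split=> y.
    move=> [g gp <-]; exists g.
      rewrite /= mem_filter; apply/andP; split; first exact/asboolP.
      by apply/mem_win => l; have := bd x g fx gp l; lia.
    by rewrite boxE; exists g => //; exact: (box_refl id wR B0 bB mk_cov a_rng).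
  move=> [g /=]; rewrite mem_filter => /andP [/asboolP gp _]; rewrite boxE => -[h bh <-].
  exists h => //=; rewrite -gp; apply: esym.
  apply: (corner_refines B0 bB mk_cov a_rng) bh => l u; by rewrite wall_frame.
exact: tl.
Qed.

End Tiling.

(** * Regions *)

Section Regions.
Variables (R : realType) (n : nat).
Notation Z := 'rV[int]_n.
Implicit Types (x y : config n) (g h u v z p : Z) (l t : 'I_n) (Q : set (config n)).
Implicit Types (lam : config n -> Z).

Lemma nbhs_agree k x : nbhs x [set x' | agree k x x'].
Proof.
have H (L : seq Z) : nbhs x [set x' : config n | forall h, h \in L -> x h = x' h].
  elim: L => [|h L IH]; first by apply: filterE.
  have N : nbhs x [set x' : config n | x h = x' h].
    have d : nbhs (x h : bool) [set b : bool | x h = b].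
      have -> : [set b : bool | x h = b] = [set x h] by apply/seteqP; split=> b ->.
      exact: discrete_set1.
    exact: (@proj_continuous Z (fun=> bool) h x _ d).
  apply: filterS2 N IH => x' e HL h'; rewrite inE => /orP [/eqP -> //|]; exact: HL.
by apply: filterS (H (win n k)) => x' Hx' h nh; apply: Hx'; apply/mem_win.
Qed.

(** Points outside the free part are isolated in the subspace topology, so a window is required at
    free points only. *)
Lemma open_local (U : set (config n)) :
  (forall x, free_part x -> U x -> exists k, forall x', free_part x' -> agree k x x' -> U x') ->
  open (U : set (subspace (@free_part n))).
Proof.
move=> loc; rewrite openE => x Ux; rewrite /interior /nbhs /=.
have [fx|nfx] := pselect (free_part x); last by rewrite -nbhs_subspace_out // => _ ->.
rewrite -nbhs_subspace_in //; have [k Hk] := loc x fx Ux.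
by apply: filterS (nbhs_agree k x) => x' ag fx'; exact: Hk.
Qed.

Lemma clopen_lc (f : config n -> Prop) : lc f ->
  clopen ([set x | free_part x /\ f x] : set (subspace (@free_part n))).
Proof.
move=> lf; split.
  apply: open_local => x fx [_ fx0]; have [k Hk] := lf x fx; exists k => x' fx' ag.
  by split=> //; rewrite Hk.
rewrite -openC; apply: open_local => x fx nf; have [k Hk] := lf x fx; exists k => x' fx' ag.
by move=> [_]; rewrite Hk // => fx0; apply: nf.
Qed.

Definition region lam x : set (config n) :=
  [set act g x | g in [set g | colour lam x g = colour lam x 0]].

Lemma region_refl lam x : region lam x x.
Proof. by exists 0; rewrite ?act0. Qed.

Lemma region_act lam x h : region lam (act h x) =
  [set act g x | g in [set g | colour lam x g = colour lam x h]].
Proof.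
apply/seteqP; split=> y [g /= e <-].
  exists (g + h); last by rewrite actD.
  by move: e; rewrite /= !colour_act add0r => /addIr.
exists (g - h); last by rewrite actD subrK.
by rewrite /= !colour_act subrK add0r e.
Qed.

Lemma region_eq lam x y : region lam x y -> region lam y = region lam x.
Proof. by move=> [g e <-]; rewrite region_act e. Qed.

Lemma region_clopen lam : offset lam ->
  clopen_partition [set Q | exists2 x, free_part x & Q = region lam x].
Proof.
move=> ol; have [ll _] := ol; split.
- split.
  + apply/seteqP; split=> x; first by move=> [Q [y fy ->] [g _ <-]]; exact: free_act.
    by move=> fx; exists (region lam x); [exists x|exact: region_refl].
  + move=> Q Q' [x fx ->] [y fy ->] [z [zx zy]].
    by rewrite -(region_eq zx) -(region_eq zy).
  by move=> Q [x fx ->]; exists x; exact: region_refl.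
- move=> Q [x fx ->]; split; last by exists x => y [g _ <-]; exists g.
  apply: finite_image; have [b bd] := colour_bounded ol (colour lam x 0).
  apply: (@sub_finite_set _ _ [set` win n (absz b)]); last exact: finite_seq.
  by move=> g gp; apply/mem_win => l; have := bd x g fx gp l; lia.
move=> g; have -> : [set x | exists2 Q, [set Q | exists2 x, free_part x & Q = region lam x] Q & Q x /\ Q (act g x)]
    = [set x | free_part x /\ colour lam x g = colour lam x 0].
  apply/seteqP; split=> x.
    move=> [_ [y fy ->] [yx ygx]].
    have fx : free_part x by have [h _ <-] := yx; exact: free_act.
    split=> //; move: ygx; rewrite -(region_eq yx) => -[h e /(act_inj fx) hg].
    by rewrite -hg.
  move=> [fx e]; exists (region lam x); first by exists x.
  by split; [exact: region_refl|exists g].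
apply: clopen_lc; pose r : int := \sum_l `|g 0 l|.
have ng : nearby r g.
  move=> l; have : `|g 0 l| <= r by rewrite /r (bigD1 l) //= lerDl sumr_ge0.
  by lia.
have r0 : 0 <= r by apply: sumr_ge0.
apply: (lc_local (r := r) ll) => x x' _ _ e.
by rewrite /colour (e _ ng) (e _ (nearby0 r0)).
Qed.

(** Passing from the base point [x] to another base point [y] of the orbit turns the region into a
    colour class of the colouring read from [y]; the walls of regions in one orbit are then walls in
    one frame. *)
Lemma region_realization lam x y : free_part x -> region lam x `<=` Zn_orbit y ->
  exists p, [/\ free_part y, (exists g, colour lam y g = p) &
    realization R y (region lam x) = @cubes R n [set g | colour lam y g = p]].
Proof.
move=> fx /(_ x (region_refl lam x)) [h _ e]; rewrite -e in fx *.
have fy : free_part y by have := free_act (g := - h) fx; rewrite actD addNr act0.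
exists (colour lam y h); split=> //; first by exists h.
rewrite region_act /realization /cubes; congr (\bigcup_(g in _) _).
by apply/seteqP; split=> g /=; [move=> [g' e' /(act_inj fy) <-]|move=> e'; exists g].
Qed.

Lemma wall_region lam y p l g : wall [set g | colour lam y g = p] l g -> frame (walls lam) y l g.
Proof. by rewrite -wall_frame => w e; apply: w; rewrite /= e. Qed.

End Regions.

Theorem theorem2p5 (R : realType) (n : nat) (hn : (2 <= n)%N) :
  exists eps K : R, 0 < eps /\
  forall d : nat -> nat,
    (0 < d 0)%N ->
    (forall k, (d k < d k.+1)%N) ->
    (forall k, K * (d k)%:R < (d k.+1)%:R) ->
  exists P : nat -> nat -> set (set (config n)),
    orthogonality_properties eps d P /\
    forall m : nat, (1 <= m)%N ->
    forall Q : set (config n), P m 1%N Q ->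
    forall y : config n, Q `<=` Zn_orbit y ->
      [/\ connected (realization R y Q),
          connected (boundary (realization R y Q))
        & homeomorphic (realization R y Q) (closed_unit_ball R n)].
Proof.
have n0 : (0 < n)%N by exact: ltnW.
(* The separation of walls can be prescribed in advance, and it is taken larger than [d k]; so 1 is
   a possible [eps]. *)
exists 1, 1; split=> // d d0 dS _.
have d2 k : (1 <= k)%N -> (2 <= d k)%N.
  by elim: k => // -[|k] IH _; [have := dS 0%N; lia|have := dS k.+1; have := IH isT; lia].
have ex k : exists lam : nat -> config n -> 'rV[int]_n, (1 <= k)%N ->
    [/\ forall m, offset (lam m), forall m, balls R (lam m),
      forall x m m' l u v, free_part x -> frame (walls (lam m)) x l u ->
        frame (walls (lam m')) x l v -> nearby (6 * (d k)%:Z + 20) (u - v) ->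
        m = m' /\ u 0 l = v 0 l &
      forall m x p, free_part x ->
        disjoint_union_of_rectangles (d k) [set act g x | g in [set g | colour (lam m) x g = p]]].
  have [k1|k0] := leqP 1 k; last by exists (fun _ _ => 0).
  have [s [s0 tile]] := tiled_classes (d2 k k1) n0.
  (* One separation serves all purposes: [s] is needed for the cutting into rectangles, and
     [6 * d k + 20] by [faces_near], which also exceeds the [d k + 1] of [faces_far]. *)
  have S0 : 0 < s + (6 * (d k)%:Z + 20) by lia.
  have [lam [ol bl gen]] := generic_partitions R n0 S0; exists lam => _; split=> //.
    move=> x m m' l u v fx wu wv nuv; apply: (gen x _ _ l u v fx wu wv).
    by apply: nearby_le nuv; lia.
  move=> m; apply: tile => // x l u v fx wu wv nuv.
  have [|//] := gen x m m l u v fx wu wv.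
  by apply: nearby_le nuv; lia.
have [lam lamP] := choice ex.
(* For [k <= j < m] the labels [m - k] and [j - k] differ, so orthogonality to previous regions
   becomes the separation of different labels in the array for [k]. *)
exists (fun m k => [set Q | exists2 x, free_part x & Q = region (lam k (m - k)%N) x]).
have cube_bound (lm : config n -> 'rV[int]_n) p : offset lm -> exists r, forall x, free_part x ->
    forall g, [set g | colour lm x g = p] g -> nearby r g.
  by move=> ol; have [b bd] := colour_bounded ol p; exists b => x fx g; exact: bd.
split; last first.
  move=> m m1 Q [x fx ->] y /(region_realization R fx) [p [fy ne ->]].
  have [_ bl _ _] := lamP 1%N isT; have ball := bl _ y p fy ne.
  split; [exact: ambient_ball_connected|exact: ambient_ball_boundary|exact: ambient_ball_homeomorphic].
move=> m k /andP [k1 km]; have [ol bl gen tile] := lamP k k1; split.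
- split; first exact: region_clopen.
  by move=> Q [x fx ->]; exact: tile.
- move=> j /andP [kj jm] y Q Q' [x fx ->] [x' fx' ->].
  move=> /(region_realization R fx) [p [fy _ ->]] /(region_realization R fx') [p' [_ _ ->]].
  move=> i F F' fF fF'; rewrite mul1r.
  have [r br] := cube_bound _ p (ol (m - k)%N); have [r' br'] := cube_bound _ p' (ol (j - k)%N).
  apply: (@faces_far R n _ _ i F F' (d k)%:Z (Num.max r r') _ _ _ fF fF') => [g /br|g /br'|g g'].
  + by move=> /(_ fy); apply: nearby_le; lia.
  + by move=> /(_ fy); apply: nearby_le; lia.
  move=> /wall_region wg /wall_region wg' ng.
  have [|mj _] := gen y _ _ i g g' fy wg wg'; first by apply: nearby_le ng; lia.
  by move: mj; lia.
move=> y Q Q' [x fx ->] [x' fx' ->].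
move=> /(region_realization R fx) [p [fy _ ->]] /(region_realization R fx') [p' [_ _ ->]].
move=> i F F' fF fF' n1; rewrite mul1r.
have [r br] := cube_bound _ p (ol (m - k)%N); have [r' br'] := cube_bound _ p' (ol (m - k)%N).
apply: (@faces_near R n _ _ i F F' (d k)%:Z (Num.max r r') _ _ _ _ fF fF' n1) => //.
- by move=> g /br => /(_ fy); apply: nearby_le; lia.
- by move=> g /br' => /(_ fy); apply: nearby_le; lia.
move=> l g g' wg wg' ng.
have w : frame (walls (lam k (m - k)%N)) y l g by case: wg => /wall_region.
have w' : frame (walls (lam k (m - k)%N)) y l g' by case: wg' => /wall_region.
by have [_] := gen y _ _ l g g' fy w w' ng.
Qed.
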